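(* Assume the setting, the assumptions on $F$ and the structural assumptions (i)-(iii) described in the context, and let $u_k$ be generated by the PDAJ algorithm. Then the algorithm either terminates after finitely many steps with $u_k=\bar u$, or there are $\zeta\in(0,1)$ and $c>0$ such that $$ r_j(u_k)+\|u_k-\bar u\|_{L^1}+\big|\|u_k'\|_{\mathcal M}-\|\bar u'\|_{\mathcal M}\big|\le c\,\zeta^k $$ for all $k\in\mathbb N$ large enough.
   Context: Notation. $T>0$, $I=(0,T)$, $d\ge1$. $\mathcal C_0(I;\mathbb R^d)$ is the Banach space of continuous functions $I\to\mathbb R^d$ vanishing at the boundary of $I$, with $\|\varphi\|_{\mathcal C}=\sup_{t\in I}|\varphi(t)|_{\mathbb R^d}$ (Euclidean norm); its dual is the space $\mathcal M(I;\mathbb R^d)$ of vector measures with pairing $\langle\varphi,q\rangle$ and dual norm $\|q\|_{\mathcal M}$. $\mathrm{BV}(I;\mathbb R^d)$ is the space of $u\in L^1(I;\mathbb R^d)$ whose distributional derivative $u'$ lies in $\mathcal M(I;\mathbb R^d)$, with norm $\|u\|_{\mathrm{BV}}=\|u'\|_{\mathcal M}+\|u\|_{L^1}$. $\chi_t$ denotes the characteristic function of $(t,T)$. Problem. $Y$ is a Hilbert space, $K:L^2(I;\mathbb R^d)\to Y$ is linear and continuous with adjoint $K^*$, $F:Y\to\mathbb R$ is strictly convex and continuously Fréchet differentiable with gradient $\nabla F$, $\beta>0$, and $$(\mathcal P)\qquad \min_{u\in \mathrm{BV}(I;\mathbb R^d)} j(u)=F(Ku)+\beta\|u'\|_{\mathcal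 M},$$ where $j$ is radially unbounded: $\|u_k\|_{\mathrm{BV}}\to\infty$ implies $j(u_k)\to+\infty$. Problem $(\mathcal P)$ has a minimizer; all minimizers $\bar u$ share the same observation $\bar y=K\bar u$, hence the same dual variable $\bar p(t)=\int_0^tK^*\nabla F(\bar y)(s)\,ds$. Put $r_j(u)=j(u)-\min j$. Assumptions on $F$. $\nabla F$ is Lipschitz continuous on $Y$ with constant $L>0$, and there are a neighbourhood $\mathcal N(\bar y)$ of $\bar y$ and $\gamma_0>0$ with $F(y)\ge F(\bar y)+(\nabla F(\bar y),y-\bar y)_Y+\gamma_0\|y-\bar y\|_Y^2$ for all $y\in\mathcal N(\bar y)$. Structural assumptions. (i) There are $N\ge1$ and points $\bar t_1,\dots,\bar t_N\in I$ with $\{\bar t_i\}_{i=1}^N=\{t\in I: |\bar p(t)|_{\mathbb R^d}=\|\bar p\|_{\mathcal C}=\beta\}$. (ii) With $e_1,\dots,e_d$ the canonical basis of $\mathbb R^d$ and $\chi_I\equiv1$ on $I$, the family $\{K(\bar p(\bar t_i)\chi_{\bar t_i})\}_{i=1}^N\cup\{K(e_i\chi_I)\}_{i=1}^d$ is linearly independent in $Y$. Under (i),(ii) the minimizer $\bar u$ is unique and $\bar u'=\sum_{i=1}^N\bar\mu_i\bar{\mathbf v}_i\delta_{\bar t_i}$ with $\bar\mu_i\ge0$, $\bar{\mathbf v}_i=\bar p(\bar t_i)/\beta$. Fix $\sigma>0$, $R>0$ such that the intervals $(\bar t_i-R,\bar t_i+R)\subset I$ are pairwise disjoint and $|\bar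 p(t)|_{\mathbb R^d}\le\beta-\sigma$ for $t\in\bar I\setminus\bigcup_i(\bar t_i-R,\bar t_i+R)$. (iii) $\bar\mu_i>0$ for all $i$, there is $\theta_0>0$ with $\theta_0|t-\bar t_i|^2\le\beta-|\bar p(t)|_{\mathbb R^d}$ for all $t\in(\bar t_i-R,\bar t_i+R)$ and all $i$, and $K^*\in\mathcal L(Y;L^\infty(I;\mathbb R^d))$. Operators. $B(q,c)(t)=\int_0^t dq-\frac1T\int_0^T\int_0^s dq\,ds+c$ for $(q,c)\in\mathcal M(I;\mathbb R^d)\times\mathbb R^d$ (the BV function with derivative $q$ and mean $c$), and $\mathcal K=K\circ B$. PDAJ algorithm. A jump is a measure $v=\mathbf v\delta_t$ with $t\in I$, $\mathbf v\in\mathbb R^d$, $|\mathbf v|_{\mathbb R^d}=1$. Input: a finite active set $\mathcal A_0=\{(\mu_i^0,v_i^0)\}_{i=1}^{N_0}$ of positive magnitudes and jumps, $c^0\in\mathbb R^d$, $u_0=B(\sum_i\mu_i^0v_i^0,c^0)$. Initialization: take a minimizer $(\mu,c^1)$ of $F(\mathcal K(\sum_{i=1}^{N_0}\mu_iv_i^0,c))+\beta\sum_{i=1}^{N_0}\mu_i$ over $[0,\infty)^{N_0}\times\mathbb R^d$; $\mathcal A_1=\{(\mu_i^1,v_i^1)\}_{i=1}^{N_1}$ consists of those pairs $(\mu_i,v_i^0)$ with $\mu_i>0$, and $u_1=B(\sum_{i=1}^{N_1}\mu_i^1v_i^1,c^1)$. For $k=1,2,\dots$: set $p_k(t)=\int_0^tK^*\nabla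 F(Ku_k)(s)\,ds$ and choose $\hat t_k\in I$ with $|p_k(\hat t_k)|_{\mathbb R^d}=\|p_k\|_{\mathcal C}$. If $\|p_k\|_{\mathcal C}\le\beta$, terminate with output $u_k$. Otherwise let $\widehat v^k=(p_k(\hat t_k)/\|p_k\|_{\mathcal C})\delta_{\hat t_k}$ and take a minimizer $(\mu,c^{k+1})$ over $[0,\infty)^{N_k+1}\times\mathbb R^d$ of $F(\mathcal K(\mu_{N_k+1}\widehat v^k+\sum_{i=1}^{N_k}\mu_iv_i^k,c))+\beta\sum_{i=1}^{N_k+1}\mu_i$; $\mathcal A_{k+1}=\{(\mu_i^{k+1},v_i^{k+1})\}_{i=1}^{N_{k+1}}$ consists of the pairs among $(\mu_i,v_i^k)$, $i\le N_k$, and $(\mu_{N_k+1},\widehat v^k)$ with positive magnitude, and $u_{k+1}=B(\sum_i\mu_i^{k+1}v_i^{k+1},c^{k+1})$. *)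

(* Defs.v *)
From HB Require Import structures.
From mathcomp Require Import all_boot all_order all_algebra.
From mathcomp Require Import all_classical all_reals all_analysis.

Set Implicit Arguments.
Unset Strict Implicit.
Unset Printing Implicit Defensive.

Import Order.TTheory GRing.Theory Num.Theory.
Import numFieldNormedType.Exports.

Local Open Scope classical_set_scope.
Local Open Scope ring_scope.

Section euclidean.
Context {R : realType} {d : nat}.
Implicit Types x y : 'rV[R]_d.

Definition edot x y : R := \sum_(i < d) x 0 i * y 0 i.

(* The norm that the library puts on ['rV[R]_d] is the max norm. *)
Definition enorm x : R := Num.sqrt (edot x x).

End euclidean.

(* Together with the completeness of [Y], this makes [Y] a real Hilbert space
   whose norm is the library's norm. *)
Definition hilbert_dot (R : realType) (Y : completeNormedModType R)
    (dot : Y -> Y -> R) : Prop :=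
  [/\ forall x y, dot x y = dot y x,
      forall (a : R) x y z, dot (a *: x + y) z = a * dot x z + dot y z &
      forall x, dot x x = `|x| ^+ 2].

(* Integration against a signed measure, through its Jordan decomposition; the
   result does not depend on the Hahn decomposition that is picked. *)
Section charge_integral.
Context {R : realType}.
Implicit Type nu : {charge set (measurableTypeR R) -> \bar R}.

Definition hahn_pos nu : set (measurableTypeR R) :=
  projT1 (cid (Hahn_decomposition nu)).

Definition hahn_neg nu : set (measurableTypeR R) :=
  projT1 (cid (projT2 (cid (Hahn_decomposition nu)))).

Lemma hahnP nu : hahn_decomposition nu (hahn_pos nu) (hahn_neg nu).
Proof. exact: projT2 (cid (projT2 (cid (Hahn_decomposition nu)))). Qed.

Definition charge_integral nu (D : set R) (f : R -> R) : R :=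
  \int[jordan_pos (hahnP nu)]_(t in D) f t
  - \int[jordan_neg (hahnP nu)]_(t in D) f t.

End charge_integral.

(* Functions on [`]0, T[] are represented by functions on [R], of which only the
   values on [`]0, T[] matter; likewise a measure on [`]0, T[] is represented by
   a measure on [R], of which only the restriction to [`]0, T[] matters. *)
Section spaces.
Context {R : realType} {d : nat} (T : R).
Local Notation mu := (@lebesgue_measure R).
Implicit Types (u phi : R -> 'rV[R]_d).

Definition dom : set R := `]0, T[%classic.

(* Elements of Lebesgue spaces are represented by functions rather than by
   classes modulo equality almost everywhere. *)
Definition inL1 u : Prop :=
  forall i, mu.-integrable dom (EFin \o (fun t => u t 0 i)).

Definition inL2 u : Prop :=
  forall i, measurable_fun dom (fun t => u t 0 i) /\
            mu.-integrable dom (EFin \o (fun t => u t 0 i ^+ 2)).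

Definition L1norm u : R := \int[mu]_(t in dom) enorm (u t).

Definition L2dot u v : R := \int[mu]_(t in dom) edot (u t) (v t).

Definition L2norm u : R := Num.sqrt (L2dot u u).

Definition ae_eq_on_dom u v : Prop := {ae mu, forall t, dom t -> u t = v t}.

Definition inC0 phi : Prop :=
  [/\ forall t, dom t -> {for t, continuous phi},
      phi t @[t --> 0^'+] --> (0 : 'rV[R]_d) &
      phi t @[t --> T^'-] --> (0 : 'rV[R]_d)].

Definition Cnorm phi : R := sup [set enorm (phi t) | t in dom].

Definition vmeasure : Type :=
  'I_d -> {charge set (measurableTypeR R) -> \bar R}.

Implicit Type q : vmeasure.

Definition pairing phi q : R :=
  \sum_(i < d) charge_integral (q i) dom (fun t => phi t 0 i).

Definition Mnorm q : R :=
  sup [set `|pairing phi q| | phi in [set phi | inC0 phi /\ Cnorm phi <= 1]].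

Definition test_function (psi : R -> R) : Prop :=
  (forall n t, derivable (derive1n n psi) t 1) /\
  exists a b : R, [/\ 0 < a, b < T & forall t, t \notin `[a, b] -> psi t = 0].

Definition distr_deriv u q : Prop :=
  forall psi, test_function psi -> forall i,
    \int[mu]_(t in dom) (u t 0 i * derive1 psi t)
    = - charge_integral (q i) dom psi.

Definition inBV u : Prop := inL1 u /\ exists q, distr_deriv u q.

(* Zero if [u] has no derivative in the space of measures. *)
Definition bv_deriv u : vmeasure :=
  if pselect (exists q, distr_deriv u q) is left h then projT1 (cid h)
  else fun=> czero.

Definition BVnorm u : R := Mnorm (bv_deriv u) + L1norm u.

(* With the open interval [`]0, s[], the unit mass at [t0] is sent to the
   characteristic function of [`]t0, T[]. *)
Definition cumul q (s : R) : 'rV[R]_d := \row_i fine (q i `]0, s[%classic).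

Definition primitive (f : R -> 'rV[R]_d) (t : R) : 'rV[R]_d :=
  \row_i \int[mu]_(s in `]0, t[) f s 0 i.

Definition Bop q (c : 'rV[R]_d) (t : R) : 'rV[R]_d :=
  cumul q t - T^-1 *: primitive (cumul q) T + c.

(* A pair [(t, v)] stands for the vector measure [v delta_t]. *)
Definition is_jump (a : R * 'rV[R]_d) : Prop := dom a.1 /\ enorm a.2 = 1.

Definition dirac_charge (t : R) :
    {charge set (measurableTypeR R) -> \bar R} :=
  charge_of_finite_measure (\d_(t : measurableTypeR R)).

(* The vector measure [\sum_k mu_k v_k delta_(t_k)] given by the sequence of the
   [(mu_k, (t_k, v_k))]. *)
Definition atomic (s : seq (R * (R * 'rV[R]_d))) : vmeasure := fun i =>
  foldr (fun (x : R * (R * 'rV[R]_d))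
             (nu : {charge set (measurableTypeR R) -> \bar R}) =>
           (cadd (cscale (x.1 * x.2.2 0 i) (dirac_charge x.2.1)) nu
             : {charge set (measurableTypeR R) -> \bar R}))
        czero s.

End spaces.

Section problem.
Context {R : realType} {d : nat} (T : R) {Y : completeNormedModType R}
  (dot : Y -> Y -> R) (F : Y -> R) (gradF : Y -> Y)
  (K : (R -> 'rV[R]_d) -> Y) (Kadj : Y -> R -> 'rV[R]_d) (beta : R).
Local Notation mu := (@lebesgue_measure R).
Local Notation atom := (R * 'rV[R]_d)%type.
Implicit Types (u v : R -> 'rV[R]_d).

Definition strictly_convex : Prop :=
  forall (x y : Y) (s : R), x <> y -> 0 < s < 1 ->
    F (s *: x + (1 - s) *: y) < s * F x + (1 - s) * F y.

Definition C1_with_gradient : Prop :=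
  (forall y, is_diff y (F : Y -> R^o) (dot (gradF y) : Y -> R^o)) /\
  continuous gradF.

(* The bound forces [K] to agree on functions that are equal almost everywhere,
   so that [K] is a continuous linear map on L^2. *)
Definition continuous_linear_L2 : Prop :=
  (forall (a : R) u v, inL2 T u -> inL2 T v ->
     K (fun t => a *: u t + v t) = a *: K u + K v) /\
  exists C : R, forall u, inL2 T u -> `|K u| <= C * L2norm T u.

Definition is_adjoint : Prop :=
  forall y, inL2 T (Kadj y) /\
    forall u, inL2 T u -> dot (K u) y = L2dot T u (Kadj y).

Definition adjoint_bounded_Linfty : Prop :=
  exists C : R, forall y,
    {ae mu, forall t, dom T t -> enorm (Kadj y t) <= C * `|y|}.

Definition objective u : R := F (K u) + beta * Mnorm T (bv_deriv T u).

Definition radially_unbounded : Prop :=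
  forall u_ : nat -> R -> 'rV[R]_d, (forall k, inBV T (u_ k)) ->
    BVnorm T (u_ k) @[k --> \oo] --> +oo ->
    objective (u_ k) @[k --> \oo] --> +oo.

Definition minimizer u : Prop :=
  inBV T u /\ forall w, inBV T w -> objective u <= objective w.

Definition residual u : R :=
  objective u - inf [set objective w | w in [set w | inBV T w]].

Definition dual_variable u : R -> 'rV[R]_d := primitive (Kadj (gradF (K u))).

Definition coef_objective (J : seq atom) (m : seq R)
    (c : 'rV[R]_d) : R :=
  F (K (Bop T (atomic (zip m J)) c)) + beta * \sum_(x <- m) x.

Definition coef_minimizer (J : seq atom) (m : seq R)
    (c : 'rV[R]_d) : Prop :=
  [/\ size m = size J, {in m, forall x, 0 <= x} &
      forall (m' : seq R) (c' : 'rV[R]_d),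
        size m' = size J -> {in m', forall x, 0 <= x} ->
        coef_objective J m c <= coef_objective J m' c'].

(* An active set is enumerated in an arbitrary order. *)
Definition resolved (J : seq atom)
    (A : seq (R * atom)) (c : 'rV[R]_d) : Prop :=
  exists m : seq R, coef_minimizer J m c /\
    perm_eq A [seq x <- zip m J | 0 < x.1].

Section run.
Variables (A : nat -> seq (R * atom)) (c : nat -> 'rV[R]_d)
  (that : nat -> R).

Definition iterate (k : nat) : R -> 'rV[R]_d := Bop T (atomic (A k)) (c k).

Definition iterate_dual (k : nat) : R -> 'rV[R]_d := dual_variable (iterate k).

Definition stops (k : nat) : Prop := Cnorm T (iterate_dual k) <= beta.

(* The stopping test is first made at index 1. The sequences are constrained
   only up to the first index at which it succeeds. *)
Definition terminates_at (k : nat) : Prop :=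
  [/\ (0 < k)%N, stops k & forall l, (0 < l < k)%N -> ~ stops l].

Definition pdaj_step (k : nat) : Prop :=
  let p := iterate_dual k in
  [/\ dom T (that k), enorm (p (that k)) = Cnorm T p &
      resolved
        (rcons [seq x.2 | x <- A k] (that k, (Cnorm T p)^-1 *: p (that k)))
        (A k.+1) (c k.+1)].

Definition pdaj_run : Prop :=
  [/\ forall x, x \in A 0%N ->
        0 < x.1 /\ is_jump T x.2,
      resolved [seq x.2 | x <- A 0%N] (A 1%N) (c 1%N) &
      forall k, (0 < k)%N -> (forall l, (0 < l <= k)%N -> ~ stops l) ->
        pdaj_step k].

End run.

End problem.

(* Main.v *)
Require Import Defs.
From HB Require Import structures.
From mathcomp Require Import all_boot all_order all_algebra.
From mathcomp Require Import all_classical all_reals all_analysis.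
From mathcomp Require Import measurable_realfun.
From mathcomp Require Import ring lra.

Set Implicit Arguments.
Unset Strict Implicit.
Unset Printing Implicit Defensive.

Import Order.TTheory GRing.Theory Num.Theory.
Import numFieldNormedType.Exports.

Local Open Scope classical_set_scope.
Local Open Scope ring_scope.

(** Write a step function as a finite list [s] of weighted jumps plus a constant [c], let [y] be its
    observation, and let [cost] be F at [y] plus beta times the total mass of [s]. The excess of
    this cost over the optimal value splits into the Bregman distance of F from [ybar] to [y] and
    the sum of [x.1 * slack x.2], where the slack of a jump (t, v) is beta minus the product of v
    with pbar(t) ([excessE]). Both parts are nonnegative, and the structural assumptions make them
    coercive. The quadratic decay of |pbar| bounds the squared distance from a jump to the optimal
    jump of its ball by its slack ([offset_sqr_le]). Linear independence then recovers the errors in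
    the masses lumped per ball and in the constant from the observation error
    ([lumps_bounded_below]). Altogether the observation error, the mass-weighted distance [spread]
    and the mass error [discrepancy] are of the order of the square root of the excess
    ([excess_bounds]).

    For the descent, let p be the dual curve of an iterate. Optimality of its coefficients makes it
    [stationary]: rescaling any family of its atoms has no first-order effect. Exchanging a fraction
    h of some atoms against mass h * m at the new jump therefore lowers the cost by h * m * (max |p|
    - beta), up to h^2 * L * |D|^2, where D is the observation of the exchanged difference
    ([cost_transfer]). Convexity gives that the excess is at most [mass_bar] times max |p| - beta
    ([gap]). Exchanging all atoms yields the estimate of conditional gradient methods
    ([sublinear_step]), which suffices to get below any positive level. Once the excess is small,
    the maximizer of |p| lies in one of the balls, and the new jump is within a multiple of |y -
    ybar| of the optimal one ([peak_offset]). If only the atoms of that ball are exchanged, against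
    their own total mass, then |D|^2 is of the order of the excess itself, so that a fixed h
    contracts the excess ([linear_step]). Both regimes together give [geometric_convergence].

    The residual is at most the excess ([residual_le_excess]), the L^1 error is bounded by [spread]
    plus [discrepancy], and beta times the difference of the total variations is the residual minus
    the difference of the F terms. As these involve square roots of the excess, the final rate is
    the square root of the rate of the excess ([linear_rate]). If the algorithm stops, [gap] gives
    excess zero and [excess_bounds] identifies the iterate with ubar ([stop_optimal]).

    The connection with BV rests on three facts: a charge on the interval is determined by its
    integrals against test functions ([charge_determined]), a function whose derivative is atomic is
    almost everywhere a step function ([du_bois_reymond]), and the total variation of ubar' is the
    sum of the [mubar i], as the test field pbar / beta shows ([Mnorm_ubar]). *)

(** * Bilinear forms, the Euclidean norm and the Hilbert norm *)

Section cauchy_schwarz.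
Context {R : realType} {V : lmodType R} (b : V -> V -> R).
Hypothesis bC : forall x y, b x y = b y x.
Hypothesis bl : forall (a : R) x y z, b (a *: x + y) z = a * b x z + b y z.
Hypothesis b0 : forall x, 0 <= b x x.

Lemma bform0l z : b 0 z = 0.
Proof. by have := bl (-1) 0 0 z; rewrite scaler0 addr0 mulN1r addNr. Qed.

Lemma bformDl x y z : b (x + y) z = b x z + b y z.
Proof. by rewrite -[x]scale1r bl mul1r scale1r. Qed.

Lemma bformZl a x z : b (a *: x) z = a * b x z.
Proof. by rewrite -[a *: x]addr0 bl bform0l addr0. Qed.

Lemma bformNl x z : b (- x) z = - b x z.
Proof. by rewrite -scaleN1r bformZl mulN1r. Qed.

Lemma bformBl x y z : b (x - y) z = b x z - b y z.
Proof. by rewrite bformDl bformNl. Qed.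

Lemma bformDr x y z : b z (x + y) = b z x + b z y.
Proof. by rewrite bC bformDl !(bC z). Qed.

Lemma bformZr a x z : b z (a *: x) = a * b z x.
Proof. by rewrite bC bformZl (bC z). Qed.

Lemma bformNr x z : b z (- x) = - b z x.
Proof. by rewrite bC bformNl (bC z). Qed.

Lemma bformBr x y z : b z (x - y) = b z x - b z y.
Proof. by rewrite bformDr bformNr. Qed.

Lemma bform0r z : b z 0 = 0. Proof. by rewrite bC bform0l. Qed.

Lemma bform_suml I (r : seq I) (P : pred I) (f : I -> V) z :
  b (\sum_(i <- r | P i) f i) z = \sum_(i <- r | P i) b (f i) z.
Proof.
by elim/big_rec2: _ => [|i x y _ <-]; [exact: bform0l | rewrite bformDl].
Qed.

Lemma cauchy_schwarz x y : b x y ^+ 2 <= b x x * b y y.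
Proof.
have H (a : R) : 0 <= b x x + 2 * a * b x y + a ^+ 2 * b y y.
  have := b0 (x + a *: y).
  rewrite bformDl !bformDr !bformZl !bformZr (bC y x).
  by rewrite (_ : forall u v w : R, u + a * v + (a * v + a * (a * w)) = u + 2 * a * v + a ^+ 2 * w) // => u v w; ring.
have [y0|y0] := eqVneq (b y y) 0.
  rewrite y0 mulr0; have [->|xy0] := eqVneq (b x y) 0; first by rewrite expr0n.
  (* When [b y y] vanishes the quadratic [H] is affine in [a], and this [a] would give it the value
     -1. *)
  have := H (- (b x x + 1) / (2 * b x y)).
  rewrite y0 mulr0 addr0.
  have -> : b x x + 2 * (- (b x x + 1) / (2 * b x y)) * b x y = -1 by field.
  by rewrite oppr_ge0 ler10.
have yp : 0 < b y y by rewrite lt_def y0 b0.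
have := H (- b x y / b y y).
have -> : b x x + 2 * (- b x y / b y y) * b x y + (- b x y / b y y) ^+ 2 * b y y
  = (b x x * b y y - b x y ^+ 2) / b y y by field.
by rewrite pmulr_lge0 ?invr_gt0 // subr_ge0.
Qed.

End cauchy_schwarz.

Section euclidean_theory.
Context {R : realType} {d : nat}.
Implicit Types x y z : 'rV[R]_d.

Lemma edotC x y : edot x y = edot y x.
Proof. by apply: eq_bigr => i _; rewrite mulrC. Qed.

Lemma edot_linl (a : R) x y z : edot (a *: x + y) z = a * edot x z + edot y z.
Proof.
rewrite /edot mulr_sumr -big_split; apply: eq_bigr => i _.
by rewrite !mxE mulrDl mulrA.
Qed.

Lemma edot_ge0 x : 0 <= edot x x.
Proof. by apply: sumr_ge0 => i _; rewrite -expr2 sqr_ge0. Qed.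

Definition edotDl := bformDl edot_linl.
Definition edotZl := bformZl edot_linl.
Definition edotNl := bformNl edot_linl.
Definition edotBl := bformBl edot_linl.
Definition edot0l := bform0l edot_linl.
Definition edotDr := bformDr edotC edot_linl.
Definition edotZr := bformZr edotC edot_linl.
Definition edotNr := bformNr edotC edot_linl.
Definition edotBr := bformBr edotC edot_linl.
Definition edot0r := bform0r edotC edot_linl.

Lemma enorm_ge0 x : 0 <= enorm x. Proof. exact: sqrtr_ge0. Qed.

Lemma sqr_enorm x : enorm x ^+ 2 = edot x x.
Proof. by rewrite sqr_sqrtr // edot_ge0. Qed.

Lemma edot_le x y : `|edot x y| <= enorm x * enorm y.
Proof.
rewrite -(@ler_pXn2r _ 2) ?nnegrE ?mulr_ge0 ?enorm_ge0 //.
rewrite exprMn !sqr_enorm real_normK ?num_real //.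
exact: (cauchy_schwarz edotC edot_linl edot_ge0).
Qed.

Lemma edot_ler x y : edot x y <= enorm x * enorm y.
Proof. exact: le_trans (ler_norm _) (edot_le _ _). Qed.

Lemma enormD x y : enorm (x + y) <= enorm x + enorm y.
Proof.
rewrite -(@ler_pXn2r _ 2) ?nnegrE ?addr_ge0 ?enorm_ge0 //.
rewrite sqrrD !sqr_enorm edotDl !edotDr (edotC y x).
have := edot_ler x y; lra.
Qed.

Lemma enormZ a x : enorm (a *: x) = `|a| * enorm x.
Proof.
by rewrite /enorm edotZl edotZr mulrA -expr2 sqrtrM ?sqr_ge0 // sqrtr_sqr.
Qed.

Lemma enormN x : enorm (- x) = enorm x.
Proof. by rewrite -scaleN1r enormZ normrN1 mul1r. Qed.

Lemma enormB x y : enorm (x - y) <= enorm x + enorm y.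
Proof. by rewrite -(enormN y) enormD. Qed.

Lemma enormBC x y : enorm (x - y) = enorm (y - x).
Proof. by rewrite -enormN opprB. Qed.

Lemma enorm0 : enorm (0 : 'rV[R]_d) = 0.
Proof. by rewrite /enorm edot0l sqrtr0. Qed.

Lemma enorm_eq0 x : enorm x = 0 -> x = 0.
Proof.
move=> x0; have := sqr_enorm x; rewrite x0 expr0n /= => /esym.
move=> /eqP; rewrite /edot psumr_eq0; last by move=> i _; rewrite -expr2 sqr_ge0.
move=> /allP h; apply/rowP => i; rewrite mxE.
by have := h i (mem_index_enum _); rewrite /= mulf_eq0 orbb => /eqP.
Qed.

Lemma enorm_sum I (r : seq I) (P : pred I) (f : I -> 'rV[R]_d) :
  enorm (\sum_(i <- r | P i) f i) <= \sum_(i <- r | P i) enorm (f i).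
Proof.
elim/big_rec2: _ => [|i x y _ h]; first by rewrite enorm0.
by apply: le_trans (enormD _ _) _; rewrite lerD2l.
Qed.

Lemma coord_le_enorm x i : `|x 0 i| <= enorm x.
Proof.
rewrite -sqrtr_sqr ler_wsqrtr // /edot (bigD1 i) //= -expr2 lerDl.
by apply: sumr_ge0 => j _; rewrite -expr2 sqr_ge0.
Qed.

Lemma enorm_le_sum x : enorm x <= \sum_(i < d) `|x 0 i|.
Proof.
have -> : enorm x = enorm (\sum_(i < d) x 0 i *: (delta_mx 0 i : 'rV[R]_d)).
  by rewrite -row_sum_delta.
apply: le_trans (enorm_sum _ _ _) _; apply: ler_sum => i _.
rewrite enormZ -[leRHS]mulr1 ler_wpM2l //.
rewrite /enorm /edot (bigD1 i) //= big1 => [|j ji].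
  by rewrite addr0 !mxE !eqxx mul1r sqrtr1.
by rewrite !mxE (negPf ji) andbF mul0r.
Qed.

End euclidean_theory.

Section hilbert.
Context {R : realType} {Y : completeNormedModType R} {dot : Y -> Y -> R}.
Hypothesis dotP : hilbert_dot dot.

Lemma dotC x y : dot x y = dot y x. Proof. by have [h _ _] := dotP. Qed.
Lemma dot_linl (a : R) x y z : dot (a *: x + y) z = a * dot x z + dot y z.
Proof. by have [_ h _] := dotP. Qed.
Lemma dot_norm x : dot x x = `|x| ^+ 2. Proof. by have [_ _ h] := dotP. Qed.
Lemma dot_ge0 x : 0 <= dot x x. Proof. by rewrite dot_norm sqr_ge0. Qed.

Lemma dot_le x y : `|dot x y| <= `|x| * `|y|.
Proof.
rewrite -(@ler_pXn2r _ 2) ?nnegrE ?mulr_ge0 //.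
rewrite exprMn real_normK ?num_real // -!dot_norm.
exact: (cauchy_schwarz dotC dot_linl dot_ge0).
Qed.

Lemma dot_ler x y : dot x y <= `|x| * `|y|.
Proof. exact: le_trans (ler_norm _) (dot_le _ _). Qed.

End hilbert.

(** Cauchy-Schwarz for the semidefinite form with weights [m], applied to the constant 1 and [a]. *)
Lemma sqr_sum_wle {R : realType} {I : Type} (r : seq I) (P : pred I)
    (m a : I -> R) :
  (forall i, 0 <= m i) ->
  (\sum_(i <- r | P i) m i * a i) ^+ 2 <=
  (\sum_(i <- r | P i) m i) * \sum_(i <- r | P i) m i * a i ^+ 2.
Proof.
move=> m0.
pose b (f g : I -> R^o) : R := \sum_(i <- r | P i) m i * (f i * g i).
have bC x y : b x y = b y x.
  by apply: eq_bigr => i _; rewrite (mulrC (x i)).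
have bl c x y z : b (c *: x + y) z = c * b x z + b y z.
  rewrite mulr_sumr -big_split; apply: eq_bigr => i _ /=.
  by rewrite mulrDl mulrDr -mulrA mulrCA.
have b0 x : 0 <= b x x.
  by apply: sumr_ge0 => i _; rewrite mulr_ge0 // -expr2 sqr_ge0.
have := cauchy_schwarz bC bl b0 (fun=> 1) a; rewrite /b.
have -> : \sum_(i <- r | P i) m i * (1 * a i) = \sum_(i <- r | P i) m i * a i.
  by apply: eq_bigr => i _; rewrite mul1r.
have -> : \sum_(i <- r | P i) m i * (1 * 1) = \sum_(i <- r | P i) m i.
  by apply: eq_bigr => i _; rewrite !mulr1.
by [].
Qed.

(** * Convex functions with Lipschitz gradient *)

Section smooth_convex.
Context {R : realType} {Y : completeNormedModType R} {dot : Y -> Y -> R}.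
Hypothesis dotP : hilbert_dot dot.
Context {F : Y -> R} {gradF : Y -> Y}.
Hypotheses (F_conv : strictly_convex F) (F_C1 : C1_with_gradient dot F gradF).

Lemma convex_le (x y : Y) (s : R) : 0 < s < 1 ->
  F (x + s *: (y - x)) <= F x + s * (F y - F x).
Proof.
move=> s01; have [->|/eqP yx] := eqVneq y x.
  by rewrite !subrr scaler0 addr0 mulr0 addr0.
have := F_conv yx s01.
have -> : s *: y + (1 - s) *: x = x + s *: (y - x).
  by rewrite scalerBl scale1r scalerBr addrCA.
move=> /ltW /le_trans; apply; lra.
Qed.

(** By convexity the difference quotients along [y - x] are at most [F y - F x]; they tend to the
    derivative. *)
Lemma convex_tangent (x y : Y) : F x + dot (gradF x) (y - x) <= F y.
Proof.
have [_ _] := dotP => _; have [/(_ x) dF _] := F_C1.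
have h : (fun h : R => h^-1 *: ((F (h *: (y - x) + x) : R^o) - F x)) @ 0^'+
    --> (dot (gradF x) (y - x) : R^o).
  have df : differentiable (F : Y -> R^o) x by exact: ex_diff.
  have -> : dot (gradF x) (y - x) = 'D_(y - x) (F : Y -> R^o) x.
    by rewrite deriveE // diff_val.
  by apply: cvg_dnbhs_at_right; exact: (@diff_derivable _ _ _ _ x (y - x) df).
rewrite -lerBrDl; apply: (cvgr_to_le h); near=> s.
have s01 : 0 < s < 1 by apply/andP; split; near: s; [exact: nbhs_right_gt | exact: nbhs_right_lt].
have s0 : 0 < s by case/andP: s01.
rewrite /GRing.scale /= ler_pdivrMl // lerBlDl addrC addrC [_ *: _ + _]addrC.
exact: convex_le.
Unshelve. all: by end_near. Qed.

Context {L : R}.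
Hypothesis gradF_lip : forall y z, `|gradF y - gradF z| <= L * `|y - z|.

(** The tangent inequality at [x + h], evaluated at [x], has the gradient at the wrong end; the
    Lipschitz bound corrects this. No integration along the segment is needed, at the price of the
    constant [L] instead of [L / 2]. *)
Lemma descent_le (x h : Y) :
  F (x + h) <= F x + dot (gradF x) h + L * `|h| ^+ 2.
Proof.
have := convex_tangent (x + h) x.
rewrite opprD addNKr (bformNr (dotC dotP) (dot_linl dotP)) => t.
have := dot_ler dotP (gradF (x + h) - gradF x) h.
rewrite (bformBl (dot_linl dotP)).
have := gradF_lip (x + h) x; rewrite addrAC subrr add0r => l.
have : `|gradF (x + h) - gradF x| * `|h| <= L * `|h| * `|h| by rewrite ler_wpM2r.
by rewrite -mulrA -expr2; move: t; lra.
Qed.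

(* A function of a step length [s] that is minimal at [s = 0] has nonnegative
   slope there. *)
Lemma slope_ge0 (x h : Y) (b : R) :
  (forall s, 0 < s <= 1 -> F x <= F (x + s *: h) + s * b) ->
  0 <= dot (gradF x) h + b.
Proof.
move=> H; rewrite leNgt; apply/negP => neg.
set a := dot _ _ + b in neg.
pose q := L * `|h| ^+ 2.
(* With this step length the quadratic term [s * q] cannot make up for the negative slope [a]. *)
pose s := Num.min 1 (- a / (2 * (`|q| + 1))).
have q1 : 0 < `|q| + 1 by rewrite ltr_wpDl.
have s0 : 0 < s by rewrite lt_min ltr01 /= divr_gt0 ?oppr_gt0 // mulr_gt0.
have s1 : s <= 1 by rewrite ge_min lexx.
have s2 : s * (2 * (`|q| + 1)) <= - a.
  by rewrite -ler_pdivlMr ?mulr_gt0 // ge_min lexx orbT.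
have := H s; rewrite s0 s1 => /(_ isT).
have := descent_le x (s *: h).
rewrite (bformZr (dotC dotP) (dot_linl dotP)) normrZ (gtr0_norm s0) exprMn mulrCA -/q.
move=> d1 d2.
have : 0 <= s * (a + s * q) by rewrite /a; nra.
rewrite pmulr_rge0 //.
have := ler_norm q; nra.
Qed.

End smooth_convex.

(** The norm of the combination attains a positive minimum on the compact unit sphere of the max
    norm. Homogeneity extends the bound to all coefficients, and the division by the dimension
    passes from the max norm to the sum of absolute values. *)
Lemma injective_bounded_below {R : realType} {Y : normedModType R} {n : nat}
    (y : 'I_n -> Y) :
  (forall a : 'I_n -> R, \sum_i a i *: y i = 0 -> forall i, a i = 0) ->
  exists2 kappa : R, 0 < kappa &
    forall a : 'I_n -> R, kappa * \sum_i `|a i| <= `|\sum_i a i *: y i|.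
Proof.
move=> inj.
case: n => [|n] in y inj *.
  by exists 1 => // a; rewrite big_ord0 mulr0.
pose f (z : 'rV[R]_n.+1) : R := `|\sum_i z 0 i *: y i|.
have fc : continuous f.
  have sc : continuous (fun z : 'rV[R]_n.+1 => \sum_i z 0 i *: y i).
    have := @continuous_big Y 'I_n.+1 +%R 0 predT (@add_continuous Y)
      _ (index_enum _) (fun i (z : 'rV[R]_n.+1) => z 0 i *: y i).
    apply => i _ z.
    by apply: cvgZr_tmp; [exact: (@nbhs_filter 'rV[R]_n.+1 z) | exact: (@coord_continuous R 1 n.+1 0 i z)].
  by move=> z; apply: (continuous_comp (sc z)); exact: norm_continuous.
pose S := [set z : 'rV[R]_n.+1 | `|z| = 1].
have Sc : compact S.
  apply: bounded_closed_compact.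
    exists 1; split; first by rewrite num_real.
    by move=> M M1 z /= ->; exact: ltW.
  have -> : S = Num.norm @^-1` [set 1] by [].
  by apply: closed_comp; [move=> z _; exact: norm_continuous | exact: closed_eq].
have unit_norm (v : 'rV[R]_n.+1) : v != 0 -> `| `|v|^-1 *: v| = 1.
  by move=> v0; rewrite normrZ normfV normr_id mulVf // normr_eq0.
have S0 : S !=set0.
  exists (`|const_mx 1 : 'rV[R]_n.+1|^-1 *: const_mx 1); apply: unit_norm.
  by apply/eqP => /rowP /(_ ord0) /eqP; rewrite !mxE oner_eq0.
have [z Sz zmin] := compact_EVT_min S0 Sc (continuous_subspaceT fc).
have z1 : `|z| = 1 by move: Sz; rewrite inE.
have fz : 0 < f z.
  rewrite /f normr_gt0; apply/eqP => /inj h.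
  have z0 : z = 0 by apply/rowP => i; rewrite mxE h.
  by move: z1; rewrite z0 normr0 => /esym/eqP; rewrite oner_eq0.
exists (f z / n.+1%:R); first by rewrite divr_gt0.
move=> a; pose v : 'rV[R]_n.+1 := \row_i a i.
have fa : `|\sum_i a i *: y i| = f v.
  by rewrite /f; congr `|_|; apply: eq_bigr => i _; rewrite mxE.
rewrite fa; have [v0|v0] := eqVneq v 0.
  rewrite big1 ?mulr0 ?normr_ge0 // => i _.
  by move/rowP: v0 => /(_ i); rewrite !mxE => ->; rewrite normr0.
have sv : \sum_i `|a i| <= n.+1%:R * `|v|.
  rewrite mulr_natl -[X in _ *+ X]card_ord -sumr_const; apply: ler_sum => i _.
  have -> : a i = v 0 i by rewrite mxE.
  rewrite [X in _ <= X]mx_normrE.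
  exact: (@le_bigmax_cond _ _ _ _ (0, i) predT (fun ij => `|v ij.1 ij.2|) isT).
have := zmin (`|v|^-1 *: v); rewrite inE => /(_ (unit_norm _ v0)).
have -> : f (`|v|^-1 *: v) = `|v|^-1 * f v.
  rewrite /f (_ : \sum_i _ = `|v|^-1 *: \sum_i v 0 i *: y i).
    by rewrite normrZ normfV normr_id.
  by rewrite scaler_sumr; apply: eq_bigr => i _; rewrite mxE scalerA.
rewrite ler_pdivlMl ?normr_gt0 // mulrC => h; apply: le_trans h.
by rewrite -mulrA ler_pM2l // ler_pdivrMl.
Qed.

(** * Lumping the atoms of a measure into the balls around the optimal positions *)

Section lumping.
Context {R : realType} {d : nat}.
Local Notation atom := (R * 'rV[R]_d)%type.
Implicit Types (s : seq (R * atom)) (t : R) (v c : 'rV[R]_d).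

Definition mass s : R := \sum_(x <- s) x.1.

Context {N : nat} (tbar : 'I_N -> R) (vbar : 'I_N -> 'rV[R]_d) (rad : R).

Definition nearest t : option 'I_N := [pick i | `|t - tbar i| < rad].

Definition lump s (i : 'I_N) : R :=
  \sum_(x <- s | nearest x.2.1 == Some i) x.1.

(* The distance of a jump from the optimal jump of its ball; jumps outside all
   balls count as being at distance 1. *)
Definition offset (x : atom) : R :=
  if nearest x.1 is Some i then `|x.1 - tbar i| + enorm (x.2 - vbar i) else 1.

Definition spread s : R := \sum_(x <- s) x.1 * offset x.2.

Lemma offset_ge0 x : 0 <= offset x.
Proof.
by rewrite /offset; case: nearest => // i; rewrite addr_ge0 ?enorm_ge0.
Qed.

Lemma sum_nearest (V : nmodType) s (f : option 'I_N -> R * atom -> V) :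
  \sum_(x <- s) f (nearest x.2.1) x =
  \sum_(x <- s | nearest x.2.1 == None) f None x +
  \sum_i \sum_(x <- s | nearest x.2.1 == Some i) f (Some i) x.
Proof.
under [X in _ = _ + X]eq_bigr do rewrite big_mkcond.
rewrite exchange_big /= [X in _ = X + _]big_mkcond -big_split /=; apply: eq_bigr => x _.
case: nearest => [i|] /=; last by rewrite big1 ?addr0.
rewrite add0r (bigD1 i) //= eqxx big1 ?addr0 // => j ji.
by rewrite (inj_eq Some_inj) eq_sym (negPf ji).
Qed.

Section synthesis.
Context {V : lmodType R} (G : R -> 'rV[R]_d -> V) (E : 'rV[R]_d -> V).

(** [G] and [E] are abstract because the decomposition is used twice: for observations in [Y] with
    its norm, and for step functions with the L^1 norm. The predicate [P] below singles out the
    elements on which [n] behaves as a seminorm, such as bounded measurable functions for the L^1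
    norm. *)
Definition synth s c : V := \sum_(x <- s) x.1 *: G x.2.1 x.2.2 + E c.

Definition residue s : V := \sum_(x <- s) x.1 *:
  (G x.2.1 x.2.2 - if nearest x.2.1 is Some i then G (tbar i) (vbar i) else 0).

Context (mubar : 'I_N -> R) (cbar : 'rV[R]_d).
Hypothesis EB : forall c c', E (c - c') = E c - E c'.

(** Sliding every atom to the optimal jump of its ball, and dropping those outside all balls, costs
    [residue]; what remains is a combination of the optimal jumps. *)
Lemma synthB s c :
  synth s c - (\sum_i mubar i *: G (tbar i) (vbar i) + E cbar) =
  residue s + (\sum_i (lump s i - mubar i) *: G (tbar i) (vbar i) + E (c - cbar)).
Proof.
have resE : residue s = \sum_(x <- s) x.1 *: G x.2.1 x.2.2
    - \sum_i lump s i *: G (tbar i) (vbar i).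
  rewrite /residue; under eq_bigr do rewrite scalerBr.
  rewrite sumrB; congr (_ - _).
  rewrite (sum_nearest s (fun o x =>
    x.1 *: if o is Some i then G (tbar i) (vbar i) else 0)).
  rewrite big1 => [|x _]; last by rewrite scaler0.
  by rewrite add0r; apply: eq_bigr => i _; rewrite -scaler_suml.
have -> : synth s c = residue s + \sum_i lump s i *: G (tbar i) (vbar i) + E c.
  by rewrite resE subrK.
rewrite EB; under [in RHS]eq_bigr do rewrite scalerBl.
by rewrite big_split /= sumrN opprD -!addrA; congr (_ + (_ + _)); rewrite addrCA.
Qed.

Context (P : V -> Prop) (n : V -> R) (C : R).
Hypotheses (P0 : P 0) (PD : forall u w, P u -> P w -> P (u + w))
  (PZ : forall a u, P u -> P (a *: u))
  (n0 : n 0 = 0)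
  (nD : forall u w, P u -> P w -> n (u + w) <= n u + n w)
  (nZ : forall a u, P u -> n (a *: u) = `|a| * n u).
Context (dom : R -> Prop).
Hypotheses (PG : forall t v, dom t -> P (G t v)) (PE : forall c, P (E c)).
Hypotheses (C0 : 0 <= C)
  (nG : forall t v, dom t -> n (G t v) <= C * enorm v)
  (nE : forall c, n (E c) <= C * enorm c)
  (nGB : forall t t' v v', dom t -> dom t' -> enorm v' = 1 ->
    n (G t v - G t' v') <= C * (`|t - t'| + enorm (v - v'))).
Hypotheses (dom_tbar : forall i, dom (tbar i))
  (vbar1 : forall i, enorm (vbar i) = 1).

Lemma closed_sum I (r : seq I) (Q : pred I) (f : I -> V) :
  (forall i, P (f i)) -> P (\sum_(i <- r | Q i) f i).
Proof. by move=> Pf; elim/big_ind: _ => //; exact: PD. Qed.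

Lemma seminorm_sum I (r : seq I) (Q : pred I) (f : I -> V) :
  (forall i, P (f i)) -> n (\sum_(i <- r | Q i) f i) <= \sum_(i <- r | Q i) n (f i).
Proof.
move=> Pf; elim: r => [|i r IH]; first by rewrite !big_nil n0.
rewrite !big_cons; case: (Q i) => //.
by apply: le_trans (nD (Pf i) (closed_sum _ _ Pf)) _; rewrite lerD2l.
Qed.

Definition admissible s := forall x, x \in s ->
  [/\ 0 < x.1, dom x.2.1 & enorm x.2.2 = 1].

Lemma closed_residue s : admissible s -> P (residue s).
Proof.
rewrite /residue /admissible; elim: s => [|x s IH] h; first by rewrite big_nil.
rewrite big_cons; apply: PD; last by apply: IH => y ys; apply: h; rewrite in_cons ys orbT.
have [_ dx _] := h x (mem_head _ _); apply: PZ; apply: PD; first exact: PG.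
rewrite -scaleN1r; apply: PZ; case: nearest => // i; exact: PG.
Qed.

Lemma seminorm_residue s : admissible s -> n (residue s) <= C * spread s.
Proof.
rewrite /residue /spread; elim: s => [|x s IH] h.
  by rewrite !big_nil n0 mulr0.
have hs : admissible s by move=> y ys; apply: h; rewrite in_cons ys orbT.
have [x0 dx vx] := h x (mem_head _ _).
rewrite !big_cons mulrDr.
have Px : P (G x.2.1 x.2.2 - if nearest x.2.1 is Some i then G (tbar i) (vbar i) else 0).
  apply: PD; first exact: PG.
  by rewrite -scaleN1r; apply: PZ; case: nearest => // i; exact: PG.
apply: le_trans (nD (PZ _ Px) (closed_residue hs)) _.
apply: lerD; last exact: IH.
rewrite nZ // gtr0_norm // mulrCA ler_pM2l // /offset.
case: nearest => [i|]; first exact: nGB.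
by rewrite subr0 mulr1 (le_trans (nG _ dx)) // vx mulr1.
Qed.

Lemma seminorm_lumps s c :
  n (\sum_i (lump s i - mubar i) *: G (tbar i) (vbar i) + E (c - cbar)) <=
  C * (\sum_i `|lump s i - mubar i| + enorm (c - cbar)).
Proof.
have PGb i : P ((lump s i - mubar i) *: G (tbar i) (vbar i)) by apply: PZ; exact: PG.
apply: le_trans (nD (closed_sum _ _ PGb) (PE _)) _.
rewrite mulrDr lerD //; apply: le_trans (seminorm_sum _ _ PGb) _.
rewrite mulr_sumr; apply: ler_sum => i _; rewrite nZ; last exact: PG.
by rewrite mulrC ler_wpM2r // (le_trans (nG _ _)) // vbar1 mulr1.
Qed.

Lemma seminorm_synthB s c : admissible s ->
  n (synth s c - (\sum_i mubar i *: G (tbar i) (vbar i) + E cbar)) <=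
  C * (spread s + (\sum_i `|lump s i - mubar i| + enorm (c - cbar))).
Proof.
move=> hs; rewrite synthB mulrDr.
have PGb i : P ((lump s i - mubar i) *: G (tbar i) (vbar i)) by apply: PZ; exact: PG.
apply: le_trans (nD (closed_residue hs) (PD (closed_sum _ _ PGb) (PE _))) _.
by rewrite lerD ?seminorm_residue ?seminorm_lumps.
Qed.

(** Atoms outside all balls have offset 1, so their mass is part of [spread]. *)
Lemma mass_le_lumps s : admissible s ->
  mass s <= \sum_i lump s i + spread s.
Proof.
move=> hs; rewrite /mass (sum_nearest s (fun _ x => x.1)) addrC lerD2l /spread.
rewrite big_mkcond /= big_seq [leRHS]big_seq; apply: ler_sum => x xs.
have [x0 _ _] := hs x xs; case: ifPn => [/eqP|_].
  by rewrite /offset => ->; rewrite mulr1.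
by rewrite mulr_ge0 ?offset_ge0 // ltW.
Qed.

End synthesis.
End lumping.

(** * Growth of the Bregman distance of F at the optimal observation *)

Section growth.
Context {R : realType} {Y : completeNormedModType R} {dot : Y -> Y -> R}.
Hypothesis dotP : hilbert_dot dot.
Context {F : Y -> R} {gradF : Y -> Y}.
Hypotheses (F_conv : strictly_convex F) (F_C1 : C1_with_gradient dot F gradF).
Context (ybar : Y) (gamma0 : R).
Hypothesis gamma0_gt0 : 0 < gamma0.
Hypothesis F_growth : \forall y \near ybar,
  F y >= F ybar + dot (gradF ybar) (y - ybar) + gamma0 * `|y - ybar| ^+ 2.

Definition bregman (y : Y) : R := F y - F ybar - dot (gradF ybar) (y - ybar).

Lemma bregman_ge0 y : 0 <= bregman y.
Proof.
by have := convex_tangent dotP F_conv F_C1 ybar y; rewrite /bregman; lra.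
Qed.

(* By convexity the local quadratic growth turns into linear growth far away. *)
Lemma bregman_growth (M : R) : 0 <= M ->
  exists2 C : R, 0 < C &
    forall y, bregman y <= M -> `|y - ybar| ^+ 2 <= C * bregman y.
Proof.
move=> M0; have /nbhs_normP[r /= r0 hr] := F_growth.
have near y : `|y - ybar| < r -> gamma0 * `|y - ybar| ^+ 2 <= bregman y.
  by move=> yr; have := hr y; rewrite /bregman /= distrC => /(_ yr); lra.
have [q q0 qr] : exists2 q, 0 < q & q < r by exists (r / 2); lra.
have far y : q <= `|y - ybar| -> gamma0 * q * `|y - ybar| <= bregman y.
  move=> yq; have y0 : 0 < `|y - ybar| by exact: lt_le_trans yq.
  have [yq1|yq1] := eqVneq `|y - ybar| q.
    have := near y; rewrite yq1 -mulrA -expr2; exact.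
  have yq' : q < `|y - ybar| by rewrite lt_def yq1.
  (* The point of the segment at distance [q] from [ybar] lies where the local growth holds;
     convexity carries the bound out to [y]. *)
  pose s := q / `|y - ybar|.
  have s01 : 0 < s < 1 by rewrite divr_gt0 //= ltr_pdivrMr // mul1r.
  have := convex_le F_conv ybar y s01; have := near (ybar + s *: (y - ybar)).
  have sE : s * `|y - ybar| = q by rewrite /s divfK // gt_eqF.
  have [s0 s1] := andP s01.
  rewrite /bregman addrAC subrr add0r normrZ gtr0_norm // sE.
  rewrite (bformZr (dotC dotP) (dot_linl dotP)).
  move=> /(_ qr) h1 h2.
  have h3 : gamma0 * q ^+ 2 <= s * (F y - F ybar - dot (gradF ybar) (y - ybar)) by lra.
  rewrite -(ler_pM2l s0); apply: le_trans h3.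
  by rewrite mulrCA sE expr2 mulrA.
(* The first summand serves the near case. In the far case the linear bound is squared and one of
   the two factors [bregman y] is estimated by [M]. *)
pose C := gamma0^-1 + M / (gamma0 * q) ^+ 2.
have C0 : 0 < C by rewrite ltr_wpDr ?invr_gt0 // divr_ge0 // sqr_ge0.
exists C => // y yM; have D0 := bregman_ge0 y.
have [yq|yq] := ltP `|y - ybar| r.
  have := near y yq; rewrite mulrC -ler_pdivlMr // => /le_trans; apply.
  by rewrite mulrC ler_wpM2r // lerDl divr_ge0 // sqr_ge0.
have yq' : q <= `|y - ybar| by exact: le_trans (ltW qr) yq.
have := far y yq'; rewrite mulrC -ler_pdivlMr ?mulr_gt0 // => h.
apply: (@le_trans _ _ ((bregman y / (gamma0 * q)) ^+ 2)).
  by rewrite ler_pXn2r // ?nnegrE // divr_ge0 // ltW // mulr_gt0.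
rewrite expr_div_n /C mulrDl; apply: ler_wpDl.
  by rewrite mulr_ge0 // invr_ge0 ltW.
by rewrite [leRHS]mulrAC ler_wpM2r ?invr_ge0 ?sqr_ge0 // expr2 ler_wpM2r.
Qed.
End growth.

(** * Cost of weighted jumps, stationarity and exchange of mass; [G], [E] and [p] enter through
    their duality relations *)

Section descent.
Context {R : realType} {d : nat} (T : R).
Local Notation atom := (R * 'rV[R]_d)%type.
Local Notation dom := (dom T).
Context {Y : completeNormedModType R} {dot : Y -> Y -> R}.
Hypothesis dotP : hilbert_dot dot.
Context {F : Y -> R} {gradF : Y -> Y}.
Hypotheses (F_conv : strictly_convex F) (F_C1 : C1_with_gradient dot F gradF).
Context {L : R}.
Hypothesis L_gt0 : 0 < L.
Hypothesis gradF_lip : forall y z, `|gradF y - gradF z| <= L * `|y - z|.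
Context {beta : R}.
Hypothesis beta_gt0 : 0 < beta.

Let dC := dotC dotP.
Let dl := dot_linl dotP.

Context (G : R -> 'rV[R]_d -> Y) (E : 'rV[R]_d -> Y) (p : Y -> R -> 'rV[R]_d).
Hypotheses (GB : forall t v w, G t (v - w) = G t v - G t w)
  (EB : forall c c', E (c - c') = E c - E c')
  (EZ : forall a c, E (a *: c) = a *: E c).
Hypothesis dotE : forall c y, dot (E c) y = edot c (p y T).
Hypothesis dotG : forall t v y, dom t ->
  dot (G t v) y = edot v (p y T - p y t).
Context {C0 : R}.
Hypothesis C0_ge0 : 0 <= C0.
Hypothesis p_lip : forall y s t, 0 <= s <= T -> 0 <= t <= T ->
  enorm (p y s - p y t) <= C0 * `|y| * `|s - t|.
Hypothesis p0 : forall y, p y 0 = 0.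
Hypothesis T_gt0 : 0 < T.

Lemma dom_itv t : dom t -> 0 <= t <= T.
Proof. by rewrite /Defs.dom /= in_itv /= => /andP[/ltW -> /ltW ->]. Qed.

Lemma zT_itv : 0 <= T <= T. Proof. by rewrite lexx ltW. Qed.

Lemma edot_inj (x y : 'rV[R]_d) : (forall z, edot z x = edot z y) -> x = y.
Proof.
move=> h; apply/eqP; rewrite -subr_eq0; apply/eqP/enorm_eq0/eqP.
by rewrite -sqrf_eq0 sqr_enorm edotBr h subrr.
Qed.

(** Additivity of the dual curve in [y] is inherited from the inner product through the duality
    relations. *)
Lemma pB y z t : dom t \/ t = T -> p (y - z) t = p y t - p z t.
Proof.
have pT w w' : p (w - w') T = p w T - p w' T.
  by apply: edot_inj => v; rewrite edotBr -!dotE (bformBr dC dl).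
move=> [dt|->//]; apply: edot_inj => v.
have := dotG v (y - z) dt.
rewrite (bformBr dC dl) !dotG // pT !edotBr => h; lra.
Qed.

Lemma p_bound y t : 0 <= t <= T -> enorm (p y t) <= C0 * T * `|y|.
Proof.
move=> tT; have := p_lip y tT (_ : 0 <= 0 <= T).
rewrite lexx ltW // => /(_ isT); rewrite p0 !subr0 => /le_trans; apply.
have [t0 t1] := andP tT.
by rewrite ger0_norm // mulrAC ler_wpM2r // ler_wpM2l.
Qed.

Let C1 := C0 * (1 + T).

Lemma C1_ge0 : 0 <= C1.
Proof. by rewrite mulr_ge0 // addr_ge0 // ltW. Qed.

Lemma norm_le_dot (g : Y) (M : R) : 0 <= M -> dot g g <= M * `|g| -> `|g| <= M.
Proof.
rewrite (dot_norm dotP) => M0 h; have [->|g0] := eqVneq g 0; first by rewrite normr0.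
by move: h; rewrite expr2 ler_pM2r // normr_gt0.
Qed.

(** The difference of the two observations is tested against itself, which turns the Lipschitz bound
    on the dual curve into one on [t]. *)
Lemma normGB1 t t' v : dom t -> dom t' ->
  `|G t v - G t' v| <= C0 * `|t - t'| * enorm v.
Proof.
move=> dt dt'; apply: norm_le_dot; first by rewrite !mulr_ge0 ?enorm_ge0.
rewrite (bformBl dl) !dotG // -edotBr opprB addrC addrA subrK.
apply: le_trans (edot_ler _ _) _.
have := p_lip (G t v - G t' v) (dom_itv dt') (dom_itv dt); rewrite (distrC t').
by move=> /(ler_wpM2l (enorm_ge0 v)); lra.
Qed.

Lemma normG t v : dom t -> `|G t v| <= C1 * enorm v.
Proof.
move=> dt; apply: norm_le_dot; first by rewrite mulr_ge0 ?C1_ge0 ?enorm_ge0.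
rewrite dotG //; apply: le_trans (edot_ler _ _) _.
have := p_lip (G t v) zT_itv (dom_itv dt).
move=> /(ler_wpM2l (enorm_ge0 v)) /le_trans; apply.
have [t0 t1] := andP (dom_itv dt); rewrite ger0_norm ?subr_ge0 //.
have : 0 <= C0 * enorm v * `|G t v| by rewrite !mulr_ge0 ?enorm_ge0.
move=> /(mulr_ge0 t0); have := C0_ge0.
have : 0 <= C0 * enorm v * `|G t v| by rewrite !mulr_ge0 ?enorm_ge0.
rewrite /C1; lra.
Qed.

Lemma normGB t t' v v' : dom t -> dom t' -> enorm v' = 1 ->
  `|G t v - G t' v'| <= C1 * (`|t - t'| + enorm (v - v')).
Proof.
move=> dt dt' v1.
have -> : G t v - G t' v' = G t (v - v') + (G t v' - G t' v').
  by rewrite GB addrA subrK.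
apply: le_trans (ler_normD _ _) _.
have := normG (v - v') dt; have := normGB1 v' dt dt'; rewrite v1.
have : 0 <= C0 * T * `|t - t'| by rewrite !mulr_ge0 // ltW.
rewrite /C1; lra.
Qed.

Local Notation synth := (synth G E).

Definition cost (s : seq (R * atom)) c : R := F (synth s c) + beta * mass s.

Definition dualvar s c : R -> 'rV[R]_d := p (gradF (synth s c)).

Lemma EN c : E (- c) = - E c.
Proof. by rewrite -[- c]scaleN1r EZ scaleN1r. Qed.

Lemma ED c c' : E (c + c') = E c + E c'.
Proof. by rewrite -[in LHS](opprK c') EB EN opprK. Qed.

Lemma E0 : E 0 = 0.
Proof. by rewrite -[0](scale0r (0 : 'rV[R]_d)) EZ scale0r. Qed.

Definition reweight (f : R * atom -> R) (s : seq (R * atom)) : seq (R * atom) :=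
  [seq (f x, x.2) | x <- s].

Lemma sum_reweight (V : nmodType) (f : R * atom -> R) s (h : R * atom -> V) :
  \sum_(x <- reweight f s) h x = \sum_(x <- s) h (f x, x.2).
Proof. by rewrite big_map. Qed.

(** The first-order conditions of the coefficient problem at positive magnitudes: the derivative in
    the constant vanishes, and so does the derivative along the rescaling of any subfamily [Q]. The
    freedom in [Q] allows the atoms of a single ball to be moved later on. *)
Definition stationary s c : Prop :=
  dualvar s c T = 0 /\
  forall Q : pred (R * atom), \sum_(x <- s | Q x)
    x.1 * (beta - edot x.2.2 (dualvar s c x.2.1)) = 0.

Lemma dot_synth s c y : (forall x, x \in s -> dom x.2.1) -> p y T = 0 ->
  dot y (synth s c) = - \sum_(x <- s) x.1 * edot x.2.2 (p y x.2.1).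
Proof.
move=> hs pT; rewrite dC /synth (bformDl dl) dotE pT edot0r addr0.
rewrite (bform_suml dl) -sumrN; apply: eq_big_seq => x xs.
rewrite (bformZl dl) dotG; last exact: hs.
by rewrite pT sub0r edotNr mulrN.
Qed.

Lemma optimal_mean s c :
  (forall c', cost s c <= cost s c') -> dualvar s c T = 0.
Proof.
move=> opt.
have ge0 z : 0 <= edot z (dualvar s c T).
  have := @slope_ge0 _ _ _ dotP _ _ F_conv F_C1 _ gradF_lip
    (synth s c) (E z) 0.
  rewrite addr0 dC dotE; apply => h _; rewrite mulr0 addr0.
  by have := opt (c + h *: z); rewrite /cost lerD2r /synth ED EZ addrA.
have := ge0 (- dualvar s c T); rewrite edotNl oppr_ge0 => le0.
apply/enorm_eq0/eqP; rewrite -sqrf_eq0 sqr_enorm.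
by rewrite eq_le le0 edot_ge0.
Qed.

(** Since all magnitudes are positive, the atoms in [Q] can be scaled both up and down, so the
    one-sided slope condition holds with both signs. *)
Lemma optimal_stationary s c :
  (forall x, x \in s -> 0 < x.1 /\ dom x.2.1) ->
  (forall f c', (forall x, x \in s -> 0 <= f x) ->
    cost s c <= cost (reweight f s) c') ->
  stationary s c.
Proof.
move=> hs opt.
have s_id : reweight fst s = s.
  by rewrite /reweight -[RHS]map_id; apply: eq_map => -[].
have pT : dualvar s c T = 0.
  apply: optimal_mean => c'; have := opt fst c'; rewrite s_id; apply => x xs.
  by apply: ltW; have [] := hs x xs.
split=> // Q.
have dom_s x : x \in s -> dom x.2.1 by move=> /hs [].
have ge0 (e : R) : `|e| <= 1 ->
    0 <= e * \sum_(x <- s | Q x) x.1 * (beta - edot x.2.2 (dualvar s c x.2.1)).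
  move=> e1.
  (* The atoms in [Q] are scaled by [1 + r * e], which keeps magnitudes nonnegative for [|e| <= 1]
     and [r <= 1]; [e = 1] and [e = -1] are used in the end. *)
  pose q x : R := if Q x then e * x.1 else 0.
  pose h := synth (reweight q s) 0.
  have := @slope_ge0 _ _ _ dotP _ _ F_conv F_C1 _ gradF_lip
    (synth s c) h (beta * mass (reweight q s)).
  have -> : dot (gradF (synth s c)) h + beta * mass (reweight q s) =
      e * \sum_(x <- s | Q x) x.1 * (beta - edot x.2.2 (dualvar s c x.2.1)).
    rewrite dot_synth; [|by move=> x /mapP[y ys ->]; exact: (dom_s y)|exact: pT].
    rewrite /mass !sum_reweight /= mulr_sumr mulr_sumr -sumrN -big_split /=.
    rewrite [RHS]big_mkcond; apply: eq_bigr => x _ /=.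
    by rewrite /q; case: ifP => _; rewrite /dualvar; ring.
  apply => r /andP[r0 r1].
  have rq x : x \in s -> 0 <= x.1 + r * q x.
    move=> /hs [x0 _]; rewrite /q; case: ifP => _; last by rewrite mulr0 addr0 ltW.
    have : `|r * e| <= 1.
      by rewrite normrM gtr0_norm // mulr_ile1 // ltW.
    rewrite ler_norml => /andP[re _]; rewrite mulrA -[X in X + _]mul1r -mulrDl.
    by apply: mulr_ge0; [lra | exact: ltW].
  have := opt (fun x => x.1 + r * q x) c rq; rewrite /cost.
  have -> : mass (reweight (fun x => x.1 + r * q x) s) =
      mass s + r * mass (reweight q s).
    by rewrite /mass !sum_reweight big_split /= mulr_sumr.
  have -> : synth (reweight (fun x => x.1 + r * q x) s) c = synth s c + r *: h.
    rewrite /h /synth !sum_reweight /=; under eq_bigr do rewrite scalerDl -scalerA.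
    by rewrite big_split /= -scaler_sumr E0 addr0 addrAC.
  lra.
have := ge0 1; have := ge0 (-1); rewrite normrN1 normr1 lexx => /(_ isT) h1 /(_ isT).
by move: h1; lra.
Qed.


(** A fraction [h] of the atoms in [Q] is exchanged against mass [h * m] at the jump [(t, v)]. By
    stationarity the removal is free to first order, so only the new jump shows up in the linear
    term; [descent_le] along the exchanged observation gives the quadratic one. *)
Lemma cost_transfer s c (Q : pred (R * atom)) (m h t : R) v :
  (forall x, x \in s -> dom x.2.1) -> stationary s c -> dom t ->
  cost (rcons (reweight (fun x => if Q x then (1 - h) * x.1 else x.1) s)
         (h * m, (t, v))) c <=
  cost s c + h * (m * (beta - edot v (dualvar s c t)))
  + h ^+ 2 * (L * `|m *: G t v - \sum_(x <- s | Q x) x.1 *: G x.2.1 x.2.2| ^+ 2).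
Proof.
move=> ds [pT st] dt; set D := m *: G t v - _; pose y := synth s c.
pose f (x : R * atom) := if Q x then (1 - h) * x.1 else x.1.
have sumf (V : lmodType R) (g : R * atom -> V) : \sum_(x <- s) f x *: g x =
    \sum_(x <- s) x.1 *: g x - h *: \sum_(x <- s | Q x) x.1 *: g x.
  rewrite [X in _ - _ *: X]big_mkcond /= scaler_sumr -sumrB; apply: eq_bigr => x _.
  rewrite /f; case: ifP => _; last by rewrite scaler0 subr0.
  by rewrite scalerA -scalerBl mulrBl mul1r.
have synthE : synth (rcons (reweight f s) (h * m, (t, v))) c = y + h *: D.
  rewrite /synth -cats1 big_cat big_seq1 /= sum_reweight /= sumf.
  rewrite /y /synth /D scalerBr scalerA [RHS]addrAC; congr (_ + _).
  by rewrite -addrA (addrC (- _)).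
have massE : mass (rcons (reweight f s) (h * m, (t, v))) =
    mass s + h * (m - \sum_(x <- s | Q x) x.1).
  rewrite /mass -cats1 big_cat big_seq1 /= sum_reweight /=.
  have -> : \sum_(x <- s) f x = \sum_(x <- s) x.1 - h * \sum_(x <- s | Q x) x.1.
    rewrite [X in _ - _ * X]big_mkcond /= mulr_sumr -sumrB; apply: eq_bigr => x _.
    by rewrite /f; case: ifP => _; ring.
  by ring.
have dotD : dot (gradF y) D = - (m * edot v (dualvar s c t))
    + beta * \sum_(x <- s | Q x) x.1.
  rewrite dC (bformBl dl) (bformZl dl) dotG // -/(dualvar s c) pT sub0r edotNr mulrN.
  congr (_ + _); rewrite (bform_suml dl) mulr_sumr.
  apply/eqP; rewrite -subr_eq0 -opprD oppr_eq0 -big_split /=; apply/eqP.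
  rewrite -[RHS](st Q) big_seq_cond [RHS]big_seq_cond.
  apply: eq_bigr => x /andP[xs _].
  rewrite (bformZl dl) dotG; last exact: ds.
  by rewrite -/(dualvar s c) pT sub0r edotNr; ring.
have := descent_le dotP F_conv F_C1 gradF_lip y (h *: D).
rewrite (bformZr dC dl) normrZ exprMn -normrX (ger0_norm (sqr_ge0 h)).
rewrite /cost -/f synthE massE dotD -/y; move=> hd; rewrite -subr_ge0 in hd.
rewrite -subr_ge0; move: hd; congr (0 <= _); ring.
Qed.


(** * The excess over the optimal value and the quantities it controls *)

Context {N : nat} (tbar : 'I_N -> R) (vbar : 'I_N -> 'rV[R]_d) (rad : R)
  (mubar : 'I_N -> R) (cbar : 'rV[R]_d).
Hypotheses (dom_tbar : forall i, dom (tbar i))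
  (vbar1 : forall i, enorm (vbar i) = 1)
  (mubar_gt0 : forall i, 0 < mubar i).

Let ybar := \sum_i mubar i *: G (tbar i) (vbar i) + E cbar.
Let pbar := p (gradF ybar).
Local Notation bregman := (@bregman R Y dot F gradF ybar).
Local Notation nearest := (nearest tbar rad).
Local Notation offset := (offset tbar vbar rad).
Local Notation spread := (spread tbar vbar rad).
Local Notation lump := (lump tbar rad).
Local Notation admissible := (admissible dom).

Context {sigma theta0 gamma0 : R}.
Hypotheses (sigma_gt0 : 0 < sigma) (theta0_gt0 : 0 < theta0)
  (gamma0_gt0 : 0 < gamma0).
Hypotheses (pbarT : pbar T = 0)
  (pbar_tbar : forall i, pbar (tbar i) = beta *: vbar i).
Hypothesis pbar_near : forall t i, dom t -> nearest t = Some i ->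
  theta0 * `|t - tbar i| ^+ 2 <= beta - enorm (pbar t).
Hypothesis pbar_far : forall t, dom t -> nearest t = None ->
  enorm (pbar t) <= beta - sigma.
Hypothesis F_growth : \forall y \near ybar,
  F y >= F ybar + dot (gradF ybar) (y - ybar) + gamma0 * `|y - ybar| ^+ 2.
Hypothesis indep : forall (a : 'I_N -> R) (b : 'rV[R]_d),
  \sum_i a i *: G (tbar i) (vbar i) + E b = 0 -> (forall i, a i = 0) /\ b = 0.

Let mass_bar := \sum_i mubar i.

Definition excess s c : R := cost s c - (F ybar + beta * mass_bar).

Definition slack (x : atom) : R := beta - edot x.2 (pbar x.1).

Lemma mass_bar_ge0 : 0 <= mass_bar.
Proof. by apply: sumr_ge0 => i _; rewrite ltW. Qed.

Lemma dot_ybar y : p y T = 0 ->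
  dot y ybar = - \sum_i mubar i * edot (vbar i) (p y (tbar i)).
Proof.
move=> pT; rewrite dC /ybar (bformDl dl) dotE pT edot0r addr0.
rewrite (bform_suml dl) -sumrN; apply: eq_bigr => i _.
by rewrite (bformZl dl) dotG // pT sub0r edotNr mulrN.
Qed.

Lemma edot_unit (v : 'rV[R]_d) : enorm v = 1 -> edot v v = 1.
Proof. by move=> v1; rewrite -sqr_enorm v1 expr1n. Qed.

(** As [pbar] vanishes at [T] and equals [beta *: vbar i] at [tbar i], the linear term of the
    Bregman distance contributes [- beta * mass_bar] at [ybar] and the products with [pbar] at the
    atoms of [s]; regrouping gives the slacks. *)
Lemma excessE s c : admissible s ->
  excess s c = bregman (synth s c) + \sum_(x <- s) x.1 * slack x.2.
Proof.
move=> hs; rewrite /excess /cost /bregman (bformBr dC dl) dot_synth //; last first.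
  by move=> x /hs[].
rewrite dot_ybar // -/pbar.
under [X in _ = _ - (- _ - - X) + _]eq_bigr do
  rewrite pbar_tbar edotZr edot_unit // mulr1 mulrC.
rewrite -mulr_sumr -/mass_bar /mass /slack.
under [X in _ = _ + X]eq_bigr do rewrite mulrBr mulrC.
rewrite sumrB -mulr_sumr; lra.
Qed.

Lemma pbar_le t : dom t -> enorm (pbar t) <= beta.
Proof.
move=> dt; case e : (nearest t) => [i|]; last by have := pbar_far dt e; have := sigma_gt0; lra.
have := pbar_near dt e; have : 0 <= theta0 * `|t - tbar i| ^+ 2.
  by rewrite mulr_ge0 ?sqr_ge0 // ltW.
lra.
Qed.

Lemma slack_ge_norm x : enorm x.2 = 1 -> beta - enorm (pbar x.1) <= slack x.
Proof.
move=> v1; rewrite /slack lerD2l lerN2.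
by apply: le_trans (edot_ler _ _) _; rewrite v1 mul1r.
Qed.

Lemma slack_ge0 x : dom x.1 -> enorm x.2 = 1 -> 0 <= slack x.
Proof.
by move=> /pbar_le; rewrite -subr_ge0 => h /slack_ge_norm; apply: le_trans.
Qed.

Let Lp := C0 * `|gradF ybar|.

Lemma pbar_lip s t : dom s -> dom t -> enorm (pbar s - pbar t) <= Lp * `|s - t|.
Proof. by move=> /dom_itv ds /dom_itv dt; exact: p_lip. Qed.

Lemma Lp_ge0 : 0 <= Lp. Proof. by rewrite mulr_ge0. Qed.

(** Outside the balls the offset is 1 and the slack at least [sigma]. Inside, the decay of |pbar|
    controls the distance in time. For the direction, |pbar| <= beta gives that [beta *: x.2] is
    within the square root of [2 * beta * slack x] of [pbar x.1], which in turn is close to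
    [beta *: vbar i] by Lipschitz continuity. *)
Lemma offset_sqr_le : exists2 C : R, 0 < C &
  forall x, dom x.1 -> enorm x.2 = 1 -> offset x ^+ 2 <= C * slack x.
Proof.
pose C := sigma^-1 + 2 * theta0^-1 +
  2 * (beta ^+ 2)^-1 * (4 * beta + 2 * Lp ^+ 2 / theta0).
have [sv0 tv0] : 0 < sigma^-1 /\ 0 < theta0^-1 by rewrite !invr_gt0.
have Q0 : 0 <= 2 * (beta ^+ 2)^-1 * (4 * beta + 2 * Lp ^+ 2 / theta0).
  rewrite mulr_ge0 // ?mulr_ge0 ?invr_ge0 ?sqr_ge0 //.
  by rewrite addr_ge0 ?mulr_ge0 ?sqr_ge0 ?invr_ge0 // ltW.
have C_gt0 : 0 < C by rewrite /C; lra.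
exists C => // x dx v1.
have w0 := slack_ge0 dx v1; have wn := slack_ge_norm v1.
rewrite /offset; case e : (nearest x.1) => [i|]; last first.
  rewrite expr1n; have := pbar_far dx e => far.
  have : 1 <= sigma^-1 * slack x by rewrite ler_pdivlMl // mulr1; lra.
  move=> /le_trans; apply; rewrite ler_wpM2r // /C; lra.
have near := le_trans (pbar_near dx e) wn.
set a := `|_| in near *; set b := enorm _.
have a2 : a ^+ 2 <= theta0^-1 * slack x by rewrite ler_pdivlMl.
have n1 : enorm (beta *: x.2 - pbar x.1) ^+ 2 <= 2 * beta * slack x.
  rewrite sqr_enorm edotBl !edotBr !edotZl !edotZr edot_unit //.
  rewrite (edotC (pbar _) x.2) -sqr_enorm.
  have : enorm (pbar x.1) ^+ 2 <= beta ^+ 2.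
    by rewrite ler_pXn2r ?nnegrE ?enorm_ge0 ?pbar_le // ltW.
  rewrite /slack; lra.
have n2 : beta * b <= enorm (beta *: x.2 - pbar x.1) + Lp * a.
  rewrite -[X in X * b](gtr0_norm beta_gt0) -enormZ scalerBr -pbar_tbar.
  have -> : beta *: x.2 - pbar (tbar i) =
      (beta *: x.2 - pbar x.1) + (pbar x.1 - pbar (tbar i)).
    by rewrite addrA subrK.
  by apply: le_trans (enormD _ _) _; rewrite lerD2l pbar_lip.
have n3 : beta ^+ 2 * b ^+ 2 <= (4 * beta + 2 * Lp ^+ 2 / theta0) * slack x.
  rewrite -exprMn; apply: (@le_trans _ _
    ((enorm (beta *: x.2 - pbar x.1) + Lp * a) ^+ 2)).
    have u0 : 0 <= enorm (beta *: x.2 - pbar x.1) + Lp * a.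
      by apply: addr_ge0; [exact: enorm_ge0 | exact: (mulr_ge0 Lp_ge0 (normr_ge0 _))].
    have b0 : 0 <= beta * b by apply: mulr_ge0; [exact: ltW | exact: enorm_ge0].
    by rewrite ler_pXn2r ?nnegrE.
  set u := enorm _ in n1 *.
  have : Lp ^+ 2 * a ^+ 2 <= Lp ^+ 2 * (theta0^-1 * slack x).
    by rewrite ler_wpM2l // sqr_ge0.
  have := sqr_ge0 (u - Lp * a); lra.
have b2 : b ^+ 2 <= (beta ^+ 2)^-1 * ((4 * beta + 2 * Lp ^+ 2 / theta0) * slack x).
  by rewrite ler_pdivlMl // exprn_gt0.
have s0 : 0 <= sigma^-1 * slack x by rewrite mulr_ge0 // ltW.
have q0 : 0 <= 2 * theta0^-1 * slack x by rewrite !mulr_ge0 // ltW.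
have -> : C * slack x = sigma^-1 * slack x + 2 * (theta0^-1 * slack x) +
    2 * ((beta ^+ 2)^-1 * ((4 * beta + 2 * Lp ^+ 2 / theta0) * slack x)).
  by rewrite /C; ring.
have := sqr_ge0 (a - b); lra.
Qed.

(** A duality gap: the tangent inequality at the current observation, evaluated at [ybar], where
    stationarity replaces the products over [s] by [beta * mass s]. At [Pn = beta] it says that a
    stopped iterate is optimal. *)
Lemma gap s c Pn : admissible s -> stationary s c ->
  (forall t, dom t -> enorm (dualvar s c t) <= Pn) ->
  excess s c <= mass_bar * (Pn - beta).
Proof.
move=> hs [pT st] hP.
have := convex_tangent dotP F_conv F_C1 (synth s c) ybar.
rewrite (bformBr dC dl) dot_ybar // dot_synth //; last by move=> x /hs[].
have := st predT; under eq_bigr do rewrite mulrBr mulrC.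
rewrite sumrB -mulr_sumr -/(mass s) /dualvar /excess /cost.
have : \sum_i mubar i * edot (vbar i) (p (gradF (synth s c)) (tbar i)) <=
    mass_bar * Pn.
  rewrite mulr_suml; apply: ler_sum => i _; rewrite ler_pM2l //.
  apply: le_trans (edot_ler _ _) _; rewrite vbar1 mul1r; exact: hP.
lra.
Qed.


(** The optimal jumps and the coordinate constants are put into one family indexed by ['I_(N + d)],
    to which [injective_bounded_below] applies. *)
Lemma lumps_bounded_below : exists2 kappa : R, 0 < kappa &
  forall (a : 'I_N -> R) (b : 'rV[R]_d), kappa * (\sum_i `|a i| + enorm b) <=
    `|\sum_i a i *: G (tbar i) (vbar i) + E b|.
Proof.
pose g (k : 'I_(N + d)) : Y := match fintype.split k with
  | inl i => G (tbar i) (vbar i) | inr j => E (delta_mx 0 j) end.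
have E_row (b : 'rV[R]_d) : E b = \sum_j b 0 j *: E (delta_mx 0 j).
  rewrite [in LHS](row_sum_delta b).
  by elim/big_rec2: _ => [|i u w _ <-]; [exact: E0 | rewrite ED EZ].
have sumg (a : 'I_(N + d) -> R) : \sum_k a k *: g k =
    \sum_i a (lshift d i) *: G (tbar i) (vbar i) + E (\row_j a (rshift N j)).
  rewrite big_split_ord E_row; congr (_ + _); apply: eq_bigr => i _; rewrite /g.
    by rewrite (@fintype.unsplitK N d (inl i)).
  by rewrite (@fintype.unsplitK N d (inr i)) mxE.
have [|kappa k0 hk] := injective_bounded_below (y := g).
  move=> a; rewrite sumg => /indep[ha hb] k; rewrite -(fintype.splitK k).
  case: (fintype.split k) => [i|j] /=; first exact: ha.
  by move/rowP: hb => /(_ j); rewrite !mxE.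
exists kappa => // a b.
pose ab (k : 'I_(N + d)) : R := match fintype.split k with
  | inl i => a i | inr j => b 0 j end.
have abl i : ab (lshift d i) = a i by rewrite /ab (@fintype.unsplitK N d (inl i)).
have abr j : ab (rshift N j) = b 0 j by rewrite /ab (@fintype.unsplitK N d (inr j)).
have := hk ab; rewrite sumg big_split_ord /=.
have -> : \row_j ab (rshift N j) = b by apply/rowP => j; rewrite mxE abr.
under eq_bigr do rewrite abl; under [X in _ + X]eq_bigr do rewrite abr.
under [X in _ <= `|X + _|]eq_bigr do rewrite abl.
apply: le_trans; rewrite ler_pM2l // lerD2l; exact: enorm_le_sum.
Qed.

Implicit Types (s : seq (R * atom)) (c : 'rV[R]_d).

Definition discrepancy (s : seq (R * atom)) (c : 'rV[R]_d) : R :=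
  \sum_i `|lump s i - mubar i| + enorm (c - cbar).

Lemma discrepancy_ge0 s c : 0 <= discrepancy s c.
Proof. by rewrite addr_ge0 ?enorm_ge0 // sumr_ge0. Qed.

Lemma spread_ge0 s : admissible s -> 0 <= spread s.
Proof.
move=> hs; rewrite /spread big_seq sumr_ge0 // => x /hs[x0 _ _].
by rewrite mulr_ge0 ?offset_ge0 // ltW.
Qed.

Lemma mass_ge0 s : admissible s -> 0 <= mass s.
Proof. by move=> hs; rewrite /mass big_seq sumr_ge0 // => x /hs[/ltW]. Qed.

Lemma excess_ge0 s c : admissible s -> 0 <= excess s c.
Proof.
move=> hs; rewrite excessE // addr_ge0 ?(bregman_ge0 dotP F_conv F_C1) //.
by rewrite big_seq sumr_ge0 // => x /hs[/ltW x0 dx v1]; rewrite mulr_ge0 ?slack_ge0.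
Qed.

Lemma sqr_le_affine (x A B : R) : 0 <= x -> 0 <= A -> 0 <= B ->
  x ^+ 2 <= A + B * x -> x <= A + B + 1.
Proof.
move=> x0 A0 B0 h; rewrite leNgt; apply/negP => lt.
have x1 : 1 <= x by apply: ltW; apply: le_lt_trans lt; lra.
have : A * 1 <= A * x by rewrite ler_wpM2l.
have : (A + B + 1) * x < x * x by rewrite ltr_pM2r // (lt_le_trans ltr01).
move: h; rewrite expr2; lra.
Qed.

(** Bregman growth bounds the observation error, weighted Cauchy-Schwarz with [offset_sqr_le] bounds
    [spread], and [lumps_bounded_below] applied to [synthB] bounds [discrepancy]. The bound on
    [spread] contains the mass, which is itself bounded only through [spread] and [discrepancy]; the
    circle closes because [spread] enters one side squared and the other linearly. *)
Lemma excess_bounds (M : R) : 0 <= M -> exists2 C : R, 0 < C &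
  forall s c, admissible s -> excess s c <= M ->
  [/\ mass s <= C, `|synth s c - ybar| ^+ 2 <= C * excess s c,
      spread s ^+ 2 <= C * excess s c &
      discrepancy s c ^+ 2 <= C * excess s c].
Proof.
move=> M0.
have [Cg Cg0 hg] := bregman_growth dotP F_conv F_C1 gamma0_gt0 F_growth M0.
have [Co Co0 ho] := offset_sqr_le.
have [kappa k0 hk] := lumps_bounded_below.
have ki : 0 < kappa^-1 by rewrite invr_gt0.
have C1p := C1_ge0.
have core s c : admissible s -> excess s c <= M ->
  [/\ `|synth s c - ybar| ^+ 2 <= Cg * excess s c,
      spread s ^+ 2 <= mass s * (Co * excess s c),
      discrepancy s c <= kappa^-1 * (`|synth s c - ybar| + C1 * spread s) &
      mass s <= mass_bar + discrepancy s c + spread s].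
  move=> hs eM; have eE := excessE c hs.
  have sl0 : 0 <= \sum_(x <- s) x.1 * slack x.2.
    by rewrite big_seq sumr_ge0 // => x /hs[/ltW x0 dx v1]; rewrite mulr_ge0 ?slack_ge0.
  have br0 := bregman_ge0 dotP F_conv F_C1 ybar (synth s c).
  split.
  - apply: le_trans (hg (synth s c) _) _; first lra.
    by rewrite ler_pM2l //; lra.
  (* [sqr_sum_wle] asks for weights that are nonnegative everywhere, not only on [s]. *)
  - pose m (x : R * atom) := Num.max x.1 0.
    have mE x : x \in s -> m x = x.1.
      by move=> /hs[/ltW x0 _ _]; rewrite /m; apply/max_idPl.
    have := @sqr_sum_wle R _ s predT m (fun x => offset x.2)
      (fun x => ltac:(by rewrite /m le_max lexx orbT)).
    have e1 (f : R * atom -> R) : \sum_(x <- s) m x * f x = \sum_(x <- s) x.1 * f x.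
      by apply: eq_big_seq => x /mE ->.
    have e2 : \sum_(x <- s) m x = mass s by apply: eq_big_seq => x /mE ->.
    rewrite !e1 e2 => /le_trans; apply; rewrite ler_wpM2l ?mass_ge0 //.
    apply: (@le_trans _ _ (Co * \sum_(x <- s) x.1 * slack x.2)); last first.
      by rewrite ler_pM2l //; lra.
    rewrite mulr_sumr big_seq [leRHS]big_seq; apply: ler_sum => x /hs[x0 dx v1].
    by rewrite [leRHS]mulrCA ler_pM2l // ho.
  - rewrite ler_pdivlMl //; apply: le_trans (hk _ _) _.
    have := synthB tbar vbar rad G mubar cbar EB s c; rewrite -/ybar => e.
    have -> : \sum_i (lump s i - mubar i) *: G (tbar i) (vbar i) + E (c - cbar) =
      (synth s c - ybar) - residue tbar vbar rad G s by rewrite e addrAC subrr add0r.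
    apply: le_trans (ler_normB _ _) _; rewrite lerD2l.
    have nB u w (_ _ : True) : `|u + w : Y| <= `|u| + `|w| by exact: ler_normD.
    have nZ a u (_ : True) : `|a *: u : Y| = `|a| * `|u| by exact: normrZ.
    exact: (@seminorm_residue R d N tbar vbar rad Y G (fun=> True) Num.norm C1
      I _ _ (normr0 _) nB nZ dom _ normG normGB dom_tbar vbar1 s hs).
  - apply: le_trans (mass_le_lumps tbar vbar rad hs) _; rewrite lerD2r.
    rewrite /discrepancy addrA; apply: ler_wpDr; first exact: enorm_ge0.
    rewrite -big_split /=; apply: ler_sum => i _.
    by have := ler_norm (lump s i - mubar i); lra.
pose q := Num.sqrt (Cg * M).
have q0 : 0 <= q by exact: sqrtr_ge0.
pose A := mass_bar + kappa^-1 * q; pose B := kappa^-1 * C1 + 1.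
have A0 : 0 <= A by rewrite addr_ge0 ?mass_bar_ge0 // mulr_ge0 // ltW.
have B0 : 0 <= B by rewrite addr_ge0 // mulr_ge0 // ltW.
pose D := A * (Co * M) + B * (Co * M) + 1.
have CM0 : 0 <= Co * M by rewrite mulr_ge0 // ltW.
pose W := A + B * D.
have D0 : 0 <= D by rewrite /D !addr_ge0 // mulr_ge0.
have W0 : 0 <= W by apply: addr_ge0 => //; exact: mulr_ge0.
pose Z := 2 * (kappa^-1) ^+ 2 * (Cg + C1 ^+ 2 * (W * Co)).
have WC : 0 <= W * Co by rewrite mulr_ge0 // ltW.
have Z0 : 0 <= Z.
  apply: mulr_ge0; first by rewrite mulr_ge0 ?sqr_ge0.
  by apply: addr_ge0; [exact: ltW | rewrite mulr_ge0 ?sqr_ge0].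
exists (W + Cg + W * Co + Z) => [|s c hs eM]; first lra.
have [h1 h2 h3 h4] := core s c hs eM.
have e0 := excess_ge0 c hs; have sp0 := spread_ge0 hs.
have yq : `|synth s c - ybar| <= q.
  rewrite -(ger0_norm (normr_ge0 _)) -sqrtr_sqr ler_wsqrtr //.
  by apply: le_trans h1 _; rewrite ler_pM2l.
have massB : mass s <= A + B * spread s.
  apply: le_trans h4 _.
  have : kappa^-1 * (`|synth s c - ybar| + C1 * spread s) <=
    kappa^-1 * (q + C1 * spread s) by rewrite ler_pM2l // lerD2r.
  rewrite /A /B; lra.
(* The self-improving step: inserting the affine bound [massB] on the mass gives [spread s ^+ 2 <= A
   * (Co * M) + B * (Co * M) * spread s]. *)
have spD : spread s <= D.
  apply: sqr_le_affine; [done | exact: mulr_ge0 | exact: mulr_ge0 |].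
  apply: le_trans h2 _; apply: (@le_trans _ _ (mass s * (Co * M))).
    by rewrite ler_wpM2l ?mass_ge0 // ler_pM2l.
  rewrite mulrAC -mulrDl; exact: ler_wpM2r.
have mW : mass s <= W.
  by apply: le_trans massB _; rewrite lerD2l ler_wpM2l.
have spW : spread s ^+ 2 <= W * Co * excess s c.
  by apply: le_trans h2 _; rewrite -mulrA ler_wpM2r // mulr_ge0 // ltW.
have dZ : discrepancy s c ^+ 2 <= Z * excess s c.
  apply: (@le_trans _ _ ((kappa^-1 * (`|synth s c - ybar| + C1 * spread s)) ^+ 2)).
    rewrite ler_pXn2r ?nnegrE ?discrepancy_ge0 //.
    by apply: mulr_ge0; [exact: ltW | apply: addr_ge0 => //; exact: mulr_ge0].
  rewrite exprMn; set y := `|_| in h1 yq h3 *; set sp := spread s in spW *.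
  have : (y + C1 * sp) ^+ 2 <= 2 * (y ^+ 2 + C1 ^+ 2 * sp ^+ 2).
    by have := sqr_ge0 (y - C1 * sp); lra.
  have : C1 ^+ 2 * sp ^+ 2 <= C1 ^+ 2 * (W * Co * excess s c).
    by rewrite ler_wpM2l ?sqr_ge0.
  move=> a1 a2.
  have a3 : (y + C1 * sp) ^+ 2 <= 2 * (Cg + C1 ^+ 2 * (W * Co)) * excess s c by lra.
  apply: le_trans (ler_wpM2l (sqr_ge0 kappa^-1) a3) _.
  by rewrite /Z le_eqVlt; apply/orP; left; apply/eqP; ring.
have eX X X' : X <= X' -> X * excess s c <= X' * excess s c.
  by move=> XX; rewrite ler_wpM2r.
have aux (x1 x2 x3 x4 : R) : 0 <= x1 -> 0 <= x2 -> 0 <= x3 -> 0 <= x4 ->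
    [/\ x1 <= x1 + x2 + x3 + x4, x2 <= x1 + x2 + x3 + x4,
        x3 <= x1 + x2 + x3 + x4 & x4 <= x1 + x2 + x3 + x4].
  by move=> ? ? ? ?; split; lra.
have [l1 l2 l3 l4] := aux _ _ _ _ W0 (ltW Cg0) WC Z0.
split; [exact: le_trans l1|..].
- by apply: le_trans h1 _; exact: eX.
- by apply: le_trans spW _; exact: eX.
- by apply: le_trans dZ _; exact: eX.
Qed.


(** * The new jump, the decrease in one iteration, and geometric convergence *)

Definition peak (w : R -> 'rV[R]_d) (t : R) : Prop :=
  [/\ dom t, beta < enorm (w t) & forall t', dom t' -> enorm (w t') <= enorm (w t)].

Definition direction (w : R -> 'rV[R]_d) (t : R) : 'rV[R]_d :=
  (enorm (w t))^-1 *: w t.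

Lemma peak_gt0 w t : peak w t -> 0 < enorm (w t).
Proof. by case=> _ h _; exact: lt_trans h. Qed.

Lemma direction1 w t : peak w t -> enorm (direction w t) = 1.
Proof.
move=> /peak_gt0 w0; rewrite enormZ normfV ger0_norm ?enorm_ge0 //.
by rewrite mulVf // gt_eqF.
Qed.

Lemma edot_direction w t : peak w t -> edot (direction w t) (w t) = enorm (w t).
Proof.
by move=> /peak_gt0 w0; rewrite edotZl -sqr_enorm expr2 mulKf // gt_eqF.
Qed.

Lemma dual_diff_bound y t : dom t ->
  enorm (p (gradF y) t - pbar t) <= C0 * T * (L * `|y - ybar|).
Proof.
move=> dt; rewrite -pB; last by left.
apply: le_trans (p_bound _ (dom_itv dt)) _.
by rewrite ler_wpM2l // mulr_ge0 // ltW.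
Qed.

Lemma dual_diff_lip y t u : dom t -> dom u ->
  enorm ((p (gradF y) t - pbar t) - (p (gradF y) u - pbar u)) <=
  C0 * (L * `|y - ybar|) * `|t - u|.
Proof.
move=> dt du; rewrite -!pB; [|by left|by left].
apply: le_trans (p_lip _ (dom_itv dt) (dom_itv du)) _.
by rewrite ler_wpM2r // ler_wpM2l.
Qed.

(* The maximality of [t] compares |p_k(t)|^2 with |p_k(tbar)|^2; as p_k - pbar
   is Lipschitz with a constant O(|y - ybar|), the quadratic decay of |pbar|
   makes the distance itself O(|y - ybar|). *)
Lemma peak_offset (M : R) : 0 <= M -> exists2 C : R, 0 <= C &
  forall y t i, `|y - ybar| <= M -> peak (p (gradF y)) t -> nearest t = Some i ->
    offset (t, direction (p (gradF y)) t) <= C * `|y - ybar|.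
Proof.
move=> M0; pose em := C0 * (L * M).
have em0 : 0 <= em by rewrite mulr_ge0 // mulr_ge0 // ltW.
have Lp0 := Lp_ge0; have T0 := ltW T_gt0.
pose K1 := (2 * beta + 2 * T * Lp + 2 * T * em) / (theta0 * beta).
have num0 : 0 <= 2 * beta + 2 * T * Lp + 2 * T * em.
  by rewrite !addr_ge0 // !mulr_ge0 // ltW.
have K10 : 0 <= K1 by rewrite divr_ge0 // mulr_ge0 // ltW.
exists ((K1 + 2 * (T + Lp * K1) / beta) * (C0 * L)).
  apply: mulr_ge0; last by rewrite mulr_ge0 // ltW.
  apply: addr_ge0 => //; apply: divr_ge0; last exact: ltW.
  by rewrite mulr_ge0 // addr_ge0 // mulr_ge0.
move=> y t i yM pk ti; have [dt bt mx] := pk; set w := p (gradF y) in pk bt mx *.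
pose e := C0 * (L * `|y - ybar|).
have e0 : 0 <= e by rewrite mulr_ge0 // mulr_ge0 // ltW.
have eM : e <= em by rewrite ler_wpM2l // ler_pM2l.
have hB t' : dom t' -> enorm (w t' - pbar t') <= T * e.
  by move=> /(dual_diff_bound y); rewrite /e -/w; lra.
rewrite /offset ti /=; set dl' := `|t - tbar i|.
set P := pbar t; set B := pbar (tbar i).
pose ht := w t - P; pose hb := w (tbar i) - B.
have dh : enorm (ht - hb) <= e * dl' by exact: dual_diff_lip.
have nP : enorm P <= beta by exact: pbar_le.
have nB : enorm B = beta.
  by rewrite /B pbar_tbar enormZ vbar1 mulr1 gtr0_norm.
have PB : enorm (P - B) <= Lp * dl' by exact: pbar_lip.
have d0 : 0 <= dl' by exact: normr_ge0.
have cmp : edot (B + hb) (B + hb) <= edot (P + ht) (P + ht).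
  have -> : B + hb = w (tbar i) by rewrite /hb addrC subrK.
  have -> : P + ht = w t by rewrite /ht addrC subrK.
  by rewrite -!sqr_enorm ler_pXn2r ?nnegrE ?enorm_ge0 // mx.
have htn : enorm ht <= T * e by exact: hB.
have hbn : enorm hb <= T * e by exact: hB.
have t1 : edot (ht - hb) P <= e * dl' * beta.
  apply: le_trans (edot_ler _ _) _.
  by apply: ler_pM => //; exact: enorm_ge0.
have t2 : edot hb (P - B) <= T * e * (Lp * dl').
  apply: le_trans (edot_ler _ _) _.
  by apply: ler_pM => //; exact: enorm_ge0.
have t3 : edot (ht - hb) (ht + hb) <= e * dl' * (T * e + T * e).
  apply: le_trans (edot_ler _ _) _.
  apply: ler_pM => //; try exact: enorm_ge0.
  by apply: le_trans (enormD _ _) _; rewrite lerD.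
have growth : theta0 * dl' ^+ 2 * beta <= beta ^+ 2 - edot P P.
  have g := pbar_near dt ti; rewrite -/dl' -/P in g.
  have g0 : 0 <= theta0 * dl' ^+ 2 by rewrite mulr_ge0 ?sqr_ge0 // ltW.
  rewrite -sqr_enorm subr_sqr; apply: ler_pM => //; first exact: ltW.
  by rewrite lerDl enorm_ge0.
(* Expanding [cmp], the perturbation terms are twice [edot (ht - hb) P + edot hb (P - B)] plus
   [edot (ht - hb) (ht + hb)]. Each carries a factor [dl'] besides [e], so that one factor [dl']
   cancels against the quadratic decay. *)
have key : theta0 * beta * dl' ^+ 2 <=
    dl' * (e * (2 * beta + 2 * T * Lp + 2 * T * em)).
  have : 0 <= dl' * e * T * (em - e).
    by apply: mulr_ge0; rewrite ?subr_ge0 //; do 2 apply: mulr_ge0 => //.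
  move: cmp t1 t2 t3 growth; clearbody ht hb.
  rewrite !edotDl !edotDr !edotNl !edotNr (edotC P ht) (edotC B hb) (edotC hb ht).
  rewrite -[edot B B]sqr_enorm nB; lra.
have dK : dl' <= K1 * e.
  have [->|dn0] := eqVneq dl' 0; first exact: mulr_ge0.
  have dp : 0 < dl' by rewrite lt_def dn0.
  rewrite /K1 mulrAC ler_pdivlMr ?mulr_gt0 //.
  rewrite -(ler_pM2l dp); move: key; rewrite expr2; lra.
(* Replacing [w t] by its rescaling to length [beta] costs [enorm (w t) - beta], which is at most
   the distance from [w t] to [B], a vector of length [beta]; hence the factor 2. *)
have vK : beta * enorm (direction w t - vbar i) <= 2 * (T * e + Lp * dl').
  have wB : enorm (w t - B) <= T * e + Lp * dl'.
    have -> : w t - B = ht + (P - B) by rewrite /ht addrA subrK.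
    by apply: le_trans (enormD _ _) _; exact: lerD.
  have wn : enorm (w t) - beta <= enorm (w t - B).
    have : enorm (w t) <= enorm (w t - B) + enorm B.
      by rewrite -[in leLHS](subrK B (w t)) enormD.
    by rewrite nB; lra.
  rewrite -[X in X * _](gtr0_norm beta_gt0) -enormZ scalerBr -pbar_tbar -/B.
  have -> : beta *: direction w t - B =
      (w t - B) - (enorm (w t) - beta) *: direction w t.
    rewrite scalerBl /direction [in RHS]scalerA divff ?gt_eqF ?peak_gt0 //.
    by rewrite scale1r opprB [RHS]addrC addrA subrK.
  apply: le_trans (enormB _ _) _.
  rewrite enormZ direction1 // mulr1 ger0_norm; first lra.
  by rewrite subr_ge0 ltW.
have vK' : enorm (direction w t - vbar i) <= 2 * (T * e + Lp * (K1 * e)) / beta.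
  rewrite ler_pdivlMr // mulrC; apply: le_trans vK _.
  by rewrite ler_pM2l // lerD2l ler_wpM2l.
apply: le_trans (lerD dK vK') _.
by rewrite /e le_eqVlt; apply/orP; left; apply/eqP; ring.
Qed.


(** What the coefficient problem guarantees for the excess [e] of the next iterate: it beats every
    competitor carried by the old jumps and the new one with the same constant. *)
Definition improves (e : R) s c t : Prop :=
  forall f m, (forall x, x \in s -> 0 <= f x) -> 0 <= m ->
    e <= excess (rcons (reweight f s) (m, (t, direction (dualvar s c) t))) c.

Lemma improves_transfer e s c t (Q : pred (R * atom)) (m h : R) :
  admissible s -> stationary s c -> peak (dualvar s c) t -> improves e s c t ->
  0 <= h <= 1 -> 0 <= m ->
  e <= excess s c - h * (m * (enorm (dualvar s c t) - beta)) + h ^+ 2 * (L *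
    `|m *: G t (direction (dualvar s c) t)
      - \sum_(x <- s | Q x) x.1 *: G x.2.1 x.2.2| ^+ 2).
Proof.
move=> hs st pk imp /andP[h0 h1] m0.
have [dt _ _] := pk; have ds x : x \in s -> dom x.2.1 by case/hs.
have := @cost_transfer s c Q m h t (direction (dualvar s c) t) ds st dt.
rewrite (edot_direction pk).
have := imp (fun x => if Q x then (1 - h) * x.1 else x.1) (h * m) _ _.
rewrite /excess => H1 H2; apply: le_trans (H1 _ _) _; last first.
- by move: H2; lra.
- exact: mulr_ge0.
- move=> x /hs[/ltW x0 _ _]; case: ifP => // _.
  by rewrite mulr_ge0 // subr_ge0.
Qed.

(** All atoms are exchanged against mass [mass_bar] at the new jump. By [gap] the linear gain is at
    least [h * excess s c], and the exchanged observation is bounded because the mass is. *)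
Lemma sublinear_step (M : R) : 0 <= M -> exists2 B : R, 0 < B &
  forall e s c t h, admissible s -> excess s c <= M -> stationary s c ->
    peak (dualvar s c) t -> improves e s c t -> 0 <= h <= 1 ->
    e <= excess s c - h * excess s c + h ^+ 2 * B.
Proof.
move=> M0; have [C Cp hC] := excess_bounds M0.
have C1p := C1_ge0; have mb := mass_bar_ge0.
pose q := C1 * mass_bar + C1 * C.
have q0 : 0 <= q by rewrite addr_ge0 // mulr_ge0 // ltW.
exists (L * q ^+ 2 + 1); first by rewrite ltr_wpDl // mulr_ge0 ?sqr_ge0 // ltW.
move=> e s c t h hs eM st pk imp h01; have [h0 _] := andP h01.
have [mC _ _ _] := hC s c hs eM; have [dt _ mx] := pk.
have := improves_transfer predT hs st pk imp h01 mb.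
move=> /le_trans; apply; apply: lerD.
  rewrite lerD2l lerN2; apply: ler_wpM2l => //; exact: gap.
apply: ler_wpM2l; first exact: sqr_ge0.
apply: ler_wpDr => //; rewrite ler_pM2l // ler_pXn2r ?nnegrE //.
apply: le_trans (ler_normB _ _) _; apply: lerD.
  rewrite normrZ ger0_norm // mulrC ler_wpM2r //.
  by have := normG (direction (dualvar s c) t) dt; rewrite (direction1 pk) mulr1.
apply: le_trans (ler_norm_sum _ _ _) _.
apply: (@le_trans _ _ (C1 * mass s)); last exact: ler_wpM2l.
rewrite mulr_sumr big_seq [leRHS]big_seq; apply: ler_sum => x /hs[x0 dx v1].
rewrite normrZ gtr0_norm // mulrC ler_pM2r //.
by have := normG x.2.2 dx; rewrite v1 mulr1.
Qed.

(** Only the atoms in the ball of the new jump are exchanged, against their own total mass at that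
    jump. They and the new jump are close to the same optimal jump, so the quadratic term is bounded
    by [h ^+ 2] times a multiple of the excess. The linear gain is also proportional to the excess,
    since the ball carries mass at least [m0]; a small fixed [h] therefore yields a contraction. *)
Lemma linear_step (M : R) : 0 <= M -> exists eps q : R, [/\ 0 < eps, 0 < q < 1 &
  forall e s c t, admissible s -> excess s c <= M -> excess s c <= eps ->
    stationary s c -> peak (dualvar s c) t -> improves e s c t ->
    e <= q * excess s c].
Proof.
move=> M0; have [C Cp hC] := excess_bounds M0.
have C1p := C1_ge0; have mb := mass_bar_ge0.
pose Ym := Num.sqrt (C * M).
have [Cp' Cp'0 hpk] := @peak_offset Ym (sqrtr_ge0 _).
have [m0 m0p [m01 m0m]] : exists2 m0 : R, 0 < m0 &
    m0 <= 1 /\ forall i, m0 <= mubar i / 2.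
  exists (\big[Num.min/1]_i (mubar i / 2)).
    by apply: lt_bigmin => // i _; rewrite divr_gt0.
  split; first exact: bigmin_le_id.
  by move=> i; exact: bigmin_le.
pose k := C0 * T * L.
have k0 : 0 <= k by rewrite !mulr_ge0 // ltW.
pose rho := m0 / (mass_bar + 1).
have mb1 : 0 < mass_bar + 1 by rewrite ltr_wpDl.
have rho0 : 0 < rho by rewrite divr_gt0.
have rho1 : rho <= 1 by rewrite ler_pdivrMr // mul1r; lra.
pose Qc := 2 * C1 ^+ 2 * (C ^+ 2 * Cp' ^+ 2 * C + C).
have Qc0 : 0 <= Qc.
  apply: mulr_ge0; first by rewrite mulr_ge0 // sqr_ge0.
  by apply: addr_ge0; rewrite ?mulr_ge0 ?sqr_ge0 // ltW.
(* The quadratic term then consumes at most half of the linear gain [h * rho] times the excess. *)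
pose h := Num.min 1 (rho / (2 * (L * Qc + 1))).
have LQ : 0 < L * Qc + 1 by rewrite ltr_wpDl // mulr_ge0 // ltW.
have hp : 0 < h by rewrite lt_min ltr01 /= divr_gt0 // mulr_gt0.
have h1 : h <= 1 by rewrite ge_min lexx.
have hQ : h * (L * Qc + 1) <= rho / 2.
  have : h <= rho / (2 * (L * Qc + 1)) by rewrite ge_min lexx orbT.
  by rewrite ler_pdivlMr ?mulr_gt0 //; lra.
(* The first bound makes [discrepancy] at most [m0], so every ball keeps at least half of its
   optimal mass. The second keeps the dual curve within [sigma] of [pbar], so a point where it
   exceeds [beta] cannot lie outside all balls. *)
pose eps := Num.min (m0 ^+ 2 / C) (sigma ^+ 2 / (k ^+ 2 * C + 1)).
have kC : 0 < k ^+ 2 * C + 1.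
  by rewrite ltr_wpDl // mulr_ge0 ?sqr_ge0 // ltW.
exists eps, (1 - h * (rho / 2)); split.
- by rewrite lt_min !divr_gt0 // exprn_gt0.
- have hr : 0 < h * (rho / 2) by rewrite mulr_gt0 // divr_gt0.
  have : h * (rho / 2) <= 1 * (1 / 2).
    apply: ler_pM => //; [exact: ltW | by rewrite divr_ge0 // ltW |].
    by rewrite ler_pM2r.
  by move=> hr'; apply/andP; split; lra.
move=> e s c t hs eM ee st pk imp; have [dt bt mx] := pk.
have [mC yC sC dC'] := hC s c hs eM; have e0 := excess_ge0 c hs.
set v := direction (dualvar s c) t; set E0 := excess s c in eM ee e0 yC sC dC' *.
set y := synth s c in yC.
have yY : `|y - ybar| <= Ym.
  rewrite -(ger0_norm (normr_ge0 _)) -sqrtr_sqr ler_wsqrtr //.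
  by apply: le_trans yC _; rewrite ler_pM2l.
have ee1 : C * E0 <= m0 ^+ 2.
  by rewrite mulrC -ler_pdivlMr //; apply: le_trans ee _; rewrite ge_min lexx.
have ee2 : (k ^+ 2 * C + 1) * E0 <= sigma ^+ 2.
  by rewrite mulrC -ler_pdivlMr //; apply: le_trans ee _; rewrite ge_min lexx orbT.
case ti : (nearest t) => [i|]; last first.
  exfalso.
  have f := pbar_far dt ti; have g := dual_diff_bound y dt.
  have : enorm (dualvar s c t) <= enorm (dualvar s c t - pbar t) + enorm (pbar t).
    by rewrite -[in leLHS](subrK (pbar t) (dualvar s c t)) enormD.
  move=> tri; have sk : sigma < k * `|y - ybar|.
    by move: g tri; rewrite /dualvar -/y /k; lra.
  have : sigma ^+ 2 < (k * `|y - ybar|) ^+ 2.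
    by rewrite ltr_pXn2r ?nnegrE ?mulr_ge0 // ltW.
  rewrite exprMn; have := ler_wpM2l (sqr_ge0 k) yC.
  by move: ee2; lra.
have dle : discrepancy s c <= m0.
  rewrite -(@ler_pXn2r _ 2) ?nnegrE ?discrepancy_ge0 ?(ltW m0p) //.
  exact: le_trans dC' ee1.
have lumpm : m0 <= lump s i.
  have : `|lump s i - mubar i| <= discrepancy s c.
    rewrite /discrepancy (bigD1 i) //= -addrA lerDl addr_ge0 ?enorm_ge0 //.
    exact: sumr_ge0.
  have := m0m i; have := ler_norm (mubar i - lump s i); rewrite distrC; lra.
have l0 : 0 <= lump s i by apply: le_trans lumpm; exact: ltW.
have lC : lump s i <= mass s.
  rewrite /lump /mass [leLHS]big_mkcond /= big_seq [leRHS]big_seq.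
  by apply: ler_sum => x /hs[/ltW x0 _ _]; case: ifP.
have off := hpk y t i yY pk ti; rewrite -/(dualvar s c) -/v in off.
have off0 := offset_ge0 tbar vbar rad (t, v); have sp0 := spread_ge0 hs.
pose D := lump s i *: G t v
  - \sum_(x <- s | nearest x.2.1 == Some i) x.1 *: G x.2.1 x.2.2.
have DN : `|D| <= C1 * (C * offset (t, v) + spread s).
  (* As the removed and the added mass agree, [D] is a weighted sum of differences of jumps in the
     same ball. *)
  have -> : D = \sum_(x <- s | nearest x.2.1 == Some i)
      x.1 *: (G t v - G x.2.1 x.2.2).
    rewrite /D /lump scaler_suml -sumrB.
    by apply: eq_bigr => x _; rewrite scalerBr.
  apply: le_trans (ler_norm_sum _ _ _) _.
  apply: (@le_trans _ _ (C1 * (mass s * offset (t, v) + spread s))); last first.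
    by rewrite ler_wpM2l // lerD2r ler_wpM2r.
  rewrite /mass mulr_suml /spread -big_split /= mulr_sumr [leLHS]big_mkcond /=.
  rewrite big_seq [leRHS]big_seq; apply: ler_sum => x xs.
  have [x0 dx v1] := hs x xs; have xo := offset_ge0 tbar vbar rad x.2.
  case: ifP => [/eqP xi|_]; last first.
    by apply: mulr_ge0 => //; apply: addr_ge0; apply: mulr_ge0 => //; exact: ltW.
  rewrite normrZ gtr0_norm // -mulrDr mulrCA ler_pM2l //.
  apply: le_trans (normGB _ dt dx v1) _; rewrite ler_wpM2l //.
  rewrite /offset ti xi /=.
  have -> : t - x.2.1 = (t - tbar i) - (x.2.1 - tbar i) by ring.
  have -> : v - x.2.2 = (v - vbar i) - (x.2.2 - vbar i).
    by rewrite opprB addrA subrK.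
  have := ler_normB (t - tbar i) (x.2.1 - tbar i).
  have := enormB (v - vbar i) (x.2.2 - vbar i); lra.
have DQ : `|D| ^+ 2 <= Qc * E0.
  apply: (@le_trans _ _ ((C1 * (C * offset (t, v) + spread s)) ^+ 2)).
    rewrite ler_pXn2r ?nnegrE //; apply: mulr_ge0 => //.
    by apply: addr_ge0 => //; apply: mulr_ge0 => //; exact: ltW.
  have o2 : offset (t, v) ^+ 2 <= Cp' ^+ 2 * (C * E0).
    apply: (@le_trans _ _ ((Cp' * `|y - ybar|) ^+ 2)).
      by rewrite ler_pXn2r ?nnegrE ?mulr_ge0.
    by rewrite exprMn ler_wpM2l ?sqr_ge0.
  have o3 := ler_wpM2l (sqr_ge0 C) o2.
  have : (C * offset (t, v) + spread s) ^+ 2 <=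
      2 * (C ^+ 2 * (Cp' ^+ 2 * (C * E0)) + C * E0).
    by have := sqr_ge0 (C * offset (t, v) - spread s); move: o3 sC; lra.
  move=> /(ler_wpM2l (sqr_ge0 C1)) h'; rewrite exprMn; apply: le_trans h' _.
  by rewrite /Qc le_eqVlt; apply/orP; left; apply/eqP; ring.
have h01 : 0 <= h <= 1 by rewrite h1 ltW.
have := improves_transfer (fun x => nearest x.2.1 == Some i) hs st pk imp h01 l0.
rewrite -/E0 -/v -/D => imp'.
have gp : E0 <= (mass_bar + 1) * (enorm (dualvar s c t) - beta).
  have := gap hs st mx; rewrite -/E0; lra.
have rE : rho * E0 <= lump s i * (enorm (dualvar s c t) - beta).
  apply: (@le_trans _ _ (m0 * (enorm (dualvar s c t) - beta))); last first.
    by rewrite ler_wpM2r // subr_ge0 ltW.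
  rewrite /rho mulrAC ler_pdivrMr // -mulrA ler_pM2l // mulrC; exact: gp.
have hrE := ler_wpM2l (ltW hp) rE.
have hD : h ^+ 2 * (L * `|D| ^+ 2) <= h * (rho / 2) * E0.
  apply: (@le_trans _ _ (h * (h * (L * Qc + 1)) * E0)); last first.
    by rewrite ler_wpM2r // ler_pM2l.
  rewrite expr2 -!mulrA ler_pM2l // ler_pM2l //.
  have := ler_wpM2l (ltW L_gt0) DQ; lra.
by move: imp' hrE hD; lra.
Qed.


(** [sublinear_step] brings the excess below the threshold of [linear_step], monotonicity keeps it
    there, and [linear_step] contracts it from then on. *)
Lemma geometric_convergence (A : nat -> seq (R * atom)) (cs : nat -> 'rV[R]_d)
    (th : nat -> R) :
  (forall k, admissible (A k)) -> (forall k, stationary (A k) (cs k)) ->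
  (forall k, peak (dualvar (A k) (cs k)) (th k)) ->
  (forall k, improves (excess (A k.+1) (cs k.+1)) (A k) (cs k) (th k)) ->
  exists zeta C : R, [/\ 0 < zeta < 1, 0 < C &
    forall k, excess (A k) (cs k) <= C * zeta ^+ k].
Proof.
move=> hA hS hP hI; pose e k := excess (A k) (cs k).
have e0 k : 0 <= e k by exact: excess_ge0.
have dec k : e k.+1 <= e k.
  (* The exchange with [h = 0] leaves the cost unchanged, so the excess is nonincreasing. *)
  have h0 : (0 : R) <= 0 <= (1 : R) by rewrite lexx ler01.
  have := improves_transfer predT (hA k) (hS k) (hP k) (hI k) h0 (lexx 0).
  by rewrite mul0r subr0 expr0n mul0r addr0.
have le_e0 k n : e (k + n)%N <= e k.
  elim: n => [|n IH]; first by rewrite addn0.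
  by rewrite addnS; exact: le_trans (dec _) IH.
pose M := e 0%N; have M0 : 0 <= M by exact: e0.
have eM k : e k <= M by rewrite -[k]add0n le_e0.
have [B B0 hB] := sublinear_step M0.
have [eps [q [eps0 /andP[q0 q1] hq]]] := linear_step M0.
have [K hK] : exists K, e K <= eps.
  apply: contrapT => /forallNP no.
  have big k : eps < e k by rewrite ltNge; apply/negP; exact: no.
  (* As long as the excess exceeds [eps], this step length gains at least [g] per iteration, which
     cannot go on since the excess is nonnegative. *)
  pose h := Num.min 1 (eps / (2 * B)).
  have h0 : 0 < h by rewrite lt_min ltr01 /= divr_gt0 // mulr_gt0.
  have h1 : h <= 1 by rewrite ge_min lexx.
  have hB' : h * B <= eps / 2.
    have : h <= eps / (2 * B) by rewrite ge_min lexx orbT.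
    by rewrite ler_pdivlMr ?mulr_gt0 //; lra.
  pose g := h * (eps / 2); have g0 : 0 < g by rewrite mulr_gt0 // divr_gt0.
  have step k : e k.+1 <= e k - g.
    have h01 : 0 <= h <= 1 by rewrite h1 ltW.
    have := hB _ _ _ _ h (hA k) (eM k) (hS k) (hP k) (hI k) h01.
    have : h * eps <= h * e k by rewrite ler_pM2l // ltW.
    have : h * (h * B) <= h * (eps / 2) by rewrite ler_pM2l.
    rewrite /g -/(e k) -/(e k.+1); lra.
  have lin k : e k <= M - k%:R * g.
    elim: k => [|k IH]; first by rewrite mul0r subr0.
    by apply: le_trans (step k) _; rewrite -natr1 mulrDl mul1r; lra.
  have := lin (Num.truncn (M / g)).+1; have := e0 (Num.truncn (M / g)).+1.
  have : M / g < (Num.truncn (M / g)).+1%:R by exact: Num.Theory.truncnS_gt.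
  rewrite ltr_pdivrMr //; lra.
have lin n : e (K + n)%N <= q ^+ n * M.
  elim: n => [|n IH]; first by rewrite addn0 mul1r.
  rewrite addnS exprS -mulrA.
  apply: le_trans (hq _ _ _ _ (hA _) (eM _) _ (hS _) (hP _) (hI (K + n)%N)) _.
    exact: le_trans (le_e0 K n) hK.
  by rewrite ler_pM2l.
have qK : 0 < q ^+ K by exact: exprn_gt0.
(* Dividing by [q ^+ K] absorbs the first [K] iterates; the added 1 keeps the constant positive. *)
exists q, ((M + 1) / q ^+ K); split.
- by rewrite q0.
- by rewrite divr_gt0 // ltr_wpDl.
move=> k; rewrite -/(e k) mulrAC ler_pdivlMr //.
have [Kk|kK] := leqP K k.
  have := lin (k - K)%N; rewrite subnKC // => h.
  apply: (@le_trans _ _ (q ^+ (k - K) * M * q ^+ K)); first by rewrite ler_pM2r.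
  rewrite mulrAC -exprD subnK // mulrC ler_pM2r ?exprn_gt0 //; lra.
apply: ler_pM => //; first exact: ltW.
  by apply: le_trans (eM k) _; lra.
by apply: ler_wiXn2l; [exact: ltW|exact: ltW|exact: ltnW].
Qed.

End descent.

(** * Smooth functions: the flat exponentials *)

Section smooth_step.
Context {R : realType}.
Implicit Types (f g : R -> R) (P : {poly R}).

(** Differentiability of order [n + 1], by recursion on the derivative, so that closure properties
    follow by induction. *)
Fixpoint Ck n f : Prop :=
  (forall t, derivable f t 1) /\ if n is m.+1 then Ck m (derive1 f) else True.

Definition smooth f : Prop := forall n, Ck n f.

Lemma CkS n f (f' : R -> R) : (forall t : R, is_derive t 1 f (f' t)) -> Ck n f' -> Ck n.+1 f.
Proof.
move=> df h; split=> [t|]; first exact: ex_derive.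
by have -> : derive1 f = f' by apply/funext => t; rewrite derive1E derive_val.
Qed.

Lemma CkW n f : Ck n.+1 f -> Ck n f.
Proof.
by elim: n f => [|n IH] f [df h]; split => //; exact: IH.
Qed.

Lemma Ck_is_derive n f (t : R) : Ck n f -> is_derive t 1 f (derive1 f t).
Proof. by case: n => [|n] [df _]; apply: DeriveDef => //; rewrite derive1E. Qed.

Lemma CkD n f g : Ck n f -> Ck n g -> Ck n (fun t => f t + g t).
Proof.
elim: n f g => [|n IH] f g.
  by move=> [df _] [dg _]; split=> [t|]; [exact: derivableD|].
move=> hf hg; apply: (@CkS _ _ (fun t => derive1 f t + derive1 g t)).
  by move=> t; exact: (is_deriveD (Ck_is_derive t hf) (Ck_is_derive t hg)).
by apply: IH; [case: hf | case: hg].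
Qed.

Lemma CkM n f g : Ck n f -> Ck n g -> Ck n (fun t => f t * g t).
Proof.
elim: n f g => [|n IH] f g.
  by move=> [df _] [dg _]; split=> [t|]; [exact: derivableM|].
move=> hf hg; apply: (@CkS _ _ (fun t => f t * derive1 g t + g t * derive1 f t)).
  by move=> t; exact: (is_deriveM (Ck_is_derive t hf) (Ck_is_derive t hg)).
apply: CkD; apply: IH; by [exact: CkW | case: hf | case: hg].
Qed.

Lemma Ck_comp n f g : Ck n f -> Ck n g -> Ck n (f \o g).
Proof.
elim: n f g => [|n IH] f g.
  move=> hf hg; split=> // t.
  have dg := Ck_is_derive t hg; have df := Ck_is_derive (g t) hf.
  by have := is_derive1_comp df dg => -[].
move=> hf hg; apply: (@CkS _ _ (fun t => (derive1 f \o g) t * derive1 g t)).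
  move=> t; have dg := Ck_is_derive t hg; have df := Ck_is_derive (g t) hf.
  exact: is_derive1_comp.
apply: CkM; last by case: hg.
by apply: IH; [case: hf | exact: CkW].
Qed.

Lemma Ck_cst n (a : R) : Ck n (cst a).
Proof.
elim: n a => [|n IH] a; first by split=> // t; exact: derivable_cst.
by apply: (@CkS _ _ (cst 0)) => // t; exact: is_derive_cst.
Qed.

Lemma Ck_id n : Ck n (@id R).
Proof.
case: n => [|n]; first by split=> // t; exact: derivable_id.
by apply: (@CkS _ _ (cst 1)) (Ck_cst _ _) => t; exact: is_derive_id.
Qed.

Lemma smoothP f : smooth f -> forall n t, derivable (derive1n n f) t 1.
Proof.
move=> sf n; elim: n f sf => [|n IH] f sf t; first by have [] := sf 0%N.
by rewrite derive1Sn; apply: IH => m; have [] := sf m.+1.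
Qed.

Definition flat P (x : R) : R := if 0 < x then P.[x^-1] * expR (- x^-1) else 0.

Lemma horner_le_pow P : exists2 C : R, 0 <= C &
  forall y, 1 <= y -> `|P.[y]| <= C * y ^+ size P.
Proof.
exists (\sum_(i < size P) `|P`_i|) => [|y y1]; first exact: sumr_ge0.
have y0 : 0 <= y by apply: le_trans y1.
rewrite horner_coef; apply: le_trans (ler_norm_sum _ _ _) _.
rewrite mulr_suml; apply: ler_sum => i _.
rewrite normrM normrX (ger0_norm y0) ler_wpM2l //.
by apply: ler_weXn2l => //; exact: ltnW.
Qed.

(** The exponential dominates the power [m = (size P).+2] of [x^-1]; the two spare powers give
    [x ^+ 2], which makes the difference quotient at 0 vanish in the limit. *)
Lemma flat_le P : exists2 C : R, 0 <= C &
  forall x, 0 < x <= 1 -> `|flat P x| <= C * x ^+ 2.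
Proof.
have [C C0 hC] := horner_le_pow P.
pose m := (size P).+2.
exists (C * m`!%:R) => [|x /andP[x0 x1]]; first by rewrite mulr_ge0.
have y1 : 1 <= x^-1 by rewrite invf_ge1.
have y0 : 0 < x^-1 by rewrite invr_gt0.
rewrite /flat x0 normrM (gtr0_norm (expR_gt0 _)) expRN.
have e : (x^-1) ^+ m / m`!%:R <= expR x^-1.
  by apply: le_trans (expR_ge1Dxn (size P).+1 (ltW y0)); rewrite lerDr.
have p0 : 0 < (x^-1) ^+ m / m`!%:R by rewrite divr_gt0 ?exprn_gt0 // ltr0n fact_gt0.
have e' : (expR x^-1)^-1 <= ((x^-1) ^+ m / m`!%:R)^-1.
  by rewrite lef_pV2 ?posrE ?expR_gt0.
apply: (@le_trans _ _ (C * x^-1 ^+ size P * ((x^-1) ^+ m / m`!%:R)^-1)).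
  by apply: ler_pM; rewrite ?invr_ge0 ?expR_ge0 ?hC.
rewrite invf_div -exprVn invrK /m !exprS exprVn le_eqVlt; apply/orP; left; apply/eqP.
by field; rewrite expf_neq0 // gt_eqF.
Qed.

Lemma is_derive_flat P (t : R) : is_derive t 1 (flat P) (flat ('X^2 * (P - P^`())) t).
Proof.
have [t0|t0|t0] := ltgtP t 0.
- have -> : flat ('X^2 * (P - P^`())) t = 0 by rewrite /flat ltNge (ltW t0).
  apply: (@near_eq_is_derive _ _ _ (cst 0 : R -> R)).
  near=> x; rewrite /flat ltNge ltW //=.
  by near: x; exact: lt_nbhsl.
- have tn : t != 0 by rewrite gt_eqF.
  have dV : is_derive t 1 (fun x : R => x^-1) (- t^-2).
    by have := @is_deriveV _ id t 1 1 tn (is_derive_id _ _); rewrite scaler1.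
  have d1 : is_derive t 1 (horner P \o (fun x : R => x^-1)) (P^`().[t^-1] * - t^-2).
    exact: is_derive1_comp.
  have d2 : is_derive t 1 (expR \o (fun x : R => - x^-1)) (expR (- t^-1) * - - t^-2).
    by apply: is_derive1_comp; exact: (is_deriveN dV).
  have D := is_deriveM d1 d2.
  apply: (near_eq_is_derive (f := (horner P \o (fun x : R => x^-1)) *
      (expR \o (fun x : R => - x^-1)))).
    near=> x; rewrite /flat; have -> : 0 < x by near: x; exact: lt_nbhsr.
    by [].
  apply: (is_derive_eq D); rewrite /flat t0 /= /GRing.scale /= hornerM hornerXn hornerD hornerN.
  by rewrite exprVn; ring.
- subst t; rewrite {2}/flat ltxx.
  have [C C0 hC] := flat_le P.
  have cv : h^-1 *: (flat P (h *: 1 + 0) - flat P 0) @[h --> 0^'] --> (0 : R).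
    apply/cvgrPdist_le => e e0.
    near=> h; rewrite sub0r normrN {2}/flat ltxx subr0 addr0 /GRing.scale /= mulr1.
    have h0 : h != 0 by near: h; exact: nbhs_dnbhs_neq.
    have h1 : `|h| <= Num.min 1 (e / (C + 1)).
      near: h; apply: dnbhs0_le; rewrite lt_min ltr01 /= divr_gt0 //.
      by rewrite ltr_wpDl.
    have [hp|hn] := ltP 0 h; last first.
      by rewrite /flat ltNge hn /= mulr0 normr0 ltW.
    move: h1; rewrite gtr0_norm // le_min => /andP[h1 h2].
    rewrite normrM normfV (gtr0_norm hp) ler_pdivrMl //.
    apply: le_trans (hC h _) _; first by rewrite hp.
    rewrite expr2 mulrCA ler_pM2l //.
    apply: (@le_trans _ _ ((C + 1) * h)); first by rewrite ler_pM2r // lerDl.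
    by rewrite mulrC -ler_pdivlMr // ltr_wpDl.
  apply: DeriveDef; first by apply/cvg_ex; exists 0.
  exact/cvg_lim.
Unshelve. all: by end_near. Qed.

Lemma smooth_flat P : smooth (flat P).
Proof.
move=> n; elim: n P => [|n IH] P.
  by split=> // t; have [] := is_derive_flat P t.
exact: CkS (is_derive_flat P) (IH _).
Qed.

End smooth_step.

(** * Bounded measurable functions and their integrals against charges *)

Section bounded_measurable.
Context {d} {X : measurableType d} {R : realType}.
Implicit Types (f g : X -> R) (D : set X).

Definition bounded_measurable D f : Prop :=
  measurable_fun D f /\ exists M, forall x, D x -> `|f x| <= M.

Lemma bounded_measurable_integrable (m : {measure set X -> \bar R}) D f :
  measurable D -> (m D < +oo)%E -> bounded_measurable D f ->
  m.-integrable D (EFin \o f).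
Proof.
move=> mD fD [mf [M hM]]; apply: measurable_bounded_integrable => //.
exists M; split; first exact: num_real.
by move=> M' MM' x Dx /=; apply: le_trans (hM x Dx) _; exact: ltW.
Qed.

Lemma bounded_measurable_cst D (a : R) : bounded_measurable D (cst a).
Proof. by split; [exact: measurable_cst | exists `|a|]. Qed.

Lemma bounded_measurableD D f g : bounded_measurable D f ->
  bounded_measurable D g -> bounded_measurable D (fun x => f x + g x).
Proof.
move=> [mf [M hM]] [mg [N hN]]; split; first exact: measurable_funD.
by exists (M + N) => x Dx; rewrite (le_trans (ler_normD _ _)) // lerD ?hM ?hN.
Qed.

Lemma bounded_measurableM D f g : bounded_measurable D f ->
  bounded_measurable D g -> bounded_measurable D (fun x => f x * g x).
Proof.
move=> [mf [M hM]] [mg [N hN]]; split; first exact: measurable_funM.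
by exists (M * N) => x Dx; rewrite normrM ler_pM ?hM ?hN.
Qed.

Lemma bounded_measurable_sum I (r : seq I) D (f : I -> X -> R) :
  (forall i, bounded_measurable D (f i)) ->
  bounded_measurable D (fun x => \sum_(i <- r) f i x).
Proof.
move=> hf; elim: r => [|i r IH].
  have -> : (fun x => \sum_(i <- [::]) f i x) = cst 0 :> (X -> R).
    by apply/funext => x; rewrite big_nil.
  exact: bounded_measurable_cst.
have -> : (fun x => \sum_(j <- i :: r) f j x) =
    (fun x => f i x + \sum_(j <- r) f j x).
  by apply/funext => x; rewrite big_cons.
exact: bounded_measurableD.
Qed.

End bounded_measurable.

Section charges.
Context {R : realType}.
Local Notation RT := (measurableTypeR R).
Implicit Types (nu : {charge set RT -> \bar R}) (f : R -> R) (D : set RT).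

Lemma jordan_finite nu (A : set RT) : measurable A ->
  (jordan_pos (hahnP nu) A < +oo)%E /\ (jordan_neg (hahnP nu) A < +oo)%E.
Proof.
move=> mA; split; rewrite ltey_eq.
  have := @fin_num_measure _ _ _ (jordan_pos (hahnP nu)) A mA.
  by move=> ->.
have := @fin_num_measure _ _ _ (jordan_neg (hahnP nu)) A mA.
by move=> ->.
Qed.

Lemma charge_jordan nu (A : set RT) : measurable A ->
  nu A = (jordan_pos (hahnP nu) A - jordan_neg (hahnP nu) A)%E.
Proof.
move=> mA; rewrite (jordan_decomp (hahnP nu) mA) /cadd /=; congr (_ + _)%E.
by rewrite /cscale EFinN mulN1e.
Qed.

(** An equality of differences of measures is rewritten as an equality of sums, so that only
    positive measures are integrated against. *)
Lemma integral_measure_balance (a1 a2 b1 b2 : {measure set RT -> \bar R}) D f :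
  measurable D -> bounded_measurable D f ->
  (forall A : set RT, measurable A -> [/\ (a1 A < +oo)%E, (a2 A < +oo)%E,
     (b1 A < +oo)%E & (b2 A < +oo)%E]) ->
  (forall A : set RT, measurable A -> A `<=` D ->
     (a1 A + b2 A = b1 A + a2 A)%E) ->
  \int[a1]_(x in D) f x - \int[a2]_(x in D) f x =
  \int[b1]_(x in D) f x - \int[b2]_(x in D) f x.
Proof.
move=> mD bf fin bal; have [fa1 fa2 fb1 fb2] := fin D mD.
have [mf _] := bf.
have ia1 := bounded_measurable_integrable mD fa1 bf.
have ia2 := bounded_measurable_integrable mD fa2 bf.
have ib1 := bounded_measurable_integrable mD fb1 bf.
have ib2 := bounded_measurable_integrable mD fb2 bf.
have mEf : measurable_fun D (EFin \o f) by exact/measurable_EFinP.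
have := @eq_measure_integral _ RT R D (measure_add b1 a2) (measure_add a1 b2) (EFin \o f).
have H A : measurable A -> A `<=` D -> measure_add a1 b2 A = measure_add b1 a2 A.
  by move=> mA AD; rewrite !measure_addE; exact: bal.
move=> /(_ H); rewrite !integral_measure_add //.
have fin_int (m : {measure set RT -> \bar R}) : m.-integrable D (EFin \o f) ->
    (\int[m]_(x in D) (f x)%:E)%E = (\int[m]_(x in D) f x)%:E.
  by move=> im; rewrite /Rintegral fineK // integrable_fin_num.
rewrite !fin_int // -!EFinD => -[]; lra.
Qed.

Lemma jordan_fin_num nu (A : set RT) : measurable A ->
  (jordan_pos (hahnP nu) A \is a fin_num) * (jordan_neg (hahnP nu) A \is a fin_num).
Proof.
move=> mA; have := @fin_num_measure _ _ _ (jordan_pos (hahnP nu)) A mA.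
by have := @fin_num_measure _ _ _ (jordan_neg (hahnP nu)) A mA.
Qed.

Lemma sube_eq_balance (x y z w : \bar R) : x \is a fin_num -> y \is a fin_num ->
  z \is a fin_num -> w \is a fin_num ->
  (x - y = z - w -> x + w = z + y)%E.
Proof.
case: x => // x; case: y => // y; case: z => // z; case: w => // w _ _ _ _.
by rewrite -!EFinB -!EFinD => -[h]; congr (_%:E); lra.
Qed.

Lemma balance_sube_eq (x y z w : \bar R) : x \is a fin_num -> y \is a fin_num ->
  z \is a fin_num -> w \is a fin_num ->
  (x + w = z + y -> x - y = z - w)%E.
Proof.
case: x => // x; case: y => // y; case: z => // z; case: w => // w _ _ _ _.
by rewrite -!EFinD => -[h]; congr (_%:E); lra.
Qed.

Lemma subeACA (x y z w : \bar R) : x \is a fin_num -> y \is a fin_num ->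
  z \is a fin_num -> w \is a fin_num ->
  ((x - y) + (z - w) = (x + z) - (y + w))%E.
Proof.
case: x => // x; case: y => // y; case: z => // z; case: w => // w _ _ _ _.
by rewrite -!EFinB -!EFinD; congr (_%:E); ring.
Qed.

Lemma eq_charge_integral nu nu' D f : measurable D -> bounded_measurable D f ->
  (forall A : set RT, measurable A -> A `<=` D -> nu A = nu' A) ->
  charge_integral nu D f = charge_integral nu' D f.
Proof.
move=> mD bf e; apply: integral_measure_balance => //.
  by move=> A mA; have [] := jordan_finite nu mA; have [] := jordan_finite nu' mA.
move=> A mA AD; apply: sube_eq_balance; rewrite ?jordan_fin_num //.
rewrite -(charge_jordan nu mA) -(charge_jordan nu' mA); exact: e.
Qed.

Lemma charge_integral_add nu nu' D f : measurable D -> bounded_measurable D f ->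
  charge_integral (cadd nu nu') D f = charge_integral nu D f + charge_integral nu' D f.
Proof.
move=> mD bf; rewrite {2 3}/charge_integral.
set p := jordan_pos (hahnP nu); set n := jordan_neg (hahnP nu).
set p' := jordan_pos (hahnP nu'); set n' := jordan_neg (hahnP nu').
have [mf _] := bf; have mEf : measurable_fun D (EFin \o f) by exact/measurable_EFinP.
have int_add (m m' : {finite_measure set RT -> \bar R}) :
    \int[measure_add m m']_(x in D) f x =
    \int[m]_(x in D) f x + \int[m']_(x in D) f x.
  have fm : (m D < +oo)%E by rewrite ltey_eq fin_num_measure.
  have fm' : (m' D < +oo)%E by rewrite ltey_eq fin_num_measure.
  have im := bounded_measurable_integrable mD fm bf.
  have im' := bounded_measurable_integrable mD fm' bf.
  rewrite /Rintegral integral_measure_add // fineD //; exact: integrable_fin_num.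
have -> : \int[p]_(t in D) f t - \int[n]_(t in D) f t +
    (\int[p']_(t in D) f t - \int[n']_(t in D) f t) =
    \int[measure_add p p']_(t in D) f t - \int[measure_add n n']_(t in D) f t.
  by rewrite !int_add; ring.
apply: integral_measure_balance => //.
  move=> A mA; have [? ?] := jordan_finite (cadd nu nu') mA.
  have [? ?] := jordan_finite nu mA; have [? ?] := jordan_finite nu' mA.
  have h1 : (measure_add p p' A < +oo)%E by rewrite measure_addE lte_add_pinfty.
  have h2 : (measure_add n n' A < +oo)%E by rewrite measure_addE lte_add_pinfty.
  by split.
move=> A mA AD.
suff : (jordan_pos (hahnP (cadd nu nu')) A + measure_add n n' A =
        measure_add p p' A + jordan_neg (hahnP (cadd nu nu')) A)%E by [].
rewrite !measure_addE.
have [fp fn] := jordan_fin_num nu mA; have [fp' fn'] := jordan_fin_num nu' mA.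
apply: sube_eq_balance; rewrite ?jordan_fin_num ?fin_numD ?fp ?fn ?fp' ?fn' //.
transitivity (nu A + nu' A)%E; first exact: esym (charge_jordan (cadd nu nu') mA).
transitivity ((p A - n A) + (p' A - n' A))%E.
  by congr (_ + _)%E; exact: charge_jordan.
exact: subeACA.
Qed.

Lemma integral_concentrated (m : {finite_measure set RT -> \bar R}) D f (t : R) :
  measurable D -> bounded_measurable D f ->
  (forall A : set RT, measurable A -> ~ A t -> m A = 0%E) ->
  \int[m]_(x in D) f x = f t * fine (m D).
Proof.
move=> mD bf conc; rewrite -Rintegral_cst //; congr fine.
have [mf _] := bf.
apply: ae_eq_integral => //; first exact/measurable_EFinP.
exists (~` [set t]); split.
- exact: measurableC.
- by apply: conc; [exact: measurableC | apply].
- by move=> x /= h xt; apply: h => _; rewrite xt.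
Qed.

(** Both Jordan parts vanish on sets that miss [t], so both integrals are values at [t] times
    masses, whatever the sign of [a]. *)
Lemma charge_integral_cscale_dirac (a t : R) D f :
  measurable D -> bounded_measurable D f ->
  charge_integral (cscale a (dirac_charge t)) D f = a * (f t * \1_D t).
Proof.
move=> mD bf; set nu := cscale _ _.
have nuE A : measurable A -> nu A = (a * \1_A t)%:E.
  by move=> mA; rewrite /nu /cscale /dirac_charge /charge_of_finite_measure /= diracE indicE.
have conc A : measurable A -> ~ A t ->
    jordan_pos (hahnP nu) A = 0%E /\ jordan_neg (hahnP nu) A = 0%E.
  move=> mA At; have [[mP _] [mN _] _ _] := hahnP nu.
  have z B : measurable B -> nu (A `&` B) = 0%E.
    move=> mB; rewrite nuE; last exact: measurableI.
    by rewrite indicE memNset ?mulr0 // => -[].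
  split.
    by rewrite jordan_posE cjordan_posE /crestr0 mem_set //; exact: z.
  rewrite jordan_negE cjordan_negE /crestr0 mem_set // -[RHS]oppe0.
  by congr (- _)%E; exact: z.
rewrite /charge_integral.
rewrite (@integral_concentrated (jordan_pos (hahnP nu)) D f t mD bf); last first.
  by move=> A mA At; have [] := conc A mA At.
rewrite (@integral_concentrated (jordan_neg (hahnP nu)) D f t mD bf); last first.
  by move=> A mA At; have [] := conc A mA At.
rewrite -mulrBr -fineB; [|by rewrite jordan_fin_num..].
have <- : nu D = (jordan_pos (hahnP nu) D - jordan_neg (hahnP nu) D)%E.
  exact: charge_jordan.
by rewrite nuE //= mulrCA.
Qed.

Lemma charge_integral_czero D f : measurable D -> bounded_measurable D f ->
  charge_integral czero D f = 0.
Proof.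
move=> mD bf; have := charge_integral_add czero czero mD bf.
have -> : charge_integral (cadd czero czero) D f = charge_integral czero D f.
  by apply: eq_charge_integral => // A _ _; exact: adde0.
lra.
Qed.

Lemma charge_integral_atomic {d : nat} (s : seq (R * (R * 'rV[R]_d))) (i : 'I_d) D f :
  measurable D -> bounded_measurable D f ->
  charge_integral (atomic s i) D f =
  \sum_(x <- s) x.1 * x.2.2 0 i * (f x.2.1 * \1_D x.2.1).
Proof.
move=> mD bf; elim: s => [|x s IH].
  by rewrite big_nil; exact: charge_integral_czero.
rewrite big_cons -IH /= charge_integral_add //; congr (_ + _).
exact: charge_integral_cscale_dirac.
Qed.

End charges.

(** * A smooth transition from 0 to 1 *)

Section rise.
Context {R : realType}.
Implicit Types (f : R -> R) (x a b : R).

Lemma smoothM (f g : R -> R) : smooth f -> smooth g -> smooth (fun x => f x * g x).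
Proof. by move=> hf hg n; exact: CkM. Qed.

Lemma smoothD (f g : R -> R) : smooth f -> smooth g -> smooth (fun x => f x + g x).
Proof. by move=> hf hg n; exact: CkD. Qed.

Lemma smooth_affine f a b : smooth f -> smooth (fun x => f (a * x + b)).
Proof.
move=> hf n; apply: (@Ck_comp _ n f (fun x => a * x + b)) => //.
by apply: CkD; [apply: CkM; [exact: Ck_cst | exact: Ck_id] | exact: Ck_cst].
Qed.

Let g : R -> R := flat 1.

Lemma flat1E x : g x = if 0 < x then expR (- x^-1) else 0.
Proof. by rewrite /g /flat hornerC mul1r. Qed.

Lemma flat1_ge0 x : 0 <= g x.
Proof. by rewrite flat1E; case: ifP => // _; exact: expR_ge0. Qed.

Lemma flat1_gt0 x : 0 < x -> 0 < g x.
Proof. by move=> x0; rewrite flat1E x0 expR_gt0. Qed.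

Lemma flat1_le0 x : x <= 0 -> g x = 0.
Proof. by rewrite flat1E ltNge => ->. Qed.

Lemma flat1_nondecreasing x y : x <= y -> g x <= g y.
Proof.
move=> xy; have [x0|x0] := leP x 0; first by rewrite (flat1_le0 x0) flat1_ge0.
have y0 : 0 < y by exact: lt_le_trans xy.
by rewrite !flat1E x0 y0 ler_expR lerN2 lef_pV2.
Qed.

(** Constant and positive on the negative axis and zero from 1 on. Being a composition of [g] with
    itself, it is smooth without any quotient of functions. *)
Let fall x : R := g (g 1 - g x).

Lemma fall0_gt0 : 0 < fall 0.
Proof. by rewrite /fall (flat1_le0 (lexx 0)) subr0 !flat1_gt0. Qed.

Definition rise x : R := 1 - fall x / fall 0.

Lemma rise_le0 x : x <= 0 -> rise x = 0.
Proof.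
move=> x0; have e : fall x = fall 0.
  by rewrite /fall (flat1_le0 x0) (flat1_le0 (lexx 0)).
by rewrite /rise e divff ?subrr // (gt_eqF fall0_gt0).
Qed.

Lemma rise_ge1 x : 1 <= x -> rise x = 1.
Proof.
move=> x1; rewrite /rise (_ : fall x = 0) ?mul0r ?subr0 //.
by rewrite /fall flat1_le0 // subr_le0 flat1_nondecreasing.
Qed.

Lemma rise_itv x : 0 <= rise x <= 1.
Proof.
have f0 := fall0_gt0; rewrite /rise; apply/andP; split.
  rewrite subr_ge0 ler_pdivrMr // mul1r; apply: flat1_nondecreasing.
  by rewrite lerD2l lerN2 (flat1_le0 (lexx 0)) flat1_ge0.
by rewrite lerBlDr lerDl divr_ge0 ?flat1_ge0 // ltW.
Qed.

Lemma smooth_rise : smooth rise.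
Proof.
have sg : smooth g by exact: smooth_flat.
move=> n.
have -> : rise = fun x => (- (fall 0)^-1) * fall x + 1.
  by apply/funext => x; rewrite /rise; ring.
apply: CkD; last exact: Ck_cst.
apply: CkM; first exact: Ck_cst.
apply: (@Ck_comp _ n g (fun x => g 1 - g x)); first exact: sg.
have -> : (fun x => g 1 - g x) = (fun x => g 1 + (-1) * g x).
  by apply/funext => x; ring.
by apply: CkD; [exact: Ck_cst | apply: CkM; [exact: Ck_cst | exact: sg]].
Qed.

Lemma smooth_derivable f x : smooth f -> derivable f x 1.
Proof. by move=> /(_ 0%N)[]. Qed.

Lemma smooth_derive f : smooth f -> smooth (derive1 f).
Proof. by move=> sf n; have [] := sf n.+1. Qed.

Lemma smooth_continuous f : smooth f -> continuous f.
Proof.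
move=> sf x; apply: differentiable_continuous.
by apply/derivable1_diffP; exact: smooth_derivable.
Qed.

Lemma derive1_rise_out x : x < 0 \/ 1 < x -> derive1 rise x = 0.
Proof.
have loc (a : R) : (\near x, rise x = a) -> derive1 rise x = 0.
  move=> h; rewrite derive1E (@near_eq_derive _ _ _ _ (cst a)) ?derive_cst //.
by case=> hx; [apply: (loc 0) | apply: (loc 1)]; near=> z;
  [apply: rise_le0 | apply: rise_ge1]; apply: ltW; near: z;
  [exact: lt_nbhsl | exact: lt_nbhsr].
Unshelve. all: by end_near. Qed.

Lemma derive1_rise_bound : exists2 B : R, 0 < B & forall x, `|derive1 rise x| <= B.
Proof.
have c : {within `[0, 1], continuous (fun x => `|derive1 rise x|)}.
  apply: continuous_subspaceT => x; apply: continuous_comp; last exact: norm_continuous.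
  by apply: smooth_continuous; apply: smooth_derive; exact: smooth_rise.
have [z _ hz] := EVT_max ler01 c.
exists (`|derive1 rise z| + 1); first by rewrite ltr_wpDl.
move=> x; have [x0|x0] := ltP x 0.
  by rewrite derive1_rise_out ?normr0 ?addr_ge0 //; left.
have [x1|x1] := ltP 1 x.
  by rewrite derive1_rise_out ?normr0 ?addr_ge0 //; right.
by apply: (le_trans (hz x _)); [rewrite in_itv /= x0 | rewrite lerDl].
Qed.

Lemma smooth_test_function (T a b : R) (psi : R -> R) : 0 < a -> b < T ->
  smooth psi -> (forall t, ~~ (a <= t <= b) -> psi t = 0) -> test_function T psi.
Proof.
move=> a0 bT sp out; split; first exact: smoothP.
by exists a, b; split=> // t; rewrite in_itv /=; exact: out.
Qed.

Lemma smooth_bounded_measurable f (D : set R) : smooth f ->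
  (exists M, forall x, `|f x| <= M) ->
  @bounded_measurable _ (measurableTypeR R) R D f.
Proof.
move=> sf [M hM]; split; last by exists M => x _.
apply: measurable_funTS; apply: continuous_measurable_fun.
exact: smooth_continuous.
Qed.

End rise.

(** * A charge on the interval is determined by test functions *)

Section charge_uniqueness.
Context {R : realType} (T : R).
Local Notation RT := (measurableTypeR R).
Local Notation dom := (dom T).
Implicit Types (q : {charge set RT -> \bar R}) (a t : R).

Lemma measurable_dom : @measurable _ RT dom.
Proof. exact: measurable_itv. Qed.

(** Vanishes up to [a + 1/(n+1)] and from [T - 1/(n+1)] on, and is 1 at distance at least [2/(n+1)]
    inside []a, T[]. The shift by 1 keeps the support compact in the interval even for [a = 0]. *)
Definition plateau a (n : nat) t : R :=
  rise (n.+1%:R * t + (- n.+1%:R * a - 1)) * rise (- n.+1%:R * t + (n.+1%:R * T - 1)).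

Lemma smooth_plateau a n : smooth (plateau a n).
Proof. by apply: smoothM; apply: smooth_affine; exact: smooth_rise. Qed.

Lemma plateau_itv a n t : 0 <= plateau a n t <= 1.
Proof.
have /andP[h1 h2] := rise_itv (n.+1%:R * t + (- n.+1%:R * a - 1)).
have /andP[h3 h4] := rise_itv (- n.+1%:R * t + (n.+1%:R * T - 1)).
by rewrite /plateau (mulr_ge0 h1 h3) (mulr_ile1 h1 h3 h2 h4).
Qed.

Lemma plateau_out a n t :
  ~~ (a + n.+1%:R^-1 <= t <= T - n.+1%:R^-1) -> plateau a n t = 0.
Proof.
have n0 : 0 < n.+1%:R :> R by rewrite ltr0n.
have nV : n.+1%:R * n.+1%:R^-1 = 1 :> R by rewrite divff // gt_eqF.
rewrite negb_and -!ltNge => /orP[h|h]; rewrite /plateau.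
  rewrite rise_le0 ?mul0r //.
  by have := ltW h; rewrite -(ler_pM2l n0) mulrDr nV; lra.
rewrite [X in _ * X]rise_le0 ?mulr0 //.
by have := ltW h; rewrite -(ler_pM2l n0) mulrBr nV; lra.
Qed.

Lemma test_plateau a n : 0 <= a -> test_function T (plateau a n).
Proof.
move=> a0; have n0 : 0 < n.+1%:R^-1 :> R by rewrite invr_gt0 ltr0n.
apply: (@smooth_test_function _ T (a + n.+1%:R^-1) (T - n.+1%:R^-1)).
- by rewrite ltr_wpDl.
- by rewrite ltrBlDr ltrDl.
- exact: smooth_plateau.
- by move=> t; exact: plateau_out.
Qed.

Lemma cvg_plateau a t : dom t ->
  plateau a n t @[n --> \oo] --> (\1_(`]a, T[) t : R).
Proof.
rewrite /Defs.dom /= in_itv /= => /andP[t0 tT].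
have [ta|at_] := leP t a.
  rewrite indicE memNset; last by rewrite /= in_itv /= ltNge ta.
  rewrite (_ : (fun n => plateau a n t) = cst 0); first exact: cvg_cst.
  apply/funext => n; apply: plateau_out; rewrite negb_and -ltNge; apply/orP; left.
  by apply: le_lt_trans ta _; rewrite ltrDl invr_gt0 ltr0n.
rewrite indicE mem_set; last by rewrite /= in_itv /= at_.
pose r := Num.min (t - a) (T - t).
have r0 : 0 < r by rewrite lt_min !subr_gt0 at_.
apply: cvg_near_cst; near=> n.
have nr : 2 <= n.+1%:R * r.
  rewrite mulrC -ler_pdivrMl // mulrC.
  near: n; exists (Num.truncn (2 / r)).+1 => // n /= hn.
  have := Num.Theory.truncnS_gt (2 / r) => /ltW /le_trans; apply.
  by rewrite ler_nat ltnW.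
have r1 : r <= t - a by rewrite ge_min lexx.
have r2 : r <= T - t by rewrite ge_min lexx orbT.
have n0 : 0 <= n.+1%:R :> R by rewrite ler0n.
have h1 := ler_wpM2l n0 r1; have h2 := ler_wpM2l n0 r2.
rewrite /plateau !rise_ge1 ?mulr1 //; lra.
Unshelve. all: by end_near. Qed.

Lemma integral_plateau_cvg (m : {measure set RT -> \bar R}) a : 0 <= a ->
  (m dom < +oo)%E ->
  \int[m]_(t in dom) plateau a n t @[n --> \oo] --> fine (m `]a, T[%classic).
Proof.
move=> a0 fin; have mdom := measurable_dom.
have mS : @measurable _ RT `]a, T[%classic by exact: measurable_itv.
have bp n : @bounded_measurable _ RT R dom (plateau a n).
  apply: smooth_bounded_measurable; first exact: smooth_plateau.
  by exists 1 => x; have /andP[h1 h2] := plateau_itv a n x; rewrite ger0_norm.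
have sub : `]a, T[ `<=` dom.
  by apply: subset_itv; rewrite bnd_simp.
have b1 : @bounded_measurable _ RT R dom (cst 1) by exact: bounded_measurable_cst.
have [] := @dominated_convergence _ RT R m dom mdom
  (fun n => EFin \o plateau a n) (EFin \o \1_(`]a, T[)) (EFin \o cst 1).
- by move=> n; apply/measurable_EFinP; have [] := bp n.
- by apply/measurable_EFinP; exact: measurable_indic.
- apply: aeW => x dx; apply: cvg_EFin; first by apply: nearW.
  exact: cvg_plateau.
- exact: bounded_measurable_integrable.
- apply: aeW => x n dx /=; rewrite lee_fin.
  by have /andP[h1 h2] := plateau_itv a n x; rewrite ger0_norm.
move=> _ _ h.
have e : (\int[m]_(x in dom) (EFin \o \1_(`]a, T[)) x)%E = m `]a, T[%classic.
  by rewrite integral_indic // setIidl.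
rewrite e in h; apply: fine_cvg; rewrite fineK //.
rewrite ge0_fin_numE ?measure_ge0 //; apply: le_lt_trans fin.
by apply: le_measure => //; rewrite inE.
Qed.

Lemma charge_integral_plateau_cvg q a : 0 <= a ->
  charge_integral q dom (plateau a n) @[n --> \oo] --> fine (q `]a, T[%classic).
Proof.
move=> a0; have [h1 h2] := jordan_finite q measurable_dom.
have mS : @measurable _ RT `]a, T[%classic by exact: measurable_itv.
have [f1 f2] := jordan_fin_num q mS.
rewrite (charge_jordan q mS) fineB //.
by apply: cvgB; exact: integral_plateau_cvg.
Qed.

(** Plateaus converge boundedly to the indicator of []a, T[], so the charges agree on these
    intervals. Uniqueness of measures on the generating open rays is applied to [m1] and [m2], where
    the negative parts have changed sides to make both measures positive. *)
Lemma charge_determined q q' :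
  (forall psi, test_function T psi ->
    charge_integral q dom psi = charge_integral q' dom psi) ->
  forall f, @bounded_measurable _ RT R dom f ->
    charge_integral q dom f = charge_integral q' dom f.
Proof.
move=> H f bf; have mdom := measurable_dom.
have fq (nu : {charge set RT -> \bar R}) A : measurable A -> nu A \is a fin_num.
  by move=> mA; rewrite (charge_jordan nu mA) fin_numB !jordan_fin_num.
have mS a : @measurable _ RT `]a, T[%classic by exact: measurable_itv.
have eS a : 0 <= a -> q `]a, T[%classic = q' `]a, T[%classic.
  move=> a0; rewrite -(fineK (fq q _ (mS a))) -(fineK (fq q' _ (mS a))).
  congr (_%:E); have := @charge_integral_plateau_cvg q a a0.
  have := @charge_integral_plateau_cvg q' a a0.
  rewrite (_ : (fun n => charge_integral q' dom (plateau a n)) =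
    (fun n => charge_integral q dom (plateau a n))).
    by move=> c1 c2; apply: cvg_unique c2 c1.
  by apply/funext => n; rewrite H //; exact: test_plateau.
pose m1 := mrestr (measure_add (jordan_pos (hahnP q)) (jordan_neg (hahnP q'))) mdom.
pose m2 := mrestr (measure_add (jordan_pos (hahnP q')) (jordan_neg (hahnP q))) mdom.
apply: eq_charge_integral => // A mA AD.
have balance B : measurable B -> q B = q' B <->
    measure_add (jordan_pos (hahnP q)) (jordan_neg (hahnP q')) B =
    measure_add (jordan_pos (hahnP q')) (jordan_neg (hahnP q)) B.
  move=> mB; rewrite !measure_addE (charge_jordan q mB) (charge_jordan q' mB).
  have [f1 f2] := jordan_fin_num q mB; have [f3 f4] := jordan_fin_num q' mB.
  split; first exact: sube_eq_balance.
  exact: balance_sube_eq.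
apply/(balance A mA).
have -> : A = A `&` dom by rewrite setIidl.
suff : m1 A = m2 A by [].
pose G := @RGenOInfty.G R; pose g (n : nat) : set R := `](- n%:R : R), +oo[%classic.
have mG : @measurable _ RT = <<s G >> by exact: RGenOInfty.measurableE.
have GI : setI_closed G.
  move=> _ _ [x ->] [y ->]; exists (Num.max x y).
  by apply/seteqP; split => z /=; rewrite !in_itv /= !andbT gt_max => /andP.
have Gg n : G (g n) by exists (- n%:R).
have gT : \bigcup_k g k = setT.
  apply/seteqP; split => // x _; exists (Num.truncn `|x|).+1 => //=.
  rewrite /g /= in_itv /= andbT ltrNl.
  apply: le_lt_trans (ler_norm _) _; rewrite normrN.
  exact: Num.Theory.truncnS_gt.
have m12 B : G B -> m1 B = m2 B.
  move=> [x ->]; have mB : @measurable _ RT (`]x, +oo[%classic : set R) by exact: measurable_itv.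
  have : q (`]x, +oo[%classic `&` dom) = q' (`]x, +oo[%classic `&` dom).
    have [xT|Tx] := ltP x T.
      have -> : `]x, +oo[%classic `&` dom = `](Num.max x 0), T[%classic.
        apply/seteqP; split => z /=; rewrite /Defs.dom /= !in_itv /= andbT gt_max.
          by move=> [-> /andP[-> ->]].
        by move=> /andP[/andP[-> ->] ->].
      by apply: eS; rewrite le_max lexx orbT.
    have -> : `]x, +oo[%classic `&` dom = set0.
      apply/seteqP; split => z //=; rewrite /Defs.dom /= !in_itv /= andbT.
      by move=> [xz /andP[_ zT]]; have := lt_le_trans (lt_trans xz zT) Tx; rewrite ltxx.
    by rewrite !charge0.
  by move=> /(balance _ (measurableI _ _ mB mdom)).
have fin k : (m1 (g k) < +oo)%E.
  have mB : @measurable _ RT (g k `&` dom).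
    by apply: measurableI => //; exact: measurable_itv.
  have [f1 f2] := jordan_finite q mB; have [f3 f4] := jordan_finite q' mB.
  have : (measure_add (jordan_pos (hahnP q)) (jordan_neg (hahnP q')) (g k `&` dom) < +oo)%E.
    by rewrite measure_addE lte_add_pinfty.
  by [].
exact: (@measure_unique _ R RT G g mG GI Gg gT m1 m2 m12 fin A mA).
Qed.

End charge_uniqueness.

Lemma Rintegral_sum_bounded {d} {X : measurableType d} {R : realType}
    (m : {measure set X -> \bar R}) (D : set X) I (r : seq I) (f : I -> X -> R) :
  measurable D -> (m D < +oo)%E -> (forall i, bounded_measurable D (f i)) ->
  \int[m]_(x in D) (\sum_(i <- r) f i x) = \sum_(i <- r) \int[m]_(x in D) f i x.
Proof.
move=> mD fD bf; elim: r => [|i r IH].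
  rewrite big_nil; under eq_Rintegral do rewrite big_nil.
  by rewrite Rintegral_cst // mul0r.
rewrite big_cons -IH; under eq_Rintegral do rewrite big_cons.
rewrite RintegralD //; apply: bounded_measurable_integrable => //.
exact: bounded_measurable_sum.
Qed.

(** * Integrals of test functions over the interval *)

Section test_integrals.
Context {R : realType} (T : R).
Hypothesis T_gt0 : 0 < T.
Local Notation RT := (measurableTypeR R).
Local Notation mu := (@lebesgue_measure R).
Local Notation dom := (dom T).

Lemma lebesgue_dom : mu dom = T%:E.
Proof. by rewrite /Defs.dom lebesgue_measure_itv /= lte_fin T_gt0 sube0. Qed.

Lemma lebesgue_dom_finite : (mu dom < +oo)%E.
Proof. by rewrite lebesgue_dom ltry. Qed.

Lemma continuous_bounded_measurable (f : R -> R) : continuous f ->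
  @bounded_measurable _ RT R dom f.
Proof.
move=> cf; split; first by apply: measurable_funTS; exact: continuous_measurable_fun.
have c : {within `[0, T], continuous (fun x => `|f x|)}.
  apply: continuous_subspaceT => x; apply: continuous_comp; first exact: cf.
  exact: norm_continuous.
have [z _ hz] := EVT_max (ltW T_gt0) c.
exists `|f z| => x; rewrite /Defs.dom /= in_itv /= => /andP[/ltW x0 /ltW xT].
by apply: hz; rewrite in_itv /= x0.
Qed.

Section test_function.
Variable psi : R -> R.
Hypothesis psiP : test_function T psi.

Lemma test_derivable t : derivable psi t 1.
Proof. by have [/(_ 0%N t)] := psiP. Qed.

Lemma derivable_continuous (f : R -> R) : (forall t, derivable f t 1) -> continuous f.
Proof. by move=> df t; apply/differentiable_continuous/derivable1_diffP. Qed.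

Lemma test_continuous : continuous psi.
Proof. exact: derivable_continuous test_derivable. Qed.

Lemma test_derive_continuous : continuous (derive1 psi).
Proof. by apply: derivable_continuous => t; have [/(_ 1%N t)] := psiP. Qed.

Lemma test_ge t : T <= t -> psi t = 0.
Proof.
have [_ [a [b [a0 bT out]]]] := psiP => Tt; apply: out.
by rewrite in_itv /= negb_and -!ltNge (lt_le_trans bT Tt) orbT.
Qed.

Lemma test_le t : t <= 0 -> psi t = 0.
Proof.
have [_ [a [b [a0 bT out]]]] := psiP => Tt; apply: out.
by rewrite in_itv /= negb_and -!ltNge (le_lt_trans Tt a0).
Qed.

Lemma test_bounded_measurable : @bounded_measurable _ RT R dom psi.
Proof. exact: continuous_bounded_measurable test_continuous. Qed.

Lemma test_derive_bounded_measurable : @bounded_measurable _ RT R dom (derive1 psi).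
Proof. exact: continuous_bounded_measurable test_derive_continuous. Qed.

Lemma Rintegral_derive (f : R -> R) (a b : R) : a < b ->
  (forall t, derivable f t 1) -> continuous (derive1 f) ->
  \int[mu]_(x in `]a, b[) derive1 f x = f b - f a.
Proof.
move=> ab df cf; have cf' := derivable_continuous df.
have := @continuous_FTC2 R (derive1 f) f a b ab.
move=> /(_ (continuous_subspaceT cf)) h.
have mf : measurable_fun `]a, b[ (derive1 f).
  by apply: measurable_funTS; exact: continuous_measurable_fun.
rewrite /Rintegral integral_itv_bndo_bndc; last exact/measurable_EFinP.
rewrite integral_itv_obnd_cbnd; last first.
  by apply/measurable_EFinP; apply: measurable_funTS; exact: continuous_measurable_fun.
rewrite h //; split => [x _||]; first exact: df.
- by apply: cvg_at_right_filter; exact: cf'.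
- by apply: cvg_at_left_filter; exact: cf'.
Qed.

Lemma integral_test_derive t : 0 <= t < T ->
  \int[mu]_(x in `]t, T[) derive1 psi x = - psi t.
Proof.
move=> /andP[t0 tT].
rewrite Rintegral_derive //; [|exact: test_derivable|exact: test_derive_continuous].
by rewrite test_ge // sub0r.
Qed.

End test_function.
End test_integrals.

(** * Step functions and their atomic derivatives *)

Section step_functions.
Context {R : realType} {d : nat} (T : R).
Hypothesis T_gt0 : 0 < T.
Local Notation RT := (measurableTypeR R).
Local Notation mu := (@lebesgue_measure R).
Local Notation dom := (dom T).
Local Notation atom := (R * 'rV[R]_d)%type.
Implicit Types (s : seq (R * atom)) (c v : 'rV[R]_d) (u : R -> 'rV[R]_d).

Definition jump_fun (t : R) v : R -> 'rV[R]_d :=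
  fun r => \1_(`]t, T[%classic) r *: v.

Definition const_fun c : R -> 'rV[R]_d := fun=> c.

Definition step s c : R -> 'rV[R]_d := synth jump_fun const_fun s c.

Lemma stepE s c r i : step s c r 0 i =
  \sum_(x <- s) x.1 * x.2.2 0 i * \1_(`]x.2.1, T[%classic) r + c 0 i.
Proof.
rewrite /step /synth /const_fun.
have -> : ((\sum_(x <- s) x.1 *: jump_fun x.2.1 x.2.2 : R -> 'rV[R]_d) + (fun=> c)) r
    = \sum_(x <- s) x.1 *: jump_fun x.2.1 x.2.2 r + c.
  rewrite -[LHS]/((\sum_(x <- s) x.1 *: jump_fun x.2.1 x.2.2) r + c).
  by rewrite fct_sumE.
rewrite mxE summxE; congr (_ + _); apply: eq_bigr => x _.
by rewrite /jump_fun !mxE; ring.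
Qed.

Definition bounded_measurable_row u : Prop :=
  forall i, @bounded_measurable _ RT R dom (fun t => u t 0 i).

Lemma bounded_measurable_step s c : bounded_measurable_row (step s c).
Proof.
move=> i.
have -> : (fun t => step s c t 0 i) = (fun r => \sum_(x <- s) x.1 * x.2.2 0 i *
    \1_(`]x.2.1, T[%classic) r + c 0 i) by apply/funext => r; rewrite stepE.
apply: bounded_measurableD; last exact: bounded_measurable_cst.
apply: bounded_measurable_sum => x.
apply: bounded_measurableM; first exact: bounded_measurable_cst.
split; first by apply: measurable_indic; exact: measurable_itv.
exists 1 => y _; rewrite indicE; by case: (_ \in _); rewrite ?normr1 ?normr0.
Qed.

Lemma bounded_measurable_inL1 u : bounded_measurable_row u -> inL1 T u.
Proof.
move=> bu i; apply: bounded_measurable_integrable => //.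
  exact: measurable_itv.
exact: lebesgue_dom_finite.
Qed.

Lemma bounded_measurable_inL2 u : bounded_measurable_row u -> inL2 T u.
Proof.
move=> bu i; split; first by have [] := bu i.
apply: (@bounded_measurable_integrable _ RT R mu dom (fun t => u t 0 i ^+ 2)).
- exact: measurable_itv.
- exact: lebesgue_dom_finite.
have -> : (fun t => u t 0 i ^+ 2) = (fun t => u t 0 i * u t 0 i) by [].
exact: bounded_measurableM.
Qed.

Lemma atomicE s i (A : set RT) : measurable A ->
  atomic s i A = (\sum_(x <- s) x.1 * x.2.2 0 i * \1_A x.2.1)%:E.
Proof.
move=> mA; elim: s => [|x s IH]; first by rewrite big_nil.
rewrite big_cons EFinD -IH /= /cadd /=; congr (_ + _)%E.
Qed.

Definition step_mean s : 'rV[R]_d := T^-1 *: primitive (cumul (atomic s)) T.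

(** Inside the interval, [t0] lies in []0, t[] exactly when [t] lies in []t0, T[]; the mean only
    shifts the constant. *)
Lemma Bop_atomic s c t : (forall x, x \in s -> dom x.2.1) -> dom t ->
  Bop T (atomic s) c t = step s (c - step_mean s) t.
Proof.
move=> ds dt; apply/rowP => i; rewrite stepE /Bop -/(step_mean s) !mxE.
rewrite -addrA (addrC (- _)); congr (_ + _).
rewrite atomicE /=; last exact: measurable_itv.
apply: eq_big_seq => x xs; congr (_ * _); rewrite !indicE; congr (_%:R).
move: (ds x xs) dt; rewrite /Defs.dom /= !in_itv /= => /andP[x0 xT] /andP[t0 tT].
by rewrite !mem_setE !in_itv /= x0 tT andbT.
Qed.

(** A jump at [t] contributes the integral of psi' over []t, T[], which is -psi(t); the constant
    contributes -psi(0) = 0. *)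
Lemma distr_deriv_step s c u : (forall x, x \in s -> dom x.2.1) ->
  (forall t, dom t -> u t = step s c t) -> distr_deriv T u (atomic s).
Proof.
move=> ds us psi psiP i.
have md : @measurable _ RT dom by exact: measurable_itv.
have fd := lebesgue_dom_finite T_gt0.
have bp := test_bounded_measurable T_gt0 psiP.
have bp' := test_derive_bounded_measurable T_gt0 psiP.
have bind (x : R * atom) : @bounded_measurable _ RT R dom (\1_(`]x.2.1, T[%classic : set R)).
  split; first by apply: measurable_indic; exact: measurable_itv.
  by exists 1 => y _; rewrite indicE; case: (_ \in _); rewrite ?normr1 ?normr0.
have bx (x : R * atom) : @bounded_measurable _ RT R dom
    (fun t => derive1 psi t * \1_(`]x.2.1, T[%classic) t).
  exact: bounded_measurableM.
have int_bm (f : R -> R) : @bounded_measurable _ RT R dom f -> mu.-integrable dom (EFin \o f).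
  by move=> bf; exact: (bounded_measurable_integrable md fd bf).
rewrite charge_integral_atomic //.
have -> : \int[mu]_(t in dom) (u t 0 i * derive1 psi t) =
  \int[mu]_(t in dom) (\sum_(x <- s) x.1 * x.2.2 0 i *
     (derive1 psi t * \1_(`]x.2.1, T[%classic) t) + c 0 i * derive1 psi t).
  apply: eq_Rintegral => t; rewrite inE => dt; rewrite us // stepE mulrDl mulr_suml.
  by congr (_ + _); apply: eq_bigr => x _; ring.
rewrite RintegralD //; first last.
- by apply: int_bm; apply: bounded_measurableM => //; exact: bounded_measurable_cst.
- apply: int_bm; apply: bounded_measurable_sum => x.
  by apply: bounded_measurableM => //; exact: bounded_measurable_cst.
rewrite RintegralZl //; last exact: int_bm.
rewrite (integral_test_derive psiP) ?lexx // (test_le psiP) // oppr0 mulr0 addr0.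
rewrite (@Rintegral_sum_bounded _ RT R mu dom) //; last first.
  by move=> x; apply: bounded_measurableM => //; exact: bounded_measurable_cst.
rewrite -sumrN; apply: eq_big_seq => x xs.
rewrite RintegralZl //; last exact: int_bm.
rewrite -mulrN; congr (_ * _).
have dx := ds x xs; rewrite indicE mem_set // mulr1.
have /andP[x0 xT] : 0 < x.2.1 < T by move: dx; rewrite /Defs.dom /= in_itv.
rewrite -(integral_test_derive psiP) ?(ltW x0) //.
have e : `]x.2.1, T[%classic = dom `&` `]x.2.1, T[%classic.
  by rewrite setIidr //; apply: subset_itv; rewrite bnd_simp // ltW.
rewrite [in RHS]e Rintegral_mkcondr; apply: eq_Rintegral => t _.
by rewrite patchE indicE; case: ifP => _; rewrite ?mulr1 ?mulr0.
Qed.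

End step_functions.

(** * Functions vanishing at the boundary and the total variation of atomic derivatives *)

Section vanishing_functions.
Context {R : realType} {d : nat} (T : R).
Hypothesis T_gt0 : 0 < T.
Local Notation RT := (measurableTypeR R).
Local Notation dom := (dom T).
Implicit Types (phi : R -> 'rV[R]_d).

Lemma mx_norm_coord (x : 'rV[R]_d) i : `|x 0 i| <= `|x|.
Proof.
rewrite [leRHS]mx_normrE.
exact: (@le_bigmax_cond _ _ _ _ (0, i) predT (fun ij => `|x ij.1 ij.2|) isT).
Qed.

Lemma C0_bounded phi : inC0 T phi -> exists M, forall t, dom t -> `|phi t| <= M.
Proof.
move=> [cphi l0 lT].
have [a [a0 ha]] : exists a, 0 < a /\ forall t, 0 < t -> t < a -> `|phi t| <= 1.
  move/cvgrPdist_le : l0 => /(_ 1 ltr01) /nbhs_ballP[e /= e0 he].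
  exists e; split=> // t t0 te; have := he t; rewrite sub0r normrN; apply => //.
  by rewrite /ball /= sub0r normrN gtr0_norm.
have [b [bT hb]] : exists b, b < T /\ forall t, b < t -> t < T -> `|phi t| <= 1.
  move/cvgrPdist_le : lT => /(_ 1 ltr01) /nbhs_ballP[e /= e0 he].
  exists (T - e); split=> [|t bt tT]; first by rewrite ltrBlDr ltrDl.
  have := he t; rewrite sub0r normrN; apply => //.
  by rewrite /ball /= gtr0_norm ?subr_gt0 // ltrBlDr addrC -ltrBlDr.
have c : {within `[a / 2, (b + T) / 2], continuous (fun t => `|phi t|)}.
  apply: continuous_in_subspaceT => t; rewrite inE /= in_itv /= => /andP[t1 t2].
  apply: continuous_comp; last exact: norm_continuous.
  by apply: cphi; rewrite /Defs.dom /= in_itv /=; apply/andP; split; lra.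
have [M hM] : exists M, forall t, a / 2 <= t <= (b + T) / 2 -> `|phi t| <= M.
  have [ab|ba] := leP (a / 2) ((b + T) / 2).
    by have [z _ hz] := EVT_max ab c; exists `|phi z| => t ht; exact: hz.
  by exists 0 => t /andP[h1 h2]; have := lt_le_trans ba (le_trans h1 h2); rewrite ltxx.
exists (Num.max 1 M) => t; rewrite /Defs.dom /= in_itv /= => /andP[t0 tT].
rewrite le_max; have [ta|ta] := ltP t a; first by rewrite ha.
have [bt|bt] := ltP b t; first by rewrite hb.
by rewrite hM ?orbT //; apply/andP; split; lra.
Qed.

Lemma C0_enorm_bounded phi : inC0 T phi ->
  has_ubound [set enorm (phi t) | t in dom].
Proof.
move=> /C0_bounded[M hM]; exists (\sum_(i < d) M) => _ [t dt <-].
apply: le_trans (enorm_le_sum _) _; apply: ler_sum => i _.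
exact: le_trans (mx_norm_coord _ _) (hM _ dt).
Qed.

Lemma C0_le_Cnorm phi t : inC0 T phi -> dom t -> enorm (phi t) <= Cnorm T phi.
Proof. by move=> hp dt; apply: ub_le_sup; [exact: C0_enorm_bounded | exists t]. Qed.

Lemma C0_bounded_measurable phi i : inC0 T phi ->
  @bounded_measurable _ RT R dom (fun t => phi t 0 i).
Proof.
move=> hp; have [M hM] := C0_bounded hp; have [cphi _ _] := hp.
split; last by exists M => t dt; exact: le_trans (mx_norm_coord _ _) (hM _ dt).
apply: open_continuous_measurable_fun; first exact: interval_open.
move=> t; rewrite inE => dt.
exact: (@continuous_comp _ _ _ phi (fun M : 'rV[R]_d => M 0 i) t (cphi t dt) (@coord_continuous R 1 d 0 i _)).
Qed.

Lemma inC0_0 : inC0 T (fun=> 0 : 'rV[R]_d).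
Proof. by split; [move=> t _; exact: cst_continuous | exact: cvg_cst | exact: cvg_cst]. Qed.

Local Notation atom := (R * 'rV[R]_d)%type.
Implicit Types (s : seq (R * atom)) (q : @vmeasure R d) (u : R -> 'rV[R]_d).

(** [q] is an arbitrary derivative of [u], for instance the one chosen by [bv_deriv]; by
    [charge_determined] it integrates bounded measurable functions like the atomic one. *)
Lemma pairing_atomic u q s phi : distr_deriv T u q -> distr_deriv T u (atomic s) ->
  (forall x, x \in s -> dom x.2.1) -> inC0 T phi ->
  pairing T phi q = \sum_(x <- s) x.1 * edot (phi x.2.1) x.2.2.
Proof.
move=> uq us ds hp; rewrite /pairing.
have -> : \sum_(x <- s) x.1 * edot (phi x.2.1) x.2.2 =
    \sum_(i < d) \sum_(x <- s) x.1 * x.2.2 0 i * (phi x.2.1 0 i * \1_dom x.2.1).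
  rewrite exchange_big /=; apply: eq_big_seq => x xs.
  rewrite /edot mulr_sumr; apply: eq_bigr => i _.
  by rewrite indicE (mem_set (ds x xs)) mulr1; ring.
apply: eq_bigr => i _; have bp := C0_bounded_measurable i hp.
rewrite -(charge_integral_atomic _ _ (measurable_dom T) bp).
apply: charge_determined => // psi psiP.
by apply: oppr_inj; rewrite -uq // -us.
Qed.

Section norm_bounds.
Variables (u : R -> 'rV[R]_d) (s : seq (R * atom)).
Hypotheses (us : distr_deriv T u (atomic s)) (hs : admissible dom s).

Let ds x : x \in s -> dom x.2.1. Proof. by case/hs. Qed.

Lemma bv_derivP : distr_deriv T u (bv_deriv T u).
Proof.
rewrite /bv_deriv; case: pselect => [h|]; first exact: projT2 (cid h).
by case; exists (atomic s).
Qed.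

Lemma pairing_le phi : inC0 T phi -> Cnorm T phi <= 1 ->
  `|pairing T phi (bv_deriv T u)| <= mass s.
Proof.
move=> hp p1; rewrite (pairing_atomic bv_derivP us ds hp).
apply: le_trans (ler_norm_sum _ _ _) _; rewrite /mass big_seq [leRHS]big_seq.
apply: ler_sum => x /hs[x0 dx v1]; rewrite normrM gtr0_norm // -[leRHS]mulr1.
rewrite ler_pM2l //; apply: le_trans (edot_le _ _) _.
by rewrite v1 mulr1; apply: le_trans p1; exact: C0_le_Cnorm.
Qed.

Lemma Mnorm_le_mass : Mnorm T (bv_deriv T u) <= mass s.
Proof.
apply: ge_sup; last by move=> _ [phi [hp p1] <-]; exact: pairing_le.
exists `|pairing T (fun=> 0) (bv_deriv T u)|; exists (fun=> 0) => //; split.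
  exact: inC0_0.
apply: le_trans (ge_sup (x := 0) _ _) _ => //.
  by exists 0; exists (T / 2); rewrite ?enorm0 // /Defs.dom /= in_itv /=; have T0 := T_gt0; apply/andP; split; lra.
by move=> _ [t _ <-]; rewrite enorm0.
Qed.

Lemma pairing_le_Mnorm phi : inC0 T phi -> Cnorm T phi <= 1 ->
  \sum_(x <- s) x.1 * edot (phi x.2.1) x.2.2 <= Mnorm T (bv_deriv T u).
Proof.
move=> hp p1; rewrite -(pairing_atomic bv_derivP us ds hp).
apply: le_trans (ler_norm _) _; apply: ub_le_sup; last by exists phi.
by exists (mass s) => _ [psi [hpsi psi1] <-]; exact: pairing_le.
Qed.

End norm_bounds.
End vanishing_functions.

(** * Functions with zero distributional derivative *)

Section du_bois_reymond.
Context {R : realType} (T : R).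
Hypothesis T_gt0 : 0 < T.
Local Notation RT := (measurableTypeR R).
Local Notation mu := (@lebesgue_measure R).
Local Notation dom := (dom T).

(** Rises from 0 to 1 on [[a, a + e]], so its derivative is an approximate unit mass at [a], and the
    difference of two ramps is a test function. *)
Definition ramp (a e t : R) : R := rise (e^-1 * t + - (e^-1 * a)).

Lemma smooth_ramp a e : smooth (ramp a e).
Proof. by apply: smooth_affine; exact: smooth_rise. Qed.

Lemma derive1_ramp a e t :
  derive1 (ramp a e) t = e^-1 * derive1 rise (e^-1 * t + - (e^-1 * a)).
Proof.
have dr := Ck_is_derive (e^-1 * t + - (e^-1 * a)) (@smooth_rise R 0%N).
have da : is_derive t 1 (fun t => e^-1 * t + - (e^-1 * a)) e^-1.
  have := is_deriveD (is_deriveZ (e^-1) (is_derive_id t (1 : R)))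
    (is_derive_cst (- (e^-1 * a)) t 1).
  by rewrite /GRing.scale /= mulr1 addr0.
have [_ h] := @is_derive1_comp _ rise (fun t => e^-1 * t + - (e^-1 * a)) t _ _ dr da.
by rewrite derive1E [RHS]mulrC; exact: h.
Qed.

Lemma ramp_le a e t : 0 < e -> t <= a -> ramp a e t = 0.
Proof.
move=> e0 ta; rewrite /ramp rise_le0 // -mulrBr pmulr_rle0 ?invr_gt0 //.
by rewrite subr_le0.
Qed.

Lemma ramp_ge a e t : 0 < e -> a + e <= t -> ramp a e t = 1.
Proof.
move=> e0 ta; rewrite /ramp rise_ge1 // -mulrBr ler_pdivlMl // mulr1.
by rewrite lerBrDl.
Qed.

Lemma derive1_ramp_out a e t : 0 < e -> t < a \/ a + e < t ->
  derive1 (ramp a e) t = 0.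
Proof.
move=> e0 h; rewrite derive1_ramp derive1_rise_out ?mulr0 //.
rewrite -mulrBr; case: h => h; [left|right].
  by rewrite pmulr_rlt0 ?invr_gt0 // subr_lt0.
by rewrite ltr_pdivlMl // mulr1 ltrBrDl.
Qed.

Lemma integral_derive1_ramp a e : 0 < e -> 0 <= a -> a + e <= T ->
  \int[mu]_(t in dom) derive1 (ramp a e) t = 1.
Proof.
move=> e0 a0 aT; rewrite Rintegral_derive; [|exact: T_gt0|..].
- by rewrite (ramp_ge e0 aT) (ramp_le e0 a0) subr0.
- by move=> t; apply: smooth_derivable; exact: smooth_ramp.
- by apply: smooth_continuous; apply: smooth_derive; exact: smooth_ramp.
Qed.

Lemma ramp_test a b e : 0 < e -> 0 < a -> 0 < b -> a + e < T -> b + e < T ->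
  test_function T (fun t => ramp a e t - ramp b e t).
Proof.
move=> e0 a0 b0 aT bT.
apply: (@smooth_test_function _ T (Num.min a b) (Num.max a b + e)).
- by rewrite lt_min a0.
- by rewrite addr_maxl gt_max aT.
- have -> : (fun t => ramp a e t - ramp b e t) =
      (fun t => ramp a e t + (fun t => -1 * ramp b e t) t).
    by apply/funext => t; rewrite mulN1r.
  apply: smoothD; first exact: smooth_ramp.
  by apply: smoothM; [move=> n; exact: Ck_cst | exact: smooth_ramp].
- move=> t; rewrite negb_and -!ltNge => /orP[].
    rewrite lt_min => /andP[/ltW ta /ltW tb].
    by rewrite (ramp_le e0 ta) (ramp_le e0 tb) subrr.
  rewrite addr_maxl gt_max => /andP[/ltW ta /ltW tb].
  by rewrite (ramp_ge e0 ta) (ramp_ge e0 tb) subrr.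
Qed.

Variable w : R -> R.
Hypothesis iw : mu.-integrable dom (EFin \o w).

Let f : R -> R := w \_ dom.

Lemma integrable_ramp a e : mu.-integrable dom (fun t => (w t * derive1 (ramp a e) t)%:E).
Proof.
have md : @measurable _ RT dom by exact: measurable_itv.
have [mw _] := integrableP _ _ _ iw.
have [mr [M hM]] := @continuous_bounded_measurable R T T_gt0 (derive1 (ramp a e))
  (smooth_continuous (smooth_derive (smooth_ramp a e))).
have br : [bounded derive1 (ramp a e) x | x in dom].
  exists M; split; first exact: num_real.
  by move=> M' /ltW MM' x dx; exact: le_trans (hM x dx) MM'.
exact: (integrableMl md iw mr br).
Qed.

(** The kernel has integral 1, is bounded by [e^-1 * B] and lives on [[a, a + e]], inside the ball
    of radius [2 * e]. That ball has measure [4 * e], hence [C = 4 * B]. *)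
Lemma mollify_bound : exists2 C : R, 0 < C & forall a e, dom a -> 0 < e -> a + e <= T ->
  (`|\int[mu]_(t in dom) (w t * derive1 (ramp a e) t) - w a|%:E <=
    C%:E * davg f a (2 * e))%E.
Proof.
have [B B0 hB] := @derive1_rise_bound R.
exists (4 * B); first by rewrite mulr_gt0.
move=> a e da e0 aT.
have md : @measurable _ RT dom by exact: measurable_itv.
have a0 : 0 < a by move: da; rewrite /Defs.dom /= in_itv /= => /andP[].
have fE t : dom t -> f t = w t by move=> dt; rewrite /f patchE mem_set.
have ir := integrable_ramp a e.
have smr := smooth_ramp a e.
have bder : @bounded_measurable _ RT R dom (derive1 (ramp a e)).
  by apply: continuous_bounded_measurable => //; apply: smooth_continuous; exact: smooth_derive.
have ider : mu.-integrable dom (EFin \o derive1 (ramp a e)).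
  exact: (bounded_measurable_integrable md (lebesgue_dom_finite T_gt0) bder).
have iwd : mu.-integrable dom (EFin \o (fun t => w a * derive1 (ramp a e) t)).
  exact: (integrableZl md (w a) ider).
have -> : \int[mu]_(t in dom) (w t * derive1 (ramp a e) t) - w a =
    \int[mu]_(t in dom) ((w t - w a) * derive1 (ramp a e) t).
  rewrite -[w a in LHS]mulr1 -(integral_derive1_ramp e0 (ltW a0) aT).
  rewrite -RintegralZl // -RintegralB //.
  by apply: eq_Rintegral => t _; rewrite mulrBl.
have ig : mu.-integrable dom (EFin \o (fun t => (w t - w a) * derive1 (ramp a e) t)).
  have := integrableB md ir iwd; apply: eq_integrable => // t _.
  by rewrite /= mulrBl EFinB.
rewrite EFin_normr_Rintegral //.
have [mg _] := integrableP _ _ _ ig.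
apply: le_trans (le_abse_integral mu md mg) _.
have mball : @measurable _ RT (ball a (2 * e) : set R) by rewrite ball_itv; exact: measurable_itv.
have mf : @measurable_fun _ _ RT _ setT (fun t => `|(center (f a) \o f) t|%:E : \bar R).
  apply/measurable_EFinP; apply: measurableT_comp => //.
  apply: measurable_funB; last exact: measurable_cst.
  have [/measurable_EFinP mw _] := integrableP _ _ _ iw.
  exact: ((@measurable_restrictT _ _ RT R dom w md).1 mw).
have e2 : 0 <= 2 * e by rewrite mulr_ge0 // ltW.
have eB : 0 <= e^-1 * B by rewrite mulr_ge0 ?invr_ge0 // ltW.
apply: (@le_trans _ _ (\int[mu]_(t in dom) (((fun t =>
    (e^-1 * B)%:E * `|(center (f a) \o f) t|%:E) \_ (ball a (2 * e))) t))%E).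
  apply: ge0_le_integral => //.
  - exact: measurableT_comp.
  - apply/measurable_restrict => //; apply: measurable_funTS.
    exact: measurable_funeM.
  move=> t dt; rewrite patchE /= !fE //.
  case: ifPn => [_|]; first rewrite -EFinM lee_fin normrM mulrC ler_wpM2r //.
    rewrite derive1_ramp normrM (gtr0_norm (_ : 0 < e^-1)) ?invr_gt0 //.
    by rewrite ler_pM2l ?invr_gt0 // hB.
  move=> /negP nb; rewrite derive1_ramp_out ?mulr0 ?normr0 //.
  apply: contrapT => /not_orP[/negP h1 /negP h2]; apply: nb; rewrite inE ball_itv /= in_itv /=.
  by rewrite -!leNgt in h1 h2; apply/andP; split; lra.
rewrite -integral_mkcondr.
apply: (@le_trans _ _ (\int[mu]_(t in ball a (2 * e))
    ((e^-1 * B)%:E * `|(center (f a) \o f) t|%:E))%E).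
  apply: ge0_subset_integral => //; first exact: measurableI.
  - by apply: measurable_funTS; exact: measurable_funeM.
  - by move=> t _; rewrite -EFinM lee_fin mulr_ge0.
rewrite ge0_integralZl //; last exact: measurable_funTS.
rewrite /davg /iavg lebesgue_measure_ball // inver.
have en : 2 * e *+ 2 != 0 by rewrite mulrn_eq0 /= mulf_neq0 // gt_eqF.
rewrite (negPf en) muleA -EFinM.
rewrite le_eqVlt; apply/orP; left; apply/eqP; congr (_%:E * _)%E.
by field; rewrite gt_eqF.
Qed.

Lemma mollify_cvg a : dom a -> lebesgue_pt f a ->
  \int[mu]_(t in dom) (w t * derive1 (ramp a e) t) @[e --> 0^'+] --> w a.
Proof.
move=> da pt; have [C C0 hC] := mollify_bound.
have aT : a < T by move: da; rewrite /Defs.dom /= in_itv /= => /andP[].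
apply/cvgrPdist_le => eta eta0.
have /fine_cvgP[fin fc] : davg f a r @[r --> 0^'+] --> 0%:E := pt.
have ec : 0 < eta / C by rewrite divr_gt0.
have /nbhs_ballP[r1 /= r10 h1] := fin.
have /cvgrPdist_le /(_ _ ec) /nbhs_ballP[r2 /= r20 h2] := fc.
near=> e.
have e0 : 0 < e by near: e; exact: nbhs_right_gt.
have eT : a + e <= T.
  rewrite -lerBrDl; near: e; apply: nbhs_right_le; by rewrite subr_gt0.
have e1 : 2 * e < r1.
  by rewrite -ltr_pdivlMl //; near: e; apply: nbhs_right_lt; rewrite mulr_gt0 // invr_gt0.
have e2 : 2 * e < r2.
  by rewrite -ltr_pdivlMl //; near: e; apply: nbhs_right_lt; rewrite mulr_gt0 // invr_gt0.
have p2 : 0 < 2 * e by rewrite mulr_gt0.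
have b1 : davg f a (2 * e) \is a fin_num.
  by apply: h1 => //; rewrite /ball /= sub0r normrN gtr0_norm.
have b2 : fine (davg f a (2 * e)) <= eta / C.
  have := h2 (2 * e); rewrite /= sub0r normrN => h; apply: le_trans (ler_norm _) (h _ _) => //.
  by rewrite /ball /= sub0r normrN gtr0_norm.
rewrite distrC; have := hC a e da e0 eT; rewrite -(fineK b1) -EFinM lee_fin.
move=> /le_trans; apply; move: b2; rewrite ler_pdivlMr // mulrC; exact.
Unshelve. all: by end_near. Qed.

(** Testing with a difference of ramps shows that the mollified values at two points coincide for
    small [e]; at Lebesgue points they converge to the values of [w]. *)
Lemma du_bois_reymond :
  (forall psi, test_function T psi -> \int[mu]_(t in dom) (w t * derive1 psi t) = 0) ->
  exists c, {ae mu, forall t, dom t -> w t = c}.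
Proof.
move=> H; have md : @measurable _ RT dom by exact: measurable_itv.
have pts : {ae mu, forall x, lebesgue_pt f x}.
  by apply: lebesgue_differentiation; exact: integrable_locally_restrict.
have same a b : dom a -> dom b -> lebesgue_pt f a -> lebesgue_pt f b -> w a = w b.
  move=> da db pa pb; have ca := mollify_cvg da pa.
  have cb := mollify_cvg db pb.
  move: da db; rewrite /Defs.dom /= !in_itv /= => /andP[a0 aT] /andP[b0 bT].
  pose I c e := \int[mu]_(t in dom) (w t * derive1 (ramp c e) t).
  suff eqI : {near 0^'+, I b =1 I a}.
    exact: (cvg_unique _ ca (cvg_trans (near_eq_cvg eqI) cb)).
  near=> e; rewrite /I.
  have e0 : 0 < e by near: e; exact: nbhs_right_gt.
  have eaT : a + e < T by rewrite -ltrBrDl; near: e; apply: nbhs_right_lt; rewrite subr_gt0.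
  have ebT : b + e < T by rewrite -ltrBrDl; near: e; apply: nbhs_right_lt; rewrite subr_gt0.
  have := H _ (ramp_test e0 a0 b0 eaT ebT).
  have dE t : derive1 (fun t => ramp a e t - ramp b e t) t =
      derive1 (ramp a e) t - derive1 (ramp b e) t.
    have := is_deriveB (Ck_is_derive t (@smooth_ramp a e 0%N))
      (Ck_is_derive t (@smooth_ramp b e 0%N)).
    by case=> _ h; rewrite derive1E; exact: h.
  under eq_Rintegral do rewrite dE mulrBr.
  rewrite RintegralB; [|exact: md|exact: integrable_ramp|exact: integrable_ramp].
  by move/eqP; rewrite subr_eq0 => /eqP h; exact: esym h.
have [[a0 [da0 pa0]]|no] := pselect (exists a, dom a /\ lebesgue_pt f a).
  exists (w a0); case: pts => M [mM M0 sub]; exists M; split => // t h.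
  by apply: sub => /= pt; apply: h => dt; exact: same.
exists 0; case: pts => M [mM M0 sub]; exists M; split => // t h.
by apply: sub => /= pt; apply: h => dt; exfalso; apply: no; exists t.
Unshelve. all: by end_near. Qed.

End du_bois_reymond.

(** * The L^1 norm of jumps and step functions *)

Section function_norms.
Context {R : realType} {d : nat} (T : R).
Hypothesis T_gt0 : 0 < T.
Local Notation RT := (measurableTypeR R).
Local Notation mu := (@lebesgue_measure R).
Local Notation dom := (dom T).
Implicit Types (u v : R -> 'rV[R]_d).
Local Notation bmr := (bounded_measurable_row T).

Let md : @measurable _ RT dom. Proof. exact: measurable_itv. Qed.

Lemma bounded_measurable_rowD u v : bmr u -> bmr v -> bmr (u + v).
Proof.
move=> hu hv i; have := bounded_measurableD (hu i) (hv i).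
by congr bounded_measurable; apply/funext => t; rewrite /= mxE.
Qed.

Lemma bounded_measurable_rowZ a u : bmr u -> bmr (a *: u).
Proof.
move=> hu i; have := bounded_measurableM (bounded_measurable_cst dom a) (hu i).
by congr bounded_measurable; apply/funext => t; rewrite /= mxE.
Qed.

Lemma bounded_measurable_row0 : bmr (0 : R -> 'rV[R]_d).
Proof.
move=> i; have := bounded_measurable_cst (dom : set RT) (0 : R).
by congr bounded_measurable; apply/funext => t; rewrite /= mxE.
Qed.

Lemma bounded_measurable_jump t (z : 'rV[R]_d) : bmr (jump_fun T t z).
Proof.
move=> i; have h : @bounded_measurable _ RT R dom (\1_(`]t, T[%classic : set R)).
  split; first by apply: measurable_indic; exact: measurable_itv.
  by exists 1 => y _; rewrite indicE; case: (_ \in _); rewrite ?normr1 ?normr0.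
have := bounded_measurableM h (bounded_measurable_cst dom (z 0 i)).
by congr bounded_measurable; apply/funext => r; rewrite /jump_fun /= mxE.
Qed.

Lemma bounded_measurable_const (z : 'rV[R]_d) : bmr (const_fun z).
Proof. by move=> i; exact: bounded_measurable_cst. Qed.

Lemma bounded_measurable_enorm u : bmr u ->
  @bounded_measurable _ RT R dom (fun t => enorm (u t)).
Proof.
move=> hu; split.
  apply: (measurableT_comp (f := @Num.sqrt R)).
    by apply: continuous_measurable_fun; exact: sqrt_continuous.
  have := @bounded_measurable_sum _ RT R 'I_d (index_enum _) dom
    (fun i t => u t 0 i * u t 0 i) (fun i => bounded_measurableM (hu i) (hu i)).
  by case.
have [M hM] := @boolp.choice 'I_d R (fun i M => forall t, dom t -> `|u t 0 i| <= M)
  (fun i => (hu i).2).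
exists (\sum_i M i) => t dt; rewrite ger0_norm ?enorm_ge0 //.
by apply: le_trans (enorm_le_sum _) _; apply: ler_sum => i _; exact: hM.
Qed.

Lemma integrable_bounded (f : R -> R) : @bounded_measurable _ RT R dom f ->
  mu.-integrable dom (EFin \o f).
Proof. exact: (bounded_measurable_integrable md (lebesgue_dom_finite T_gt0)). Qed.

Lemma L1norm0 : L1norm T (0 : R -> 'rV[R]_d) = 0.
Proof.
rewrite /L1norm (_ : (fun t => _) = cst 0) ?Rintegral_cst ?mul0r //.
by apply/funext => t; rewrite /= enorm0.
Qed.

Lemma L1normD u v : bmr u -> bmr v -> L1norm T (u + v) <= L1norm T u + L1norm T v.
Proof.
move=> hu hv; have iu := integrable_bounded (bounded_measurable_enorm hu).
have iv := integrable_bounded (bounded_measurable_enorm hv).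
have iuv := integrable_bounded (bounded_measurable_enorm (bounded_measurable_rowD hu hv)).
rewrite /L1norm -RintegralD //; apply: le_Rintegral => //.
  have := integrableD md iu iv; apply: eq_integrable => // t _.
by move=> t _; exact: enormD.
Qed.

Lemma L1normZ a u : bmr u -> L1norm T (a *: u) = `|a| * L1norm T u.
Proof.
move=> hu; have iu := integrable_bounded (bounded_measurable_enorm hu).
by rewrite /L1norm -RintegralZl //; apply: eq_Rintegral => t _; rewrite /= enormZ.
Qed.

Lemma L1norm_le u M : bmr u -> (forall t, dom t -> enorm (u t) <= M) ->
  L1norm T u <= T * M.
Proof.
move=> hu hM; have iu := integrable_bounded (bounded_measurable_enorm hu).
have -> : T * M = \int[mu]_(t in dom) M.
  rewrite Rintegral_cst // mulrC; congr (_ * _).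
  exact: esym (congr1 fine (lebesgue_dom T_gt0)).
apply: le_Rintegral => //.
by apply: integrable_bounded; exact: bounded_measurable_cst.
Qed.

(** The factor [1 + T] is the constant common to the three bounds that [seminorm_synthB] takes. *)
Lemma L1norm_jump t (z : 'rV[R]_d) : L1norm T (jump_fun T t z) <= (1 + T) * enorm z.
Proof.
apply: (@le_trans _ _ (T * enorm z)); last first.
  by rewrite ler_wpM2r ?enorm_ge0 // lerDr.
apply: L1norm_le; first exact: bounded_measurable_jump.
move=> r _; rewrite /jump_fun enormZ indicE.
by case: (_ \in _); rewrite ?normr1 ?mul1r // normr0 mul0r enorm_ge0.
Qed.

Lemma L1norm_const (z : 'rV[R]_d) : L1norm T (const_fun z) <= (1 + T) * enorm z.
Proof.
apply: (@le_trans _ _ (T * enorm z)); last first.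
  by rewrite ler_wpM2r ?enorm_ge0 // lerDr.
by apply: L1norm_le; first exact: bounded_measurable_const.
Qed.

Lemma bounded_measurable_rowB u v : bmr u -> bmr v -> bmr (u - v).
Proof.
move=> hu hv; apply: bounded_measurable_rowD => //.
by rewrite -scaleN1r; exact: bounded_measurable_rowZ.
Qed.

Lemma L1norm_jump_shift t t' (z : 'rV[R]_d) : dom t -> dom t' -> t <= t' -> enorm z = 1 ->
  L1norm T (jump_fun T t z - jump_fun T t' z) <= t' - t.
Proof.
move=> dt dt' tt' z1.
have hb := bounded_measurable_rowB (bounded_measurable_jump t z) (bounded_measurable_jump t' z).
have iu := integrable_bounded (bounded_measurable_enorm hb).
have mS : @measurable _ RT (`]t, t'] : set R) by exact: measurable_itv.
have e : mu (`]t, t'] : set R) = (t' - t)%:E.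
  rewrite lebesgue_measure_itv /= lte_fin; case: ltP => // t't.
  by rewrite (_ : t = t') ?subrr //; apply/eqP; rewrite eq_le tt'.
have -> : t' - t = \int[mu]_(r in dom) \1_(`]t, t'] : set R) r.
  rewrite /Rintegral integral_indic // setIidl; first exact: esym (congr1 fine e).
  move: dt dt'; rewrite /Defs.dom /= !in_itv /= => /andP[t0 tT] /andP[t'0 t'T] r /=.
  rewrite !in_itv /= => /andP[tr rt']; rewrite (lt_trans t0 tr).
  exact: le_lt_trans rt' t'T.
apply: le_Rintegral => //.
  apply: integrable_bounded; split; first exact: measurable_indic.
  by exists 1 => y _; rewrite indicE; case: (_ \in _); rewrite ?normr1 ?normr0.
move=> r; rewrite /Defs.dom /= in_itv /= => /andP[r0 rT].
rewrite /jump_fun -[X in enorm X]/(_ r *: z - _ r *: z) -scalerBl enormZ z1 mulr1.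
rewrite !indicE !mem_setE !in_itv /= rT !andbT.
case: (ltP t r) => tr; case: (leP r t') => rt' /=.
- by rewrite subr0 normr1.
- by rewrite subrr normr0.
- by rewrite subrr normr0.
- by have := le_lt_trans (le_trans tr tt') rt'; rewrite ltxx.
Qed.

Lemma L1norm_jumpB t t' (z z' : 'rV[R]_d) : dom t -> dom t' -> enorm z' = 1 ->
  L1norm T (jump_fun T t z - jump_fun T t' z') <=
    (1 + T) * (`|t - t'| + enorm (z - z')).
Proof.
move=> dt dt' z1.
have -> : jump_fun T t z - jump_fun T t' z' =
    jump_fun T t (z - z') + (jump_fun T t z' - jump_fun T t' z').
  apply/funext => r; rewrite /jump_fun.
  rewrite -[LHS]/(_ r *: z - _ r *: z') -[RHS]/(_ r *: (z - z') + (_ r *: z' - _ r *: z')).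
  by rewrite scalerBr addrA subrK.
apply: le_trans (L1normD _ _) _; first exact: bounded_measurable_jump.
  by apply: bounded_measurable_rowB; exact: bounded_measurable_jump.
have sh : L1norm T (jump_fun T t z' - jump_fun T t' z') <= `|t - t'|.
  have [tt'|/ltW tt'] := leP t t'.
    by rewrite distrC ger0_norm ?subr_ge0 // L1norm_jump_shift.
  rewrite ger0_norm ?subr_ge0 // -[X in L1norm T X]opprB -scaleN1r L1normZ.
    by rewrite normrN1 mul1r L1norm_jump_shift.
  by apply: bounded_measurable_rowB; exact: bounded_measurable_jump.
have := L1norm_jump t (z - z'); have T0 := T_gt0.
have : 0 <= T * `|t - t'| by rewrite mulr_ge0 // ltW.
lra.
Qed.

End function_norms.

(** * The operator on step functions and the dual curves *)

Section operators.
Context {R : realType} {d : nat} (T : R).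
Hypothesis T_gt0 : 0 < T.
Context {Y : completeNormedModType R} {dot : Y -> Y -> R}.
Hypothesis dotP : hilbert_dot dot.
Context {K : (R -> 'rV[R]_d) -> Y}.
Hypothesis K_lin : continuous_linear_L2 T K.
Context {Kadj : Y -> R -> 'rV[R]_d}.
Hypothesis KadjP : is_adjoint T dot K Kadj.
Hypothesis Kadj_Linfty : adjoint_bounded_Linfty T Kadj.
Local Notation RT := (measurableTypeR R).
Local Notation mu := (@lebesgue_measure R).
Local Notation dom := (dom T).
Local Notation bmr := (bounded_measurable_row T).
Implicit Types (u v : R -> 'rV[R]_d) (y : Y) (c z : 'rV[R]_d) (t : R).

Let md : @measurable _ RT dom. Proof. exact: measurable_itv. Qed.

Lemma ae_inL2 u v : (forall i, measurable_fun dom (fun t => u t 0 i)) ->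
  bmr v -> ae_eq_on_dom T u v -> inL2 T u.
Proof.
move=> mu_ bv uv i; split=> //.
have [mv _] := bv i.
have [_ iv] := bounded_measurable_inL2 T_gt0 bv i.
have m2 : measurable_fun dom (fun t => u t 0 i ^+ 2) by exact: measurable_funX.
have mv2 : measurable_fun dom (fun t => v t 0 i ^+ 2) by exact: measurable_funX.
apply/integrableP; split; first exact/measurable_EFinP.
have [_ fin] := integrableP _ _ _ iv.
have -> : (\int[mu]_(t in dom) `|(EFin \o (fun t => u t 0 i ^+ 2)%R) t| =
    \int[mu]_(t in dom) `|(EFin \o (fun t => v t 0 i ^+ 2)%R) t|)%E => //.
apply: ae_eq_integral => //.
- by apply: measurableT_comp => //; exact/measurable_EFinP.
- by apply: measurableT_comp => //; exact/measurable_EFinP.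
- case: uv => M [mM M0 sub]; exists M; split => // t h; apply: sub => /= h2.
  by apply: h => dt /=; rewrite h2.
Qed.

(** The difference has L^2 norm zero, so the bound on [K] sends it to zero. *)
Lemma K_ext u v : (forall i, measurable_fun dom (fun t => u t 0 i)) ->
  bmr v -> ae_eq_on_dom T u v -> K u = K v.
Proof.
move=> mu_ bv uv; have lu := ae_inL2 mu_ bv uv; have lv := bounded_measurable_inL2 T_gt0 bv.
have [lin [C hC]] := K_lin.
have := lin (-1) v u lv lu; set w := (fun t => _) => e.
have w0 : ae_eq_on_dom T w (fun=> 0).
  case: uv => M [mM M0 sub]; exists M; split => // t h; apply: sub => /= h2.
  by apply: h => dt; rewrite /w h2 // scaleN1r addNr.
have mw i : measurable_fun dom (fun t => w t 0 i).
  have [mv _] := bv i.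
  have := measurable_funB (mu_ i) mv; congr measurable_fun; apply/funext => t.
  by rewrite /w !mxE mulN1r addrC.
have lw : inL2 T w.
  apply: (ae_inL2 mw _ w0); exact: (bounded_measurable_row0).
have nw : L2norm T w = 0.
  rewrite /L2norm /L2dot (_ : Rintegral _ _ _ = 0) ?sqrtr0 //.
  have -> : 0 = \int[mu]_(t in dom) (0 : R) by rewrite Rintegral_cst // mul0r.
  congr fine; apply: ae_eq_integral => //.
  - apply/measurable_EFinP.
    have -> : (fun t => edot (w t) (w t)) = (fun t => \sum_(i < d) w t 0 i * w t 0 i) by [].
    by apply: measurable_sum => i; exact: (measurable_funM (mw i) (mw i)).
  - case: w0 => M [mM M0 sub]; exists M; split => // t h; apply: sub => /= h2.
    by apply: h => dt /=; rewrite h2 // edot0l.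
have := hC w lw; rewrite nw mulr0 e scaleN1r normr_le0 addrC subr_eq0 => /eqP.
exact.
Qed.

Lemma K_linear a u v : bmr u -> bmr v -> K (a *: u + v) = a *: K u + K v.
Proof.
move=> hu hv; have [lin _] := K_lin.
by apply: lin; exact: (bounded_measurable_inL2 T_gt0).
Qed.

Lemma K0 : K 0 = 0.
Proof.
have := K_linear (-1) (bounded_measurable_row0 T) (bounded_measurable_row0 T).
by rewrite scaler0 addr0 scaleN1r addNr.
Qed.

Lemma KD u v : bmr u -> bmr v -> K (u + v) = K u + K v.
Proof. by move=> hu hv; rewrite -[u]scale1r K_linear // !scale1r. Qed.

Lemma KZ a u : bmr u -> K (a *: u) = a *: K u.
Proof.
move=> hu; rewrite -[a *: u]addr0 K_linear ?K0 ?addr0 //.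
exact: bounded_measurable_row0.
Qed.

Definition Kjump t z : Y := K (jump_fun T t z).
Definition Kconst c : Y := K (const_fun c).
Definition dual y : R -> 'rV[R]_d := primitive (Kadj y).

Lemma jump_funZ a t z : jump_fun T t (a *: z) = a *: jump_fun T t z.
Proof.
apply/funext => r; rewrite /jump_fun -[RHS]/(a *: (_ r *: z)).
by rewrite !scalerA mulrC.
Qed.

Lemma jump_funD t z z' : jump_fun T t (z + z') = jump_fun T t z + jump_fun T t z'.
Proof.
apply/funext => r; rewrite /jump_fun -[RHS]/(_ r *: z + _ r *: z').
by rewrite scalerDr.
Qed.

Lemma KjumpZ a t z : Kjump t (a *: z) = a *: Kjump t z.
Proof. by rewrite /Kjump jump_funZ KZ //; exact: bounded_measurable_jump. Qed.

Lemma KjumpB t z z' : Kjump t (z - z') = Kjump t z - Kjump t z'.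
Proof.
rewrite -(scaleN1r z') -[- Kjump _ _]scaleN1r -KjumpZ.
by rewrite /Kjump jump_funD KD //; exact: bounded_measurable_jump.
Qed.

Lemma KconstZ a c : Kconst (a *: c) = a *: Kconst c.
Proof. by rewrite -KZ //; exact: bounded_measurable_const. Qed.

Lemma KconstB c z : Kconst (c - z) = Kconst c - Kconst z.
Proof.
rewrite -(scaleN1r z) -[- Kconst _]scaleN1r -KconstZ.
by rewrite /Kconst -KD //; exact: bounded_measurable_const.
Qed.

Lemma K_step s c : K (step T s c) = synth Kjump Kconst s c.
Proof.
rewrite /step /synth; elim: s => [|x s IH].
  by rewrite !big_nil !add0r.
rewrite !big_cons -!addrA -IH K_linear //; first exact: bounded_measurable_jump.
exact: bounded_measurable_step.
Qed.

Lemma Kadj_integrable y i : mu.-integrable dom (EFin \o (fun t => Kadj y t 0 i)).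
Proof.
have [h _] := KadjP y; have [m1 i2] := h i.
have i1 : mu.-integrable dom (EFin \o cst (1 : R)).
  by apply: integrable_bounded => //; exact: bounded_measurable_cst.
apply: (le_integrable md _ _ (integrableD md i1 i2)); first exact/measurable_EFinP.
move=> t _ /=; rewrite lee_fin.
set x := Kadj y t 0 i; rewrite -real_normK ?num_real // [leRHS]ger0_norm; last first.
  by rewrite addr_ge0 // sqr_ge0.
have := sqr_ge0 (`|x| - 1); have := normr_ge0 x; nra.
Qed.

Lemma primitive_increment y i s t : 0 <= s <= t -> t <= T ->
  (dual y t - dual y s) 0 i = \int[mu]_(r in `]s, t[) Kadj y r 0 i.
Proof.
move=> /andP[s0 st] tT; rewrite /dual /primitive !mxE.
have it (b : R) : b <= T -> mu.-integrable `]0, b[ (EFin \o (fun r => Kadj y r 0 i)).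
  move=> bT; apply: (integrableS md _ _ (Kadj_integrable y i)) => //.
  by apply: subset_itv; rewrite bnd_simp.
have [<-|st'] := eqVneq s t.
  rewrite subrr (_ : `]s, s[%classic = set0) ?Rintegral_set0 //.
  by apply/seteqP; split => r //=; rewrite in_itv /= => /andP[a b]; have := lt_trans a b; rewrite ltxx.
have lt_st : s < t by rewrite lt_def eq_sym st'.
rewrite -(@Rintegral_itvB _ (fun r => Kadj y r 0 i) (BRight 0) (BLeft t) s); [|exact: it|by rewrite bnd_simp|by rewrite bnd_simp].
rewrite (@Rintegral_itv_bndo_bndc _ (BRight 0) s) //; apply: it; exact: le_trans st tT.
Qed.

Lemma dual0 y : dual y 0 = 0.
Proof.
apply/rowP => i; rewrite /dual /primitive !mxE (_ : `]0, 0[%classic = set0) ?Rintegral_set0 //.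
by apply/seteqP; split => r //=; rewrite in_itv /= => /andP[a b]; have := lt_trans a b; rewrite ltxx.
Qed.

Lemma integrable_bounded_mul (f g : R -> R) : @bounded_measurable _ RT R dom f ->
  mu.-integrable dom (EFin \o g) -> mu.-integrable dom (EFin \o (fun t => f t * g t)).
Proof.
move=> [mf [M hM]] ig; apply: (integrableMr md mf _ ig).
exists M; split; first exact: num_real.
by move=> M' /ltW MM' x dx; exact: le_trans (hM x dx) MM'.
Qed.

Lemma Rintegral_sum_integrable (f : 'I_d -> R -> R) (r : seq 'I_d) :
  (forall i, mu.-integrable dom (EFin \o f i)) ->
  mu.-integrable dom (EFin \o (fun t => \sum_(i <- r) f i t)) /\
  \int[mu]_(t in dom) (\sum_(i <- r) f i t) = \sum_(i <- r) \int[mu]_(t in dom) f i t.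
Proof.
move=> hf; elim: r => [|i r [IH1 IH2]].
  have e : (fun t => \sum_(i <- [::]) f i t) = cst 0.
    by apply/funext => t; rewrite big_nil.
  rewrite e big_nil; split; last by rewrite Rintegral_cst // mul0r.
  by apply: integrable_bounded => //; exact: bounded_measurable_cst.
have e : (fun t => \sum_(j <- i :: r) f j t) = (fun t => f i t + \sum_(j <- r) f j t).
  by apply/funext => t; rewrite big_cons.
rewrite e big_cons -IH2 RintegralD //; split=> //.
exact: (integrableD md (hf i) IH1).
Qed.

Lemma dot_K u y : bmr u ->
  dot (K u) y = \sum_(i < d) \int[mu]_(t in dom) (u t 0 i * Kadj y t 0 i).
Proof.
move=> hu; have [_ h] := KadjP y.
rewrite h; last exact: bounded_measurable_inL2.
have [_ e] := @Rintegral_sum_integrable (fun i t => u t 0 i * Kadj y t 0 i)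
  (index_enum _) (fun i => integrable_bounded_mul (hu i) (Kadj_integrable y i)).
by rewrite -e.
Qed.

Lemma dot_Kconst c y : dot (Kconst c) y = edot c (dual y T).
Proof.
rewrite dot_K; last exact: bounded_measurable_const.
apply: eq_bigr => i _; rewrite /const_fun RintegralZl //; last exact: Kadj_integrable.
by rewrite /dual /primitive mxE.
Qed.

Lemma dot_Kjump t z y : dom t -> dot (Kjump t z) y = edot z (dual y T - dual y t).
Proof.
move=> dt; have /andP[t0 tT] : 0 < t < T by move: dt; rewrite /Defs.dom /= in_itv.
rewrite dot_K; last exact: bounded_measurable_jump.
apply: eq_bigr => i _; rewrite primitive_increment ?(ltW t0) ?(ltW tT) //.
have e : `]t, T[%classic = dom `&` `]t, T[%classic.
  by rewrite setIidr //; apply: subset_itv; rewrite bnd_simp // ltW.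
have bS : @bounded_measurable _ RT R dom (\1_(`]t, T[%classic : set R)).
  split; first by apply: measurable_indic; exact: measurable_itv.
  by exists 1 => r _; rewrite indicE; case: (_ \in _); rewrite ?normr1 ?normr0.
have -> : \int[mu]_(r in dom) (jump_fun T t z r 0 i * Kadj y r 0 i) =
    \int[mu]_(r in dom) (z 0 i * (\1_(`]t, T[%classic) r * Kadj y r 0 i)).
  by apply: eq_Rintegral => r _; rewrite /jump_fun mxE; ring.
rewrite RintegralZl //; last first.
  exact: integrable_bounded_mul bS (Kadj_integrable y i).
congr (_ * _); rewrite [in RHS]e Rintegral_mkcondr.
by apply: eq_Rintegral => r _; rewrite patchE indicE; case: ifP => _; rewrite ?mul1r ?mul0r.
Qed.

(** A primitive of an essentially bounded function is Lipschitz; the coordinatewise estimate brings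
    in the factor [d]. *)
Lemma dual_lip : exists2 C0 : R, 0 <= C0 & forall y s t, 0 <= s <= T -> 0 <= t <= T ->
  enorm (dual y s - dual y t) <= C0 * `|y| * `|s - t|.
Proof.
have [C hC] := Kadj_Linfty.
exists (d%:R * `|C|) => [|y s t]; first by rewrite mulr_ge0.
wlog st : s t / s <= t => [H hs ht|/andP[s0 sT] /andP[t0 tT]].
  have [st|/ltW ts] := leP s t; first exact: H.
  by rewrite enormBC distrC; exact: H.
rewrite enormBC distrC; apply: le_trans (enorm_le_sum _) _.
rewrite -!mulrA -[X in X%:R * _]card_ord mulr_natl -sumr_const.
apply: ler_sum => i _; rewrite primitive_increment ?s0 //.
have sub : `]s, t[%classic `<=` dom.
  by apply: subset_itv; rewrite bnd_simp.
have mS : @measurable _ RT (`]s, t[ : set R) by exact: measurable_itv.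
have iS : mu.-integrable `]s, t[ (EFin \o (fun r => Kadj y r 0 i)).
  exact: (integrableS md mS sub (Kadj_integrable y i)).
rewrite -lee_fin EFin_normr_Rintegral //.
have [mf _] := integrableP _ _ _ iS.
apply: le_trans (le_abse_integral mu mS mf) _.
apply: (@le_trans _ _ ((`|C| * `|y|)%:E * mu `]s, t[%classic)%E).
  apply: integral_le_bound => //.
  case: (hC y) => M [mM M0 subM]; exists M; split => // r h; apply: subM => h2.
  apply: h => Sr /=; rewrite lee_fin; apply: le_trans (coord_le_enorm _ _) _.
  apply: le_trans (h2 (sub _ Sr)) _; by rewrite ler_wpM2r ?ler_norm.
have e : mu `]s, t[%classic = if (s < t)%R then (t - s)%:E else 0%E.
  by rewrite [LHS]lebesgue_measure_itv /= lte_fin EFinB.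
rewrite [X in (_ * X <= _)%E]e (@ger0_norm _ (t - s)) ?subr_ge0 //.
case: ltP => [_|_]; rewrite ?mule0 -?EFinB -?EFinM lee_fin ?mulrA //.
by rewrite !mulr_ge0 // subr_ge0.
Qed.

End operators.

(** * Dropping atoms of zero magnitude *)

Section active_sets.
Context {R : realType} {d : nat} (T : R).
Local Notation atom := (R * 'rV[R]_d)%type.
Implicit Types (s A : seq (R * atom)) (J : seq atom) (m : seq R).

Lemma sum_active (V : lmodType R) s A (h : atom -> V) :
  (forall x, x \in s -> 0 <= x.1) -> perm_eq A [seq x <- s | 0 < x.1] ->
  \sum_(x <- A) x.1 *: h x.2 = \sum_(x <- s) x.1 *: h x.2.
Proof.
move=> s0 /(perm_big _) ->; rewrite big_filter big_mkcond /=.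
apply: eq_big_seq => x /s0; rewrite le_eqVlt => /orP[/eqP <-|-> //].
by rewrite ltxx scale0r.
Qed.

Lemma cumul_atomic s t : cumul (atomic s) t =
  \sum_(x <- s) x.1 *: ((\1_(`]0, t[%classic) x.2.1 : R) *: x.2.2).
Proof.
apply/rowP => i; rewrite mxE atomicE /=; last exact: measurable_itv.
rewrite summxE; apply: eq_bigr => x _; rewrite !mxE; ring.
Qed.

Lemma step_mean_active s A : (forall x, x \in s -> 0 <= x.1) ->
  perm_eq A [seq x <- s | 0 < x.1] -> step_mean T A = step_mean T s.
Proof.
move=> s0 As; rewrite /step_mean; congr (_ *: primitive _ _); apply/funext => t.
rewrite !cumul_atomic.
exact: (sum_active (fun a => (\1_(`]0, t[%classic) a.1 : R) *: a.2) s0 As).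
Qed.

Lemma zip_reweight m J (g : R * atom -> R) : size m = size J ->
  zip [seq g x | x <- zip m J] J = reweight g (zip m J).
Proof.
move=> mJ; rewrite /reweight -[X in zip _ X](@unzip2_zip _ _ m J) ?mJ //.
by rewrite /unzip2 zip_map.
Qed.

End active_sets.

(** * What a run of the algorithm guarantees *)

Section run.
Context {R : realType} {d : nat} (T : R).
Hypothesis T_gt0 : 0 < T.
Local Notation atom := (R * 'rV[R]_d)%type.
Local Notation dom := (dom T).
Context {Y : completeNormedModType R} {dot : Y -> Y -> R}.
Hypothesis dotP : hilbert_dot dot.
Context {K : (R -> 'rV[R]_d) -> Y}.
Hypothesis K_lin : continuous_linear_L2 T K.
Context {Kadj : Y -> R -> 'rV[R]_d}.
Hypothesis KadjP : is_adjoint T dot K Kadj.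
Hypothesis Kadj_Linfty : adjoint_bounded_Linfty T Kadj.
Context (F : Y -> R) (gradF : Y -> Y) {beta : R}.
Hypothesis beta_gt0 : 0 < beta.
Implicit Types (s A : seq (R * atom)) (J : seq atom) (m : seq R) (c : 'rV[R]_d).

Local Notation G := (@Kjump R d T Y K).
Local Notation E := (@Kconst R d Y K).
Local Notation cost := (@cost R d Y F beta G E).
Local Notation dualvar := (@dualvar R d Y gradF G E (@dual R d Y Kadj)).
Local Notation admissible := (admissible dom).

Lemma K_Bop s c : (forall x, x \in s -> dom x.2.1) ->
  K (Bop T (atomic s) c) = synth G E s (c - step_mean T s).
Proof.
move=> ds; rewrite -(K_step T_gt0 K_lin).
apply: (K_ext T_gt0 K_lin).
- move=> i; have [ms _] := bounded_measurable_step T s (c - step_mean T s) i.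
  apply: eq_measurable_fun ms => t; rewrite inE => dt.
  by rewrite Bop_atomic.
- exact: bounded_measurable_step.
- by apply: aeW => t dt; rewrite Bop_atomic.
Qed.

Lemma coef_objectiveE J m c : size m = size J -> (forall a, a \in J -> dom a.1) ->
  coef_objective T F K beta J m c = cost (zip m J) (c - step_mean T (zip m J)).
Proof.
move=> mJ dJ; rewrite /coef_objective K_Bop; last first.
  by move=> [x a] /= /(map_f snd) /=; rewrite -/unzip2 unzip2_zip ?mJ // => /dJ.
rewrite /cost /mass; congr (_ + _ * _).
by rewrite -[in LHS](@unzip1_zip _ _ m J) ?mJ // big_map.
Qed.

(** The coefficient problem is parametrized by the mean, [cost] by the constant of the step
    function. The two differ by [step_mean], which depends on the weights but is absorbed by the
    free choice of the mean. *)
Lemma coef_minimizer_cost J m c c' m' :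
  (forall a, a \in J -> dom a.1) -> coef_minimizer T F K beta J m c ->
  size m' = size J -> {in m', forall x, 0 <= x} ->
  cost (zip m J) (c - step_mean T (zip m J)) <= cost (zip m' J) c'.
Proof.
move=> dJ [mJ _ opt] m'J m'0.
have := opt m' (c' + step_mean T (zip m' J)) m'J m'0.
by rewrite !coef_objectiveE // addrK.
Qed.

Section resolved.
Variables (J : seq atom) (A : seq (R * atom)) (c : 'rV[R]_d).
Hypothesis jumpJ : forall a, a \in J -> is_jump T a.
Hypothesis resA : resolved T F K beta J A c.

Let domJ a : a \in J -> dom a.1. Proof. by move=> /jumpJ[]. Qed.

Lemma resolved_admissible : admissible A.
Proof.
have [m [[mJ _ _] /perm_mem Am]] := resA.
move=> x; rewrite Am mem_filter => /andP[x0 /(map_f snd)].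
by rewrite -/unzip2 unzip2_zip ?mJ // => /jumpJ[].
Qed.

Lemma resolved_optimal m' c' : size m' = size J -> {in m', forall x, 0 <= x} ->
  cost A (c - step_mean T A) <= cost (zip m' J) c'.
Proof.
have [m [mmin Am]] := resA; have [mJ m0 _] := mmin.
have z0 x : x \in zip m J -> 0 <= x.1.
  by move=> /(map_f fst); rewrite -/unzip1 unzip1_zip ?mJ // => /m0.
move=> m'J m'0; apply: le_trans (coef_minimizer_cost c' domJ mmin m'J m'0).
rewrite (step_mean_active T z0 Am) /cost /synth /mass.
rewrite (sum_active (fun a => G a.1 a.2) z0 Am).
have := sum_active (fun=> 1 : R^o) z0 Am.
rewrite (eq_bigr (fun x => x.1)) => [|x _]; last exact: mulr1.
by rewrite [RHS](eq_bigr (fun x => x.1)) => [->|x _]; last exact: mulr1.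
Qed.

(** Weights on the surviving atoms extend by zero to weights on all of [J], so optimality survives
    the removal of atoms. *)
Lemma resolved_reweight f c' : (forall x, x \in A -> 0 <= f x) ->
  cost A (c - step_mean T A) <= cost (reweight f A) c'.
Proof.
move=> f0; have [m [[mJ m0 _] Am]] := resA.
pose g (x : R * atom) := if 0 < x.1 then f x else 0.
have := @resolved_optimal [seq g x | x <- zip m J] c'.
rewrite zip_reweight // size_map size_zip mJ minnn => /(_ erefl).
have sumg (V : lmodType R) (h : atom -> V) :
    \sum_(x <- zip m J) g x *: h x.2 = \sum_(x <- A) f x *: h x.2.
  rewrite (perm_big _ Am) /= big_filter [RHS]big_mkcond /=; apply: eq_bigr => x _.
  by rewrite /g; case: ifP => // _; rewrite scale0r.
have -> : cost (reweight g (zip m J)) c' = cost (reweight f A) c'.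
  rewrite /cost /synth /mass !sum_reweight.
  rewrite (sumg _ (fun a => G a.1 a.2)).
  have := sumg R^o (fun=> 1); rewrite (eq_bigr g) => [|x _]; last exact: mulr1.
  by rewrite [RHS](eq_bigr f) => [->|x _]; last exact: mulr1.
apply=> _ /mapP[x xz ->]; rewrite /g; case: ifP => // x0.
by apply: f0; rewrite (perm_mem Am) mem_filter x0.
Qed.

End resolved.

Lemma resolved_rcons A A' a c' cs (f : R * atom -> R) (w : R) :
  (forall x, x \in A -> is_jump T x.2) -> is_jump T a ->
  resolved T F K beta (rcons [seq x.2 | x <- A] a) A' c' ->
  (forall x, x \in A -> 0 <= f x) -> 0 <= w ->
  cost A' (c' - step_mean T A') <= cost (rcons (reweight f A) (w, a)) cs.
Proof.
move=> jA ja res f0 w0.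
have jJ b : b \in rcons [seq x.2 | x <- A] a -> is_jump T b.
  by rewrite mem_rcons in_cons => /orP[/eqP -> //|/mapP[x xA ->]]; exact: jA.
have := @resolved_optimal _ _ _ jJ res (rcons (map f A) w) cs.
rewrite !size_rcons !size_map zip_rcons ?size_map // => /(_ erefl).
have -> : zip (map f A) [seq x.2 | x <- A] = reweight f A by rewrite zip_map.
apply=> x; rewrite mem_rcons in_cons => /orP[/eqP -> //|/mapP[y yA ->]]; exact: f0.
Qed.

Local Notation p := (@dual R d Y Kadj).

Lemma dual_le_Cnorm (y : Y) t : dom t -> enorm (p y t) <= Cnorm T (p y).
Proof.
have [C0 C00 lip] := dual_lip T_gt0 KadjP Kadj_Linfty.
move=> dt; apply: ub_le_sup; last by exists t.
exists (C0 * `|y| * T) => _ [r dr <-].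
have /andP[/ltW r0 /ltW rT] : 0 < r < T by move: dr; rewrite /Defs.dom /= in_itv.
have := lip y r 0; rewrite dual0 !subr0 r0 rT lexx ltW // => /(_ isT isT) /le_trans; apply.
by rewrite ler_wpM2l ?mulr_ge0 // ger0_norm.
Qed.

Variables (A : nat -> seq (R * atom)) (c : nat -> 'rV[R]_d) (that : nat -> R).
Hypothesis run : pdaj_run T F gradF K Kadj beta A c that.
Local Notation cs k := (c k - step_mean T (A k)).
Local Notation stops := (stops T gradF K Kadj beta A c).

Lemma iterate_dualE k : admissible (A k) ->
  iterate_dual T gradF K Kadj A c k = dualvar (A k) (cs k).
Proof.
by move=> adm; rewrite /iterate_dual /dual_variable /iterate K_Bop // => x /adm[].
Qed.

Let step_jump k : admissible (A k) -> pdaj_step T F gradF K Kadj beta A c that k ->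
  ~ stops k ->
  [/\ @peak R d T beta (dualvar (A k) (cs k)) (that k),
      is_jump T (that k, direction (dualvar (A k) (cs k)) (that k)) &
      resolved T F K beta (rcons [seq x.2 | x <- A k]
        (that k, direction (dualvar (A k) (cs k)) (that k))) (A k.+1) (c k.+1)].
Proof.
move=> adm; rewrite /pdaj_step /Defs.stops iterate_dualE // => -[dt et res] /negP.
rewrite -ltNge => ltb.
have pk : @peak R d T beta (dualvar (A k) (cs k)) (that k).
  by split; rewrite ?et // => t' dt'; exact: dual_le_Cnorm.
split=> //; first by split => //=; exact: direction1 beta_gt0 _ _ pk.
by rewrite /direction et.
Qed.

(** From index 1 on every iterate solves a coefficient problem; the initial active set is merely
    given. The induction also carries that the inserted vectors have unit length, which needs the
    preceding indices not to stop. *)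
Lemma run_resolved k : (0 < k)%N -> (forall l, (0 < l < k)%N -> ~ stops l) ->
  exists J, (forall a, a \in J -> is_jump T a) /\ resolved T F K beta J (A k) (c k).
Proof.
have [A0 res1 steps] := run.
elim: k => // -[|k] IH _ nst.
  by exists [seq x.2 | x <- A 0%N]; split => // _ /mapP[x /A0[_ jx] ->].
have [l /andP[l0 lk]|J [jJ res]] := IH isT; first by apply: nst; rewrite l0 ltnW.
have adm := resolved_admissible jJ res.
have nk : ~ stops k.+1 by apply: nst; rewrite ltnSn.
have [|_ ja res'] := step_jump adm (steps k.+1 isT _) nk; first exact: nst.
exists (rcons [seq x.2 | x <- A k.+1]
  (that k.+1, direction (dualvar (A k.+1) (cs k.+1)) (that k.+1))).
split=> // a; rewrite mem_rcons in_cons => /orP[/eqP -> //|/mapP[x /adm[_ dx v1] ->]].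
by split.
Qed.

Lemma run_admissible k : (0 < k)%N -> (forall l, (0 < l < k)%N -> ~ stops l) ->
  admissible (A k).
Proof.
by move=> k0 nst; have [J [jJ res]] := run_resolved k0 nst; exact: resolved_admissible res.
Qed.

Lemma run_reweight k f c' : (0 < k)%N -> (forall l, (0 < l < k)%N -> ~ stops l) ->
  (forall x, x \in A k -> 0 <= f x) ->
  cost (A k) (cs k) <= cost (reweight f (A k)) c'.
Proof.
by move=> k0 nst; have [J [jJ res]] := run_resolved k0 nst; exact: resolved_reweight res _ _.
Qed.

Lemma run_peak k : (0 < k)%N -> (forall l, (0 < l <= k)%N -> ~ stops l) ->
  @peak R d T beta (dualvar (A k) (cs k)) (that k).
Proof.
have [_ _ steps] := run => k0 nst.
have adm : admissible (A k).
  by apply: run_admissible => // l /andP[l0 lk]; apply: nst; rewrite l0 ltnW.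
by have [] := step_jump adm (steps k k0 nst) (nst k _) => //; rewrite k0 leqnn.
Qed.

Lemma run_improves k (f : R * atom -> R) (w : R) : (0 < k)%N ->
  (forall l, (0 < l <= k)%N -> ~ stops l) ->
  (forall x, x \in A k -> 0 <= f x) -> 0 <= w ->
  cost (A k.+1) (cs k.+1) <= cost (rcons (reweight f (A k))
    (w, (that k, direction (dualvar (A k) (cs k)) (that k)))) (cs k).
Proof.
have [_ _ steps] := run => k0 nst f0 w0.
have adm : admissible (A k).
  by apply: run_admissible => // l /andP[l0 lk]; apply: nst; rewrite l0 ltnW.
have [|_ ja res] := step_jump adm (steps k k0 nst) (nst k _); first by rewrite k0 leqnn.
by apply: resolved_rcons ja res f0 w0 => x /adm[_ dx v1]; split.
Qed.

End run.

(** * Functions with atomic derivative and Lipschitz members of the space of vanishing functions *)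

Section atomic_derivative.
Context {R : realType} {d : nat} (T : R).
Hypothesis T_gt0 : 0 < T.
Local Notation atom := (R * 'rV[R]_d)%type.
Local Notation RT := (measurableTypeR R).
Local Notation mu := (@lebesgue_measure R).
Local Notation dom := (dom T).
Implicit Types (s : seq (R * atom)) (u v : R -> 'rV[R]_d) (c : 'rV[R]_d).

Let md : @measurable _ RT dom. Proof. exact: measurable_itv. Qed.

(** [bv_deriv] is a choice among all derivatives. With one derivative in common the two functions
    have the same derivatives, so the choices coincide. *)
Lemma bv_deriv_eq u v q : distr_deriv T u q -> distr_deriv T v q ->
  bv_deriv T u = bv_deriv T v.
Proof.
move=> uq vq; rewrite /bv_deriv (_ : distr_deriv T u = distr_deriv T v) //.
apply/funext => q'; apply/propext; split => h psi psiP i.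
  by rewrite -h // uq // vq.
by rewrite -h // vq // uq.
Qed.

Lemma step_const s c t : step T s c t = step T s 0 t + c.
Proof. by apply/rowP => i; rewrite [RHS]mxE !stepE mxE addr0. Qed.

(** The difference from the step function has zero derivative in each coordinate, so
    [du_bois_reymond] applies. *)
Lemma ae_step_of_deriv u s : inL1 T u -> (forall x, x \in s -> dom x.2.1) ->
  distr_deriv T u (atomic s) -> exists c, ae_eq_on_dom T u (step T s c).
Proof.
move=> lu ds us.
have ss : distr_deriv T (step T s 0) (atomic s) by exact: distr_deriv_step ds _.
have is0 i : mu.-integrable dom (EFin \o (fun t => step T s 0 t 0 i)).
  exact: bounded_measurable_inL1 (bounded_measurable_step T s 0) i.
have ci i : exists c : R, {ae mu, forall t, dom t -> u t 0 i - step T s 0 t 0 i = c}.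
  apply: (@du_bois_reymond _ T) => //.
    exact: (integrableB md (lu i) (is0 i)).
  move=> psi psiP.
  have bp := test_derive_bounded_measurable T_gt0 psiP.
  have -> : (fun t => (u t 0 i - step T s 0 t 0 i) * derive1 psi t) =
     (fun t => u t 0 i * derive1 psi t - step T s 0 t 0 i * derive1 psi t).
    by apply/funext => t; rewrite mulrBl.
  rewrite RintegralB //; first by rewrite us // ss // subrr.
  - under [X in EFin \o X]funext do rewrite mulrC.
    exact: integrable_bounded_mul bp (lu i).
  - under [X in EFin \o X]funext do rewrite mulrC.
    exact: integrable_bounded_mul bp (is0 i).
have [c hc] := choice ci; exists (\row_i c i).
have := @filter_forall _ _ _ (almost_everywhere mu) _ hc.
case=> M [mM M0 sub]; exists M; split => // t h; apply: sub => /= h2.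
apply: h => dt; apply/rowP => i; rewrite step_const [RHS]mxE [X in _ + X]mxE.
by have /= <- := h2 i dt; rewrite addrC subrK.
Qed.

Lemma mx_norm_le_enorm (x : 'rV[R]_d) : `|x| <= enorm x.
Proof.
rewrite [leLHS]mx_normrE; apply: bigmax_le => [|[i j] _ /=]; first exact: enorm_ge0.
by rewrite ord1; exact: coord_le_enorm.
Qed.

Lemma measurable_enorm u : (forall i, measurable_fun dom (fun t => u t 0 i)) ->
  measurable_fun dom (fun t => enorm (u t)).
Proof.
move=> hu; apply: (measurableT_comp (f := @Num.sqrt R)).
  by apply: continuous_measurable_fun; exact: sqrt_continuous.
have -> : (fun t => edot (u t) (u t)) = (fun t => \sum_(i < d) u t 0 i * u t 0 i) by [].
by apply: measurable_sum => i; exact: (measurable_funM (hu i) (hu i)).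
Qed.

Lemma L1norm_ae u v : (forall i, measurable_fun dom (fun t => u t 0 i)) ->
  (forall i, measurable_fun dom (fun t => v t 0 i)) ->
  ae_eq_on_dom T u v -> L1norm T u = L1norm T v.
Proof.
move=> mu_ mv uv; congr fine; apply: ae_eq_integral => //.
- by apply/measurable_EFinP; exact: measurable_enorm.
- by apply/measurable_EFinP; exact: measurable_enorm.
- case: uv => M [mM M0 sub]; exists M; split => // t h; apply: sub => /= h2.
  by apply: h => dt /=; rewrite h2.
Qed.

Lemma inC0_lipschitz u (C : R) : (forall s t : R, 0 <= s <= T -> 0 <= t <= T ->
    enorm (u s - u t) <= C * `|s - t|) -> u 0 = 0 -> u T = 0 -> inC0 T u.
Proof.
move=> lip u0 uT; pose D := `|C| + 1; have D0 : 0 < D by rewrite ltr_wpDl.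
have near_le (s e : R) : 0 <= s <= T -> 0 < e ->
    \forall t \near s, 0 <= t <= T -> `|u s - u t| <= e.
  move=> hs e0; have eD : 0 < e / D by rewrite divr_gt0.
  have close : \forall t \near s, `|s - t| <= e / D.
    by have /cvgrPdist_le/(_ _ eD) := @cvg_id _ (nbhs s).
  near=> t => ht; apply: le_trans (mx_norm_le_enorm _) _.
  apply: le_trans (lip _ _ hs ht) _; apply: (@le_trans _ _ (D * `|s - t|)).
    by rewrite ler_wpM2r // (le_trans (ler_norm _)) // lerDl.
  rewrite mulrC -ler_pdivlMr //; near: t; exact: close.
have T0 : (0 : R) <= 0 <= T by rewrite lexx ltW.
have TT : 0 <= T <= T by rewrite lexx ltW.
split.
- move=> t; rewrite /Defs.dom /= in_itv /= => /andP[t0 tT].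
  have ht : 0 <= t <= T by rewrite !ltW.
  apply/cvgrPdist_le => e e0; near=> r; have : 0 <= r <= T.
    by apply/andP; split; apply: ltW; near: r; [exact: lt_nbhsr|exact: lt_nbhsl].
  by near: r; exact: near_le.
- rewrite -u0; apply/cvgrPdist_le => e e0; near=> r.
  have : 0 <= r <= T.
    by apply/andP; split; near: r; [exact: nbhs_right_ge|exact: nbhs_right_le].
  near: r; apply: cvg_within; exact: near_le.
- rewrite -uT; apply/cvgrPdist_le => e e0; near=> r.
  have : 0 <= r <= T.
    by apply/andP; split; near: r; [exact: nbhs_left_ge|exact: nbhs_left_le].
  near: r; apply: cvg_within; exact: near_le.
Unshelve. all: by end_near. Qed.

End atomic_derivative.

(** * The minimizer and the transfer of rates from the excess *)

Section optimum.
Context {R : realType} {d : nat} {T : R}.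
Hypothesis T_gt0 : 0 < T.
Local Notation atom := (R * 'rV[R]_d)%type.
Local Notation mu := (@lebesgue_measure R).
Local Notation dom := (dom T).
Context {Y : completeNormedModType R} {dot : Y -> Y -> R}.
Hypothesis dotP : hilbert_dot dot.
Context {K : (R -> 'rV[R]_d) -> Y}.
Hypothesis K_lin : continuous_linear_L2 T K.
Context {Kadj : Y -> R -> 'rV[R]_d}.
Hypothesis KadjP : is_adjoint T dot K Kadj.
Hypothesis Kadj_Linfty : adjoint_bounded_Linfty T Kadj.
Context {F : Y -> R} {gradF : Y -> Y}.
Hypotheses (F_conv : strictly_convex F) (F_C1 : C1_with_gradient dot F gradF).
Context {L : R}.
Hypothesis gradF_lip : forall y z, `|gradF y - gradF z| <= L * `|y - z|.
Context {beta : R}.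
Hypothesis beta_gt0 : 0 < beta.
Context {ubar : R -> 'rV[R]_d}.
Hypothesis ubar_min : minimizer T F K beta ubar.
Local Notation pbar := (dual_variable gradF K Kadj ubar).
Context {N : nat} {tbar : 'I_N -> R} {mubar : 'I_N -> R}.
Hypothesis N_gt0 : (0 < N)%N.
Hypothesis tbarP : range tbar =
  [set t | [/\ dom t, enorm (pbar t) = Cnorm T pbar & Cnorm T pbar = beta]].
Hypothesis mubar_gt0 : forall i, 0 < mubar i.
Local Notation vbar := (fun i => beta^-1 *: pbar (tbar i)).
Local Notation sbar := [seq (mubar i, (tbar i, vbar i)) | i <- enum 'I_N].
Hypothesis ubar_deriv : distr_deriv T ubar (atomic sbar).
Implicit Types (s : seq (R * atom)) (c : 'rV[R]_d).

Local Notation G := (@Kjump R d T Y K).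
Local Notation E := (@Kconst R d Y K).
Local Notation p := (@dual R d Y Kadj).
Local Notation cost := (@cost R d Y F beta G E).
Local Notation dualvar := (@dualvar R d Y gradF G E p).
Local Notation admissible := (admissible dom).

Lemma tbar_peak i :
  [/\ dom (tbar i), enorm (pbar (tbar i)) = beta & Cnorm T pbar = beta].
Proof.
have : range tbar (tbar i) by exists i.
by rewrite tbarP => -[h1 h2 h3]; rewrite h2 h3.
Qed.

Lemma vbar1 i : enorm (vbar i) = 1.
Proof.
have [_ h _] := tbar_peak i.
by rewrite enormZ h gtr0_norm ?invr_gt0 // mulVf // gt_eqF.
Qed.

Lemma sum_sbar (V : nmodType) (h : R * atom -> V) :
  \sum_(x <- sbar) h x = \sum_i h (mubar i, (tbar i, vbar i)).
Proof. by rewrite big_map big_enum. Qed.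

Lemma sbar_admissible : admissible sbar.
Proof.
move=> _ /mapP[i _ ->]; split => //=; last exact: vbar1.
by have [] := tbar_peak i.
Qed.

Let dsbar x : x \in sbar -> dom x.2.1. Proof. by case/sbar_admissible. Qed.

Lemma ubar_step : exists c, ae_eq_on_dom T ubar (step T sbar c).
Proof. by have [[lu _] _] := ubar_min; exact: (ae_step_of_deriv T_gt0). Qed.

Lemma measurable_ubar i : measurable_fun dom (fun t => ubar t 0 i).
Proof.
have [[/(_ i) iu _] _] := ubar_min; have [mf _] := integrableP _ _ _ iu.
exact/measurable_EFinP.
Qed.

Lemma inBV_step s c u : (forall x, x \in s -> dom x.2.1) ->
  (forall t, dom t -> u t = step T s c t) -> inBV T u.
Proof.
move=> ds us; split; last by exists (atomic s); exact: distr_deriv_step ds us.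
move=> i; have := bounded_measurable_inL1 T_gt0 (bounded_measurable_step T s c) i.
apply: eq_integrable => // [|t]; first exact: measurable_itv.
by rewrite inE => dt /=; rewrite us.
Qed.

Context {cbar : 'rV[R]_d}.
Hypothesis cbarP : ae_eq_on_dom T ubar (step T sbar cbar).
Let ybar := \sum_i mubar i *: G (tbar i) (vbar i) + E cbar.

Lemma synth_sbar (V : lmodType R) (g : R -> 'rV[R]_d -> V) (e : 'rV[R]_d -> V) c :
  synth g e sbar c = \sum_i mubar i *: g (tbar i) (vbar i) + e c.
Proof. by rewrite /synth sum_sbar. Qed.

Lemma K_ubar : K ubar = ybar.
Proof.
rewrite (K_ext T_gt0 K_lin measurable_ubar (bounded_measurable_step T _ _) cbarP).
by rewrite K_step // synth_sbar.
Qed.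

Lemma bv_deriv_ubar c : bv_deriv T ubar = bv_deriv T (step T sbar c).
Proof. by apply: bv_deriv_eq ubar_deriv _; exact: distr_deriv_step dsbar _. Qed.

Lemma pbarE : pbar = p (gradF ybar).
Proof. by rewrite /dual_variable K_ubar. Qed.

(** Adding a constant to ubar leaves its derivative unchanged, so optimality reduces to the
    first-order condition for the F term in the constant. *)
Lemma pbar_T : pbar T = 0.
Proof.
rewrite pbarE.
have := @optimal_mean _ _ T _ _ dotP _ _ F_conv F_C1 _ gradF_lip beta G E p
  (KconstB T_gt0 K_lin) (KconstZ T_gt0 K_lin) (dot_Kconst T_gt0 KadjP) sbar cbar.
rewrite /dualvar synth_sbar; apply => c'.
rewrite /cost !synth_sbar lerD2r -/ybar -K_ubar.
have [_ /(_ (step T sbar c'))] := ubar_min.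
rewrite /objective -bv_deriv_ubar lerD2r K_step // synth_sbar; apply.
exact: inBV_step dsbar _.
Qed.

Lemma dual_variable_lip : exists C : R, forall s t : R, 0 <= s <= T -> 0 <= t <= T ->
  enorm (pbar s - pbar t) <= C * `|s - t|.
Proof.
have [C0 _ lip] := dual_lip T_gt0 KadjP Kadj_Linfty.
by exists (C0 * `|gradF (K ubar)|) => s t hs ht; exact: lip.
Qed.

Lemma inC0_pbar (a : R) : inC0 T (fun t => a *: pbar t).
Proof.
have [C lip] := dual_variable_lip.
apply: (@inC0_lipschitz _ _ _ T_gt0 _ (`|a| * C)).
- by move=> s t hs ht; rewrite -scalerBr enormZ -mulrA ler_wpM2l // lip.
- by rewrite [pbar 0]dual0 scaler0.
- by rewrite pbar_T scaler0.
Qed.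

Lemma dual_variable_le t : dom t -> enorm (pbar t) <= beta.
Proof.
move=> dt; have [_ _ <-] := tbar_peak (Ordinal N_gt0).
exact: (dual_le_Cnorm T_gt0 KadjP Kadj_Linfty).
Qed.

(** The test field pbar / beta vanishes at both ends, has norm at most 1 and equals [vbar i] at
    [tbar i], so it attains the total mass. *)
Lemma Mnorm_ubar : Mnorm T (bv_deriv T ubar) = \sum_i mubar i.
Proof.
apply/eqP; rewrite eq_le; apply/andP; split.
  have := Mnorm_le_mass T_gt0 ubar_deriv sbar_admissible.
  by rewrite /mass sum_sbar.
have := @pairing_le_Mnorm _ _ _ _ _ ubar_deriv sbar_admissible
  (fun t => beta^-1 *: pbar t) (inC0_pbar _).
rewrite sum_sbar /=.
have -> : \sum_i mubar i * edot (beta^-1 *: pbar (tbar i)) (vbar i) = \sum_i mubar i.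
  by apply: eq_bigr => i _; rewrite -sqr_enorm vbar1 expr1n mulr1.
apply; apply: ge_sup => [|_ [t dt <-]].
  have [dt _ _] := tbar_peak (Ordinal N_gt0).
  by exists (enorm (beta^-1 *: pbar (tbar (Ordinal N_gt0)))); exists (tbar (Ordinal N_gt0)).
rewrite enormZ gtr0_norm ?invr_gt0 // mulrC ler_pdivrMr // mul1r.
exact: dual_variable_le.
Qed.

Lemma objective_ubar : objective T F K beta ubar = F ybar + beta * \sum_i mubar i.
Proof. by rewrite /objective Mnorm_ubar K_ubar. Qed.

Lemma residualE w : residual T F K beta w = objective T F K beta w - objective T F K beta ubar.
Proof.
have [bv mn] := ubar_min; congr (_ - _); apply/eqP; rewrite eq_le; apply/andP; split.
  apply: ge_inf; last by exists ubar.
  by exists (objective T F K beta ubar) => _ [v hv <-]; exact: mn.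
apply: lb_le_inf; first by exists (objective T F K beta ubar); exists ubar.
by move=> _ [v hv <-]; exact: mn.
Qed.

Local Notation excess := (@excess R d Y F beta G E N tbar vbar mubar cbar).

Section iterates.
Variables (s : seq (R * atom)) (c : 'rV[R]_d) (u : R -> 'rV[R]_d).
Hypotheses (hs : admissible s) (us : forall t, dom t -> u t = step T s c t).

Let ds x : x \in s -> dom x.2.1. Proof. by case/hs. Qed.

Lemma measurable_iterate i : measurable_fun dom (fun t => u t 0 i).
Proof.
have [ms _] := bounded_measurable_step T s c i.
by apply: eq_measurable_fun ms => t; rewrite inE => /us ->.
Qed.

Lemma K_iterate : K u = synth G E s c.
Proof.
rewrite -(K_step T_gt0 K_lin) (K_ext T_gt0 K_lin measurable_iterate (bounded_measurable_step T s c)) //.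
exact: aeW.
Qed.

(** An inequality rather than an equality: atoms at the same position may partly cancel, so the
    total variation can be smaller than the mass. *)
Lemma residual_le_excess : 0 <= residual T F K beta u <= excess s c.
Proof.
have bv : inBV T u by exact: inBV_step ds us.
rewrite residualE; apply/andP; split; first by have [_ mn] := ubar_min; rewrite subr_ge0 mn.
rewrite objective_ubar /excess lerD2r /objective K_iterate lerD2l ler_wpM2l ?(ltW beta_gt0) //.
by apply: Mnorm_le_mass => //; exact: distr_deriv_step ds us.
Qed.

Lemma L1norm_iterate : L1norm T (fun t => u t - ubar t) =
  L1norm T (step T s c - step T sbar cbar).
Proof.
apply: L1norm_ae.
- move=> i; have := measurable_funB (measurable_iterate i) (measurable_ubar i).
  by congr measurable_fun; apply/funext => t; rewrite /= !mxE.
- move=> i; have [m1 _] := bounded_measurable_rowB (bounded_measurable_step T s c)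
    (bounded_measurable_step T sbar cbar) i.
  exact: m1.
- case: cbarP => M [mM M0 sub]; exists M; split => // t h; apply: sub => /= h2.
  by apply: h => dt; rewrite us // h2.
Qed.

Lemma L1norm_le_offsets rad : L1norm T (fun t => u t - ubar t) <=
  (1 + T) * (spread tbar vbar rad s + discrepancy tbar rad mubar cbar s c).
Proof.
rewrite L1norm_iterate /step synth_sbar.
apply: (@seminorm_synthB _ _ _ tbar vbar rad _ (jump_fun T) (@const_fun R d) mubar cbar _
  (@bounded_measurable_row R d T) (@L1norm R d T) (1 + T) _ _ _ _ _ _ dom) => //.
- exact: bounded_measurable_row0.
- exact: bounded_measurable_rowD.
- by move=> a v; exact: bounded_measurable_rowZ.
- exact: L1norm0.
- by move=> v w; exact: L1normD.
- by move=> a v; exact: L1normZ.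
- by move=> t v _; exact: bounded_measurable_jump.
- by move=> v; exact: bounded_measurable_const.
- by move=> t v _; exact: L1norm_jump.
- by move=> v; exact: L1norm_const.
- by move=> t t' v v' dt dt' v1; exact: L1norm_jumpB.
- by move=> i; have [] := tbar_peak i.
- exact: vbar1.
Qed.

End iterates.

Context {sigma rad theta0 gamma0 : R}.
Hypotheses (sigma_gt0 : 0 < sigma) (theta0_gt0 : 0 < theta0)
  (gamma0_gt0 : 0 < gamma0) (L_gt0 : 0 < L).
Hypothesis F_growth : \forall y \near K ubar,
  F y >= F (K ubar) + dot (gradF (K ubar)) (y - K ubar)
         + gamma0 * `|y - K ubar| ^+ 2.
Hypothesis indep : forall (a : 'I_N -> R) (b : 'I_d -> R),
  \sum_(i < N) a i *: K (fun t => \1_(`]tbar i, T[%classic) t *: pbar (tbar i))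
  + \sum_(i < d) b i *: K (fun=> delta_mx 0 i) = 0 ->
  (forall i, a i = 0) /\ (forall i, b i = 0).
Hypothesis pbar_far : forall t, 0 <= t <= T ->
  (forall i, ~ `]tbar i - rad, tbar i + rad[%classic t) ->
  enorm (pbar t) <= beta - sigma.
Hypothesis pbar_growth : forall i t, `]tbar i - rad, tbar i + rad[%classic t ->
  theta0 * `|t - tbar i| ^+ 2 <= beta - enorm (pbar t).

Let domtb i : dom (tbar i). Proof. by have [] := tbar_peak i. Qed.

Let near_fact t i : dom t -> nearest tbar rad t = Some i ->
  theta0 * `|t - tbar i| ^+ 2 <= beta - enorm (p (gradF ybar) t).
Proof.
rewrite -pbarE /nearest => _; case: pickP => // j h [<-].
by apply: pbar_growth; rewrite /= in_itv /= -ltr_distl.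
Qed.

Let far_fact t : dom t -> nearest tbar rad t = None ->
  enorm (p (gradF ybar) t) <= beta - sigma.
Proof.
rewrite -pbarE /nearest => dt; case: pickP => // h _.
apply: pbar_far => [|i]; last by rewrite /= in_itv /= -ltr_distl h.
by move: dt; rewrite /Defs.dom /= in_itv /= => /andP[/ltW -> /ltW ->].
Qed.

Let growth_fact : \forall y \near ybar,
  F y >= F ybar + dot (gradF ybar) (y - ybar) + gamma0 * `|y - ybar| ^+ 2.
Proof. by have := F_growth; rewrite K_ubar. Qed.

Let pbar_tbar i : p (gradF ybar) (tbar i) = beta *: vbar i.
Proof. by rewrite -pbarE scalerA divff ?gt_eqF // scale1r. Qed.

Let pbarT : p (gradF ybar) T = 0. Proof. by rewrite -pbarE pbar_T. Qed.

Lemma Kconst_sum (b : 'rV[R]_d) : E b = \sum_i b 0 i *: E (delta_mx 0 i).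
Proof.
have ED : {morph E : x y / x + y}.
  move=> x y; apply: (KD T_gt0 K_lin (u := const_fun x) (v := const_fun y));
  exact: bounded_measurable_const.
have E0 : E 0 = 0 by rewrite -[X in E X](scale0r 0) (KconstZ T_gt0 K_lin) scale0r.
rewrite {1}[b]row_sum_delta (big_morph E ED E0); apply: eq_bigr => i _.
exact: (KconstZ T_gt0 K_lin).
Qed.

Let indep_fact (a : 'I_N -> R) (b : 'rV[R]_d) :
  \sum_i a i *: G (tbar i) (vbar i) + E b = 0 -> (forall i, a i = 0) /\ b = 0.
Proof.
rewrite Kconst_sum => h.
have [|ha hb] := indep (a := fun i => a i * beta^-1) (b := fun i => b 0 i).
  rewrite -{}[RHS]h; congr (_ + _); apply: eq_bigr => i _.
  by rewrite /= (KjumpZ T_gt0 K_lin) scalerA.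
split=> [i|]; last by apply/rowP => i; rewrite hb mxE.
by have /eqP := ha i; rewrite mulf_eq0 invr_eq0 (gt_eqF beta_gt0) orbF => /eqP.
Qed.

Let bounds (M : R) : 0 <= M -> exists2 C : R, 0 < C &
  forall s c, admissible s -> excess s c <= M ->
  [/\ mass s <= C, `|synth G E s c - ybar| ^+ 2 <= C * excess s c,
      spread tbar vbar rad s ^+ 2 <= C * excess s c &
      discrepancy tbar rad mubar cbar s c ^+ 2 <= C * excess s c].
Proof.
have [C0 C00 lip] := dual_lip T_gt0 KadjP Kadj_Linfty.
exact: (excess_bounds dotP F_conv F_C1 beta_gt0 (KjumpB T_gt0 K_lin)
  (KconstB T_gt0 K_lin) (KconstZ T_gt0 K_lin) (dot_Kconst T_gt0 KadjP)
  (@dot_Kjump _ _ _ T_gt0 _ _ _ _ KadjP) C00 lip T_gt0 domtb vbar1 mubar_gt0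
  sigma_gt0 theta0_gt0 gamma0_gt0 pbarT pbar_tbar near_fact far_fact
  growth_fact indep_fact).
Qed.

Lemma residue_eq0 (V : lmodType R) (g : R -> 'rV[R]_d -> V) s : admissible s ->
  spread tbar vbar rad s = 0 -> residue tbar vbar rad g s = 0.
Proof.
move=> hs /eqP; rewrite /spread big_seq psumr_eq0; last first.
  by move=> x /hs[x0 _ _]; rewrite mulr_ge0 ?offset_ge0 // ltW.
move=> /allP h; rewrite /residue big_seq big1 // => x xs.
have := h x xs; rewrite xs /= mulf_eq0 => /orP[/eqP x0|].
  by have [] := hs x xs; rewrite x0 ltxx.
rewrite /offset; case: nearest => [i|]; last by rewrite oner_eq0.
rewrite paddr_eq0 ?enorm_ge0 // normr_eq0 subr_eq0 => /andP[/eqP -> /eqP/enorm_eq0/eqP].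
by rewrite subr_eq0 => /eqP ->; rewrite subrr scaler0.
Qed.

(** [gap] with [Pn = beta] makes the excess nonpositive, and [excess_bounds] at level 0 makes
    [spread] and [discrepancy] vanish: every atom is an optimal jump, and the lumped masses and the
    constant are the optimal ones. *)
Lemma stop_optimal s c u : admissible s -> (forall t, dom t -> u t = step T s c t) ->
  @stationary R d T Y gradF beta G E p s c ->
  (forall t, dom t -> enorm (dualvar s c t) <= beta) -> ae_eq_on_dom T u ubar.
Proof.
move=> hs us st le_beta.
have e0 : excess s c <= 0.
  have := gap dotP F_conv F_C1 (dot_Kconst T_gt0 KadjP)
    (@dot_Kjump _ _ _ T_gt0 _ _ _ _ KadjP) cbar domtb vbar1 mubar_gt0 hs st le_beta.
  by rewrite subrr mulr0.
have [C C0 /(_ s c hs e0)[_ _ s2 d2]] := bounds (lexx 0).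
have Ce0 : C * excess s c <= 0 by rewrite pmulr_rle0.
have eq0 x : x ^+ 2 <= C * excess s c -> x = 0.
  by move=> /le_trans/(_ Ce0); rewrite real_exprn_even_le0 ?num_real //= => /eqP.
have sp0 := eq0 _ s2; have := eq0 _ d2; rewrite /discrepancy => /eqP.
rewrite paddr_eq0 ?enorm_ge0 ?sumr_ge0 // => /andP[/eqP l0 /eqP/enorm_eq0 c0].
have lump0 i : lump tbar rad s i - mubar i = 0.
  by apply/eqP; rewrite -normr_eq0; apply/eqP; exact: (psumr_eq0P _ l0).
have : step T s c = step T sbar cbar.
  apply/eqP; rewrite -subr_eq0 [step T sbar _]synth_sbar.
  rewrite (synthB tbar vbar rad (jump_fun T) mubar cbar) //.
  rewrite (residue_eq0 _ hs sp0) add0r c0 big1 ?add0r // => i _.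
  by rewrite lump0 scale0r.
move=> e; case: cbarP => M [mM M0 sub]; exists M; split => // t h; apply: sub => /= h2.
by apply: h => dt; rewrite us // e h2.
Qed.

Lemma le_of_sqr (x y : R) : 0 <= y -> x ^+ 2 <= y ^+ 2 -> x <= y.
Proof. by move=> y0 h; case: (leP x y) => // lt; move: h; nra. Qed.

(** The excess converges at rate [z], and all errors are bounded by the excess or by its square
    root. *)
Lemma linear_rate (A : nat -> seq (R * atom)) (cs : nat -> 'rV[R]_d) (th : nat -> R)
    (u : nat -> R -> 'rV[R]_d) :
  (forall k, admissible (A k)) ->
  (forall k t, dom t -> u k t = step T (A k) (cs k) t) ->
  (forall k, @stationary R d T Y gradF beta G E p (A k) (cs k)) ->
  (forall k, @peak R d T beta (dualvar (A k) (cs k)) (th k)) ->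
  (forall k (f : R * atom -> R) (w : R), (forall x, x \in A k -> 0 <= f x) -> 0 <= w ->
    cost (A k.+1) (cs k.+1) <= cost (rcons (reweight f (A k))
      (w, (th k, direction (dualvar (A k) (cs k)) (th k)))) (cs k)) ->
  exists zeta C : R, [/\ 0 < zeta < 1, 0 < C & forall k,
    residual T F K beta (u k) + L1norm T (fun t => u k t - ubar t)
    + `|Mnorm T (bv_deriv T (u k)) - Mnorm T (bv_deriv T ubar)| <= C * zeta ^+ k].
Proof.
move=> hA hu hS hP hI.
have [C0 C00 lip] := dual_lip T_gt0 KadjP Kadj_Linfty.
have [z [C1 [/andP[z0 z1] C10 rate]]] := geometric_convergence dotP F_conv F_C1
  L_gt0 gradF_lip beta_gt0 (KjumpB T_gt0 K_lin)
  (KconstB T_gt0 K_lin) (KconstZ T_gt0 K_lin) (dot_Kconst T_gt0 KadjP)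
  (@dot_Kjump _ _ _ T_gt0 _ _ _ _ KadjP) C00 lip (fun y => dual0 y) T_gt0 domtb vbar1 mubar_gt0
  sigma_gt0 theta0_gt0 gamma0_gt0 pbarT pbar_tbar near_fact far_fact
  growth_fact indep_fact hA hS hP
  (fun k f w f0 w0 => lerB (hI k f w f0 w0) (lexx _)).
have [C C_0 hC] := bounds (ltW C10).
(* [excess_bounds] controls squares, so [spread], [discrepancy] and the observation error are at
   most [S * zeta ^+ k]. *)
pose zeta := Num.sqrt z; pose S := Num.sqrt (C * C1).
have S2 : S ^+ 2 = C * C1 by rewrite sqr_sqrtr // mulr_ge0 // ltW.
have S0 : 0 <= S by exact: sqrtr_ge0.
have zeta0 : 0 < zeta by rewrite sqrtr_gt0.
have zeta1 : zeta < 1 by rewrite -sqrtr1 ltr_sqrt // ltr01.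
pose g := `|gradF ybar|; have g0 : 0 <= g by exact: normr_ge0.
pose Q := g * S + L * S ^+ 2.
have Q0 : 0 <= Q by rewrite addr_ge0 ?mulr_ge0 ?sqr_ge0 // ltW.
exists zeta, (C1 + (1 + T) * (S + S) + beta^-1 * (C1 + Q)); split.
- by rewrite zeta0.
- have S20 : 0 <= (1 + T) * (S + S) by rewrite mulr_ge0 ?addr_ge0 ?(ltW T_gt0).
  have CQ0 : 0 <= beta^-1 * (C1 + Q).
    by rewrite mulr_ge0 ?invr_ge0 ?(ltW beta_gt0) // addr_ge0 // ltW.
  by rewrite -addrA ltr_wpDr // addr_ge0.
move=> k; pose w := zeta ^+ k.
have w0 : 0 <= w by rewrite exprn_ge0 // ltW.
have w1 : w <= 1 by rewrite exprn_ile1 // ltW.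
have w2 : w ^+ 2 = z ^+ k by rewrite -exprM mulnC exprM sqr_sqrtr // ltW.
have w2w : w ^+ 2 <= w by rewrite expr2 -[leRHS]mulr1 ler_wpM2l.
have ek : excess (A k) (cs k) <= C1 * w ^+ 2 by rewrite w2; exact: rate.
have eM : excess (A k) (cs k) <= C1.
  by apply: le_trans ek _; rewrite ger_pMr // (le_trans w2w).
have [_ y2 s2 d2] := hC _ _ (hA k) eM.
have leS x : x ^+ 2 <= C * excess (A k) (cs k) -> x <= S * w.
  move=> h; apply: le_of_sqr; first by rewrite mulr_ge0.
  by rewrite exprMn S2; apply: le_trans h _; rewrite -mulrA ler_wpM2l // ltW.
have hs := leS _ s2; have hd := leS _ d2; have hy := leS _ y2.
have /andP[r0 re] := residual_le_excess (hA k) (hu k).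
have rw : residual T F K beta (u k) <= C1 * w.
  by apply: le_trans re (le_trans ek _); rewrite ler_wpM2l // ltW.
have l1 : L1norm T (fun t => u k t - ubar t) <= (1 + T) * (S + S) * w.
  apply: le_trans (L1norm_le_offsets (hA k) (hu k) rad) _.
  rewrite -mulrA ler_wpM2l ?addr_ge0 ?(ltW T_gt0) // mulrDl.
  exact: lerD hs hd.
(* [convex_tangent] bounds the difference from below and [descent_le] from above; the linear term is
   of the order of the observation error. *)
have dF : `|F (K (u k)) - F ybar| <= Q * w.
  rewrite (K_iterate (hu k)); set y := synth _ _ _ _ in y2 hy *.
  have lo := convex_tangent dotP F_conv F_C1 ybar y.
  have up := descent_le dotP F_conv F_C1 gradF_lip ybar (y - ybar).
  rewrite (addrC ybar) subrK in up.
  have dl := dot_le dotP (gradF ybar) (y - ybar).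
  have n0 := normr_ge0 (y - ybar).
  have gn : g * `|y - ybar| <= g * (S * w) by rewrite ler_wpM2l.
  have ln : L * `|y - ybar| ^+ 2 <= L * (S ^+ 2 * w).
    rewrite ler_wpM2l ?(ltW L_gt0) //; apply: (@le_trans _ _ ((S * w) ^+ 2)).
      by rewrite ler_sqr ?nnegrE // mulr_ge0.
    by rewrite exprMn ler_wpM2l // sqr_ge0.
  move: dl; rewrite ler_norml => /andP[dl1 dl2].
  rewrite ler_norml /Q; apply/andP; split.
    have : 0 <= L * (S ^+ 2 * w) by rewrite !mulr_ge0 ?sqr_ge0 // ltW.
    move: lo dl1 gn; rewrite -/g; lra.
  move: up dl2 gn ln; rewrite -/g; lra.
have dM : `|Mnorm T (bv_deriv T (u k)) - Mnorm T (bv_deriv T ubar)| <=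
    beta^-1 * (C1 + Q) * w.
  rewrite -mulrA mulrC ler_pdivlMr // -[X in _ * X]gtr0_norm // -normrM.
  (* The total variation is the part of the objective left after the F term, so its error follows
     from those of the objective and of F. *)
  have -> : (Mnorm T (bv_deriv T (u k)) - Mnorm T (bv_deriv T ubar)) * beta =
      residual T F K beta (u k) - (F (K (u k)) - F ybar).
    by rewrite residualE objective_ubar /objective Mnorm_ubar; ring.
  apply: le_trans (ler_normB _ _) _; rewrite mulrDl.
  by rewrite lerD // ger0_norm.
by apply: le_trans (lerD (lerD rw l1) dM) _; rewrite -!mulrDl.
Qed.

End optimum.

(** * Assembly: the stopped run and the infinite run *)

Theorem theorem14
  (R : realType) (d : nat) (d_gt0 : (0 < d)%N) (T : R) (T_gt0 : 0 < T)
  (* the problem *)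
  (Y : completeNormedModType R) (dot : Y -> Y -> R) (dotP : hilbert_dot dot)
  (K : (R -> 'rV[R]_d) -> Y) (K_lin : continuous_linear_L2 T K)
  (Kadj : Y -> R -> 'rV[R]_d) (KadjP : is_adjoint T dot K Kadj)
  (F : Y -> R) (F_conv : strictly_convex F)
  (gradF : Y -> Y) (F_C1 : C1_with_gradient dot F gradF)
  (beta : R) (beta_gt0 : 0 < beta)
  (j_unbounded : radially_unbounded T F K beta)
  (ubar : R -> 'rV[R]_d) (ubar_min : minimizer T F K beta ubar)
  (* assumptions on F *)
  (L : R) (L_gt0 : 0 < L)
  (gradF_lip : forall y z, `|gradF y - gradF z| <= L * `|y - z|)
  (gamma0 : R) (gamma0_gt0 : 0 < gamma0)
  (F_growth : \forall y \near K ubar,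
     F y >= F (K ubar) + dot (gradF (K ubar)) (y - K ubar)
            + gamma0 * `|y - K ubar| ^+ 2)
  (* structural assumption (i) *)
  (N : nat) (N_gt0 : (0 < N)%N) (tbar : 'I_N -> R)
  (tbarP : let pbar := dual_variable gradF K Kadj ubar in
     range tbar = [set t | [/\ dom T t, enorm (pbar t) = Cnorm T pbar
                             & Cnorm T pbar = beta]])
  (* structural assumption (ii) *)
  (indep : let pbar := dual_variable gradF K Kadj ubar in
     forall (a : 'I_N -> R) (b : 'I_d -> R),
       \sum_(i < N) a i *:
          K (fun t => \1_(`]tbar i, T[%classic) t *: pbar (tbar i))
       + \sum_(i < d) b i *: K (fun=> delta_mx 0 i) = 0 ->
       (forall i, a i = 0) /\ (forall i, b i = 0))
  (mubar : 'I_N -> R)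
  (ubar_deriv : let pbar := dual_variable gradF K Kadj ubar in
     distr_deriv T ubar
       (atomic [seq (mubar i, (tbar i, beta^-1 *: pbar (tbar i)))
               | i <- enum 'I_N]))
  (sigma rad : R) (sigma_gt0 : 0 < sigma) (rad_gt0 : 0 < rad)
  (balls_sub : forall i, `]tbar i - rad, tbar i + rad[ `<=` dom T)
  (balls_disj : forall i j, i <> j ->
     `]tbar i - rad, tbar i + rad[ `&` `]tbar j - rad, tbar j + rad[ = set0)
  (pbar_far : let pbar := dual_variable gradF K Kadj ubar in
     forall t, 0 <= t <= T ->
       (forall i, ~ `]tbar i - rad, tbar i + rad[%classic t) ->
       enorm (pbar t) <= beta - sigma)
  (* structural assumption (iii) *)
  (mubar_gt0 : forall i, 0 < mubar i)
  (theta0 : R) (theta0_gt0 : 0 < theta0)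
  (pbar_growth : let pbar := dual_variable gradF K Kadj ubar in
     forall i t, `]tbar i - rad, tbar i + rad[%classic t ->
       theta0 * `|t - tbar i| ^+ 2 <= beta - enorm (pbar t))
  (Kadj_Linfty : adjoint_bounded_Linfty T Kadj)
  (* the algorithm *)
  (A : nat -> seq (R * (R * 'rV[R]_d))) (c : nat -> 'rV[R]_d) (that : nat -> R)
  (run : pdaj_run T F gradF K Kadj beta A c that) :
  let u := iterate T A c in
  (exists k, terminates_at T gradF K Kadj beta A c k /\
             ae_eq_on_dom T (u k) ubar)
  \/
  ((forall k, ~ terminates_at T gradF K Kadj beta A c k) /\
   exists zeta C : R, [/\ 0 < zeta < 1, 0 < C &
     \forall k \near \oo,
       residual T F K beta (u k)
       + L1norm T (fun t => u k t - ubar t)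
       + `|Mnorm T (bv_deriv T (u k)) - Mnorm T (bv_deriv T ubar)|
       <= C * zeta ^+ k]).
Proof.
move=> u.
have [cbar cbarP] := ubar_step T_gt0 beta_gt0 ubar_min tbarP mubar_gt0 ubar_deriv.
pose cs k := c k - step_mean T (A k).
have EB := KconstB T_gt0 K_lin; have EZ := KconstZ T_gt0 K_lin.
have dE := dot_Kconst T_gt0 KadjP; have dG := @dot_Kjump _ _ _ T_gt0 _ _ _ _ KadjP.
pose st k := Cnorm T (iterate_dual T gradF K Kadj A c k) <= beta.
pose good k := (0 < k)%N /\ forall l, (0 < l < k)%N -> ~ stops T gradF K Kadj beta A c l.
have adm k : good k -> admissible (dom T) (A k).
  by case=> k0 nst; exact: (run_admissible T_gt0 K_lin KadjP Kadj_Linfty beta_gt0 run).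
have us k : good k -> forall t, dom T t -> u k t = step T (A k) (cs k) t.
  by move=> gk t dt; apply: Bop_atomic => // x /(adm k gk)[].
have stat k : good k -> stationary (gradF := gradF) (beta := beta) T
    (@Kjump R d T Y K) (@Kconst R d Y K) (@dual R d Y Kadj) (A k) (cs k).
  move=> gk; have [k0 nst] := gk.
  apply: (optimal_stationary dotP F_conv F_C1 gradF_lip EB EZ dE dG).
    by move=> x /(adm k gk)[].
  by move=> f c' f0; apply: (run_reweight T_gt0 K_lin KadjP Kadj_Linfty beta_gt0 run).
have [[k kP]|never] := pselect (exists k, terminates_at T gradF K Kadj beta A c k).
  left; exists k; split=> //; have [k0 sk nst] := kP; have gk : good k by [].
  apply: (stop_optimal T_gt0 dotP K_lin KadjP Kadj_Linfty F_conv F_C1 gradF_lip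
    beta_gt0 ubar_min tbarP mubar_gt0 ubar_deriv cbarP sigma_gt0 theta0_gt0
    gamma0_gt0 F_growth indep pbar_far pbar_growth (adm k gk) (us k gk) (stat k gk)).
  move=> t dt; apply: le_trans sk.
  rewrite (iterate_dualE T_gt0 K_lin gradF c (adm k gk)).
  exact: (dual_le_Cnorm T_gt0 KadjP Kadj_Linfty).
have nst l : (0 < l)%N -> ~ stops T gradF K Kadj beta A c l.
  (* The least positive index that passes the test is the index of termination. *)
  move=> l0 sl; apply: never; have ex : exists k, (0 < k)%N && st k.
    by exists l; rewrite l0.
  have [k /andP[k0 sk] mink] := ex_minnP ex; exists k; split=> // j /andP[j0 jk] sj.
  by have := mink j; rewrite j0 /st sj leqNgt jk => /(_ isT).
have gS k : good k.+1 by split => // l /andP[l0 _]; exact: nst.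
right; split=> [k kP|]; first by apply: never; exists k.
have [zeta [C [z01 C0 rate]]] := linear_rate T_gt0 dotP K_lin KadjP Kadj_Linfty F_conv F_C1
  gradF_lip beta_gt0 ubar_min N_gt0 tbarP mubar_gt0 ubar_deriv cbarP sigma_gt0 theta0_gt0
  gamma0_gt0 L_gt0 F_growth indep pbar_far pbar_growth
  (A := fun k => A k.+1) (cs := fun k => cs k.+1) (u := fun k => u k.+1)
  (th := fun k => that k.+1)
  (fun k => adm _ (gS k)) (fun k => us _ (gS k)) (fun k => stat _ (gS k))
  (fun k => run_peak T_gt0 K_lin KadjP Kadj_Linfty beta_gt0 run (ltn0Sn k)
     (fun l hl => nst l (proj1 (andP hl))))
  (fun k f w => run_improves T_gt0 K_lin KadjP Kadj_Linfty beta_gt0 run (ltn0Sn k)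
     (fun l hl => nst l (proj1 (andP hl)))).
have /andP[z0 _] := z01.
(* The rate was obtained for the sequences shifted by one, as the iterates are optimal only from
   index 1 on; dividing by [zeta] undoes the shift. *)
exists zeta, (C / zeta); split=> //; first by rewrite divr_gt0.
exists 1%N => // -[//|k] _; apply: le_trans (rate k) _.
by rewrite exprS mulrA divfK // gt_eqF.
Qed.
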